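(* Let $n\ge2$, $0<p<1$, and let $\Phi:\mathbb{S}^{n-1}\to\mathbb{R}$ be a positive smooth function. Let $\{K_t\}_{t\in[0,T)}$ be a family of smooth, strictly convex bodies in $\mathbb{R}^n$, with the origin in the interior of $K_0$, whose support functions $s(z,t)=s_{K_t}(z)$ satisfy $$\partial_t s(z,t)=\Phi(z)\,S_{n-1}(z,t)^{\frac{p}{n-1}},\qquad (z,t)\in\mathbb{S}^{n-1}\times[0,T).$$ Then the support functions $s^\circ(z,t)=s_{K_t^\circ}(z)$ of the dual bodies $K_t^\circ$ satisfy $$\partial_t s^{\circ}(z,t)=-\Phi\left(\frac{s^{\circ}z+\bar{\nabla}s^{\circ}}{\sqrt{(s^{\circ})^2+|\bar{\nabla}s^{\circ}|^2}}\right)\frac{\left((s^{\circ})^2+|\bar{\nabla}s^{\circ}|^2\right)^{\frac{(n+1)p}{2(n-1)}+\frac12}}{(s^{\circ})^{\frac{(n+1)p}{n-1}-1}}\,\left(S_{n-1}^{\circ}\right)^{-\frac{p}{n-1}}$$ on $\mathbb{S}^{n-1}\times[0,T)$, where $s^\circ$, $\bar\nabla s^\circ$ and $S^\circ_{n-1}$ on the right-hand side are evaluated at $(z,t)$.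
   Context: A convex body is a compact convex subset of $\mathbb{R}^n$ with non-empty interior; its support function is $s_K(z)=\max_{y\in\partial K}\langle z,y\rangle$ for $z\in\mathbb{S}^{n-1}$. ''Smooth, strictly convex'' means the boundary is a smooth hypersurface with positive Gauss curvature. $\bar g$ and $\bar\nabla$ are the standard metric and Levi-Civita connection of $\mathbb{S}^{n-1}$; $\bar\nabla s$ denotes the gradient, viewed as a vector in $\mathbb{R}^n$ tangent to the sphere at $z$. For a smooth strictly convex body with support function $s$, set $S_{n-1}=\det_{\bar g}(\bar\nabla_i\bar\nabla_j s+\bar g_{ij}s)$, which equals the reciprocal of the Gauss curvature at the boundary point with outward unit normal $z$. For a convex body $K$ with the origin in its interior, the dual body is $K^\circ=\{y\in\mathbb{R}^n: x\cdot y\le1\ \forall x\in K\}$; $S_{n-1}^\circ$ is the function $S_{n-1}$ of $K_t^\circ$, i.e. $S_{n-1}^\circ=\det_{\bar g}(\bar\nabla_i\bar\nabla_j s^\circ+\bar g_{ij}s^\circ)$. *)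

(* Defs.v *)
From HB Require Import structures.
From mathcomp Require Import all_boot all_order all_algebra.
From mathcomp Require Import all_classical all_reals all_analysis.

Set Implicit Arguments.
Unset Strict Implicit.
Unset Printing Implicit Defensive.

Import Order.TTheory GRing.Theory Num.Theory.
Import numFieldNormedType.Exports.

Local Open Scope classical_set_scope.
Local Open Scope ring_scope.

Section EuclideanSpace.
Context {R : realType} {n : nat}.
Implicit Types (x y z u v w : 'rV[R]_n) (f phi : 'rV[R]_n -> R).

Definition dot u v : R := (u *m v^T) 0 0.

(* The library norm `|x| on row vectors is the sup norm; it induces the same
   topology and differential calculus, but lengths must be Euclidean. *)
Definition enorm x : R := Num.sqrt (dot x x).

Definition sphere : set 'rV[R]_n := [set z | enorm z = 1].

Definition normalize x : 'rV[R]_n := (enorm x)^-1 *: x.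

Definition grad f x : 'rV[R]_n := \row_i 'D_(delta_mx 0 i) f x.

(* C^infinity on the open set U: all iterated directional derivatives are
   differentiable, hence continuous, on U. *)
Definition smooth_on (U : set 'rV[R]_n) f : Prop :=
  forall vs : seq 'rV[R]_n, forall x, U x ->
    differentiable (foldr (fun v (g : 'rV[R]_n -> R) y => 'D_v g y) f vs) x.

(* Determinant, relative to the induced metric, of the bilinear form h on the
   hyperplane orthogonal to z: det (h(e_i, e_j)) / det (<e_i, e_j>), where the
   e_i are the rows of E, a basis of that hyperplane. The quotient does not
   depend on the basis. *)
Definition det_orth z (h : 'rV[R]_n -> 'rV[R]_n -> R) : R :=
  let E := row_base (kermx z^T) in
  \det (\matrix_(i, j) h (row i E) (row j E)) /
  \det (\matrix_(i, j) dot (row i E) (row j E)).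

End EuclideanSpace.

Section SphereCalculus.
Context {R : realType} {n : nat}.
Implicit Types (z u v w : 'rV[R]_n) (f : 'rV[R]_n -> R).

(* A function on the sphere is represented by a function f on R^n of which only
   the values on the sphere are used: every notion below depends on f through
   f \o normalize, its extension constant along rays. *)
Definition smooth_sphere f : Prop :=
  smooth_on [set x | x != 0] (f \o normalize).

(* Since t |-> normalize (z + t v) is a curve on the sphere with velocity the
   tangential part of v, this is the vector tangent at z representing df. *)
Definition sgrad f z : 'rV[R]_n := grad (f \o normalize) z.

Definition tproj z w : 'rV[R]_n := w - dot w z *: z.

(* The Levi-Civita connection of the sphere: tangential part of the Euclidean
   derivative of the vector field X along the tangent vector u. *)
Definition scov (X : 'rV[R]_n -> 'rV[R]_n) z u : 'rV[R]_n :=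
  tproj z ('D_u (X \o normalize) z).

Definition shess f z u v : R := dot (scov (sgrad f) z u) v.

(* S_{n-1} of the body with support function f. *)
Definition Sn1 f z : R :=
  det_orth z (fun u v => shess f z u v + dot u v * f z).

End SphereCalculus.

Section ConvexBodies.
Context {R : realType} {n : nat}.
Implicit Types (K : set 'rV[R]_n) (x y z : 'rV[R]_n) (phi : 'rV[R]_n -> R).

Definition boundary K : set 'rV[R]_n := closure K `\` interior K.

Definition convex_body K : Prop :=
  [/\ compact K, convex_set K & interior K !=set0].

Definition support_fun K z : R := sup [set dot z y | y in boundary K].

Definition dual_body K : set 'rV[R]_n :=
  [set y | forall x, K x -> dot x y <= 1].

(* phi is a smooth local equation of the boundary of K on U, regular, and
   oriented so that its gradient points out of K. *)
Definition boundary_equation K (U : set 'rV[R]_n) phi : Prop :=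
  [/\ open U, smooth_on U phi,
      forall y, U y -> (boundary K y <-> phi y = 0),
      forall y, U y -> K y -> phi y <= 0 &
      forall y, U y -> boundary K y -> grad phi y != 0].

Definition unit_normal phi y : 'rV[R]_n := normalize (grad phi y).

(* Determinant of the shape operator, i.e. of the differential of the outward
   unit normal field, on the tangent space of the level set of phi at x. *)
Definition gauss_curvature phi x : R :=
  det_orth (unit_normal phi x) (fun u v => dot ('D_u (unit_normal phi) x) v).

Definition smooth_strictly_convex K : Prop :=
  convex_body K /\
  forall x, boundary K x ->
    exists (U : set 'rV[R]_n) (phi : 'rV[R]_n -> R),
      [/\ U x, boundary_equation K U phi & 0 < gauss_curvature phi x].

End ConvexBodies.

(* l is the derivative at t of f, defined on D; one-sided if t is an endpoint
   of the interval D. *)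
Definition is_derive_in {R : realType} (D : set R) (f : R -> R) (t l : R) : Prop :=
  (fun u => (f u - f t) / (u - t)) @ within D t^' --> l.

(* Main.v *)
From HB Require Import structures.
Require Import Defs.
From mathcomp Require Import all_boot all_order all_algebra.
From mathcomp Require Import all_classical all_reals all_analysis.
From mathcomp Require Import ring lra.

Import Order.TTheory GRing.Theory Num.Theory.
Import numFieldNormedType.Exports.

Set Implicit Arguments.
Unset Strict Implicit.
Unset Printing Implicit Defensive.

Local Open Scope classical_set_scope.
Local Open Scope ring_scope.

(** Let h be the support function of a body K with the origin inside, extended
    1-homogeneously, and g that of the dual body. The gradients of h and g are
    the maps sending a direction to the support point in that direction, the
    gradients of h^2/2 and g^2/2 are inverse to each other, and the determinant
    of the Hessian of h^2/2 at a unit vector is h^(n+1) S_(n-1)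
    ([det_homogeneous]). Hence, if z is a unit vector and nu the outward normal
    of K at its boundary point on the ray of z, then g(z) h(nu) = nu . z and
    S_(n-1)(g)(z) g(z)^(n+1) and S_(n-1)(h)(nu) h(nu)^(n+1) are reciprocal
    ([dual_Sn1]); moreover h(nu)^-2 = g(z)^2 + |grad g(z)|^2 with the spherical
    gradient ([dual_sqnorm]), and nu is the normalisation of
    g(z) z + grad g(z). This turns the formula
      d/dt g(z) = - g(z)^2 F(nu) / (nu . z),
    where F = Phi S_(n-1)^(p/(n-1)) is the normal speed, into the claim.

    The formula itself is [dual_derivative]. The inverse of g(z) is the radial
    function r of the body in direction z, and r(u) (nu . z) <= s(nu, u) for all
    times u, with equality at u = t; since s is only known to be differentiable
    in time for each fixed direction, without uniformity in the direction, the
    opposite bound needs a comparison argument. It says that, for c slightly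
    below (after t) or above (before t) the expected speed F(nu) / (nu . z), the
    point (r(t) + (u - t) c) z satisfies the support inequalities of the body at
    time u in all directions.

    For u > t the barrier is the body at time t, shrunk slightly towards
    r(t) z and then translated in direction z ([forward]). Near the direction nu
    it moves more slowly than the flow, and in the other directions it has not
    yet caught up. For u < t, the function
    a |-> s(nu', a^(1-p) t) is concave in a for every direction nu'
    ([time_concave]), so that an affine lower bound for it, which holds at a = 1
    and at some a < 1, holds in between ([backward]).

    Both comparisons use a contact argument: were a competitor w not below s,
    then the maximum k of w / s would exceed 1, and at a point where it is
    attained the time derivative of w is at least k times that of s, while the
    Hessian of w is at most k times that of s ([contact], [contact_time],
    [contact_space]). As the speed is monotone in the Hessian and homogeneous of
    degree p < 1, this is impossible for a subsolution w. That interpolations in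
    a are subsolutions is the concavity of a^(1-p) det(A)^(p/(n-1)) in (a, A)
    ([det_pow_concave]).

    The regularity of h comes from the local equation of the boundary: the
    outward unit normal extends to a local C^1 diffeomorphism defined near a
    boundary point ([normal_chart]), whose tangential determinant is the Gauss
    curvature, and the support point map is its inverse. *)

(** * Euclidean inner product *)

Section InnerProduct.
Context {R : realType} {n : nat}.
Implicit Types (x y z u v w : 'rV[R]_n) (a : R).

Lemma dotE u v : dot u v = \sum_i u 0 i * v 0 i.
Proof. by rewrite /dot mxE; apply: eq_bigr => i _; rewrite mxE. Qed.

Lemma dotC u v : dot u v = dot v u.
Proof. by rewrite !dotE; apply: eq_bigr => i _; rewrite mulrC. Qed.

Lemma dotDl u v w : dot (u + v) w = dot u w + dot v w.
Proof. by rewrite /dot mulmxDl mxE. Qed.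

Lemma dotZl a u v : dot (a *: u) v = a * dot u v.
Proof. by rewrite /dot -scalemxAl mxE. Qed.

Lemma dotDr u v w : dot u (v + w) = dot u v + dot u w.
Proof. by rewrite dotC dotDl !(dotC u). Qed.

Lemma dotZr a u v : dot u (a *: v) = a * dot u v.
Proof. by rewrite dotC dotZl dotC. Qed.

Lemma dotNl u v : dot (- u) v = - dot u v.
Proof. by rewrite -scaleN1r dotZl mulN1r. Qed.

Lemma dotNr u v : dot u (- v) = - dot u v.
Proof. by rewrite dotC dotNl dotC. Qed.

Lemma dotBl u v w : dot (u - v) w = dot u w - dot v w.
Proof. by rewrite dotDl dotNl. Qed.

Lemma dotBr u v w : dot u (v - w) = dot u v - dot u w.
Proof. by rewrite dotDr dotNr. Qed.

Lemma dot0l v : dot 0 v = 0.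
Proof. by rewrite -(scale0r v) dotZl mul0r. Qed.

Lemma dot0r v : dot v 0 = 0.
Proof. by rewrite dotC dot0l. Qed.

Lemma dot_ge0 u : 0 <= dot u u.
Proof. by rewrite dotE; apply: sumr_ge0 => i _; rewrite -expr2 sqr_ge0. Qed.

Lemma dot_eq0 u : (dot u u == 0) = (u == 0).
Proof.
apply/eqP/eqP => [|->]; last exact: dot0l.
rewrite dotE => /eqP; rewrite psumr_eq0; last by move=> i _; rewrite -expr2 sqr_ge0.
move=> /allP h; apply/rowP => i; rewrite mxE; apply/eqP.
by have := h i (mem_index_enum i); rewrite /= mulf_eq0 orbb.
Qed.

Lemma dot_gt0 u : (0 < dot u u) = (u != 0).
Proof. by rewrite lt_neqAle dot_ge0 andbT eq_sym dot_eq0. Qed.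

Lemma enorm_ge0 u : 0 <= enorm u.
Proof. exact: sqrtr_ge0. Qed.

Lemma sqr_enorm u : enorm u ^+ 2 = dot u u.
Proof. by rewrite /enorm sqr_sqrtr // dot_ge0. Qed.

Lemma enorm_gt0 u : (0 < enorm u) = (u != 0).
Proof. by rewrite /enorm sqrtr_gt0 dot_gt0. Qed.

Lemma enormZ a u : enorm (a *: u) = `|a| * enorm u.
Proof.
rewrite /enorm dotZl dotZr mulrA -expr2 sqrtrM ?sqr_ge0//.
by rewrite sqrtr_sqr.
Qed.

(** The Cauchy--Schwarz inequality. *)
Lemma dot_le_enorm u v : dot u v <= enorm u * enorm v.
Proof.
have [->|v0] := eqVneq v 0.
  by rewrite dot0r mulr_ge0 ?enorm_ge0.
have vv : 0 < dot v v by rewrite dot_gt0.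
have h : dot u v ^+ 2 <= dot u u * dot v v.
  have := dot_ge0 (dot v v *: u - dot u v *: v).
  rewrite !(dotBl, dotBr, dotZl, dotZr) (dotC v u).
  set a := dot u u; set b := dot u v; set c := dot v v => h.
  have : 0 <= c * (a * c - b ^+ 2) by move: h; congr (_ <= _); ring.
  by rewrite pmulr_rge0 // subr_ge0.
apply: (@le_trans _ _ `|dot u v|); first exact: ler_norm.
by rewrite -sqrtr_sqr /enorm -sqrtrM ?dot_ge0// ler_wsqrtr.
Qed.

Lemma dot_delta u i : dot u (delta_mx 0 i) = u 0 i.
Proof. by rewrite /dot trmx_delta -colE mxE. Qed.

Lemma dot_mxl u v (A : 'M[R]_n) : dot (u *m A) v = dot u (v *m A^T).
Proof. by rewrite /dot trmx_mul trmxK mulmxA. Qed.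

Lemma sphere_dot u : sphere u -> dot u u = 1.
Proof. by rewrite /sphere /= -sqr_enorm => ->; rewrite expr1n. Qed.

Lemma sphere_neq0 u : sphere u -> u != 0.
Proof. by move=> /sphere_dot h; rewrite -dot_gt0 h ltr01. Qed.

Lemma normalize_sphere u : u != 0 -> sphere (normalize u).
Proof.
by move=> u0; rewrite /sphere /= /normalize enormZ normfV ger0_norm ?enorm_ge0//
  mulVf // gt_eqF // enorm_gt0.
Qed.

Lemma normalize_id u : sphere u -> normalize u = u.
Proof. by rewrite /sphere /= /normalize => ->; rewrite invr1 scale1r. Qed.

Lemma normalizeZ a u : 0 < a -> normalize (a *: u) = normalize u.
Proof.
move=> a0; rewrite /normalize enormZ gtr0_norm // invfM scalerA mulrAC.
by rewrite mulVf ?mul1r // gt_eqF.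
Qed.

End InnerProduct.

(** * Positive definite matrices *)

Section PositiveDefinite.
Context {R : realType}.

(** Positive definite, hence in particular symmetric. *)
Definition posdef n (A : 'M[R]_n) : Prop :=
  A^T = A /\ forall x : 'rV[R]_n, x != 0 -> 0 < dot (x *m A) x.

Lemma dot_row_mx n1 n2 (a c : 'rV[R]_n1) (b d : 'rV[R]_n2) :
  dot (row_mx a b) (row_mx c d) = dot a c + dot b d.
Proof. by rewrite /dot tr_row_mx mul_row_col mxE. Qed.

Lemma dot11 (a b : 'rV[R]_1) : dot a b = a 0 0 * b 0 0.
Proof. by rewrite dotE big_ord1. Qed.

(** The Cholesky factorisation. *)
Lemma cholesky n (A : 'M[R]_n) : posdef A ->
  exists L : 'M[R]_n, is_trig_mx L /\ A = L *m L^T.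
Proof.
elim: n A => [|n IH]; first move=> A _.
  by exists 0; split; [exact: mx0_is_trig | apply/matrixP => - []].
rewrite -[n.+1]/(1 + n)%N => A [As Ap].
rewrite -(@submxK R 1 n 1 n A) in As Ap *.
set a := ulsubmx _ in As Ap *; set b := ursubmx _ in As Ap *.
set b' := dlsubmx _ in As Ap *; set C := drsubmx _ in As Ap *.
have [_ hb _ hC] : [/\ a^T = a, b'^T = b, b^T = b' & C^T = C].
  by move: As; rewrite tr_block_mx => /eq_block_mx[].
rewrite -hb in As Ap *; clearbody a b' C; clear b hb.
have a0 : 0 < a 0 0.
  have := Ap (row_mx 1 0); rewrite mul_row_block !mul0mx !addr0 !mul1mx.
  rewrite dot_row_mx dot0r addr0 dot11 mxE mulr1; apply.
  by apply/eqP => /rowP /(_ (lshift n 0)); rewrite row_mxEl !mxE /= => /eqP; rewrite oner_eq0.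
set s := Num.sqrt (a 0 0).
have s2 : s * s = a 0 0 by rewrite -expr2 sqr_sqrtr // ltW.
have s0 : s != 0 by rewrite gt_eqF // sqrtr_gt0.
have [L [Lt LE]] : exists L : 'M[R]_n, is_trig_mx L /\
    C - (a 0 0)^-1 *: (b' *m b'^T) = L *m L^T.
  apply: IH; split; first by rewrite linearB linearZ /= trmx_mul trmxK hC.
  move=> x x0.
  (* The Schur complement is the form A restricted to the vectors which are
     A-orthogonal to the first coordinate axis. *)
  have := Ap (row_mx (- (a 0 0)^-1 *: (x *m b')) x).
  have nz : row_mx (- (a 0 0)^-1 *: (x *m b')) x != 0.
    apply: contra_neq x0 => h; apply/rowP => i.
    by have /rowP/(_ (rshift 1 i)) := h; rewrite row_mxEr !mxE.
  move=> /(_ nz); rewrite mul_row_block dot_row_mx.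
  have -> : - (a 0 0)^-1 *: (x *m b') *m a + x *m b' = 0.
    apply/rowP => i; rewrite ord1 !mxE big_ord1 !mxE.
    by rewrite mulNr mulNr mulrC mulVKf ?gt_eqF// addNr.
  rewrite dot0l add0r; congr (0 < dot _ _).
  rewrite mulmxBr -scalemxAr -scalemxAl -scaleNr addrC; congr (_ + _ *: _).
  by rewrite mulmxA.
exists (block_mx s%:M 0 (s^-1 *: b') L); split.
  by rewrite is_trig_block_mx // eqxx mx11_is_trig Lt.
rewrite tr_block_mx mulmx_block !trmx0 !mul0mx !mulmx0 !addr0 tr_scalar_mx.
congr block_mx.
- apply/matrixP => i j; rewrite !ord1 !mxE big_ord1 !mxE eqxx !mulr1n s2.
  by [].
- rewrite linearZ /= mul_scalar_mx scalerA mulfV // scale1r //.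
- by rewrite mul_mx_scalar scalerA mulfV // scale1r.
- rewrite -LE linearZ /= -scalemxAl -scalemxAr scalerA -invfM s2.
  by rewrite addrC subrK.
Qed.

Lemma posdef_gt0 n (A : 'M[R]_n) (i : 'I_n) : posdef A -> 0 < A i i.
Proof.
move=> [_ /(_ (delta_mx 0 i))]; rewrite -rowE dot_delta mxE.
apply; apply/eqP => /rowP /(_ i); rewrite !mxE !eqxx => /eqP; rewrite oner_eq0 //.
Qed.

Lemma posdef_unit n (A : 'M[R]_n) : posdef A -> A \in unitmx.
Proof.
move=> [_ Ap]; rewrite -row_free_unit -kermx_eq0; apply/eqP/row_matrixP => i.
rewrite row0; apply/eqP/negPn/negP => /Ap.
by rewrite -row_mul mulmx_ker row0 dot0l ltxx.
Qed.

Lemma posdef_det_gt0 n (A : 'M[R]_n) : posdef A -> 0 < \det A.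
Proof.
move=> Ap; have [L [Lt LE]] := cholesky Ap.
have := posdef_unit Ap; rewrite unitmxE unitfE LE det_mulmx det_tr => h.
by rewrite -expr2 lt_neqAle sqr_ge0 andbT eq_sym expr2.
Qed.

(** Hadamard's inequality. *)
Lemma hadamard n (A : 'M[R]_n) : posdef A -> \det A <= \prod_i A i i.
Proof.
move=> Ap; have [L [Lt ->]] := cholesky Ap.
rewrite det_mulmx det_tr (det_trig Lt) -big_split /=.
apply: ler_prod => i _; rewrite -expr2 sqr_ge0 /= !mxE (bigD1 i) //= mxE -expr2.
by rewrite lerDl sumr_ge0 // => j _; rewrite mxE -expr2 sqr_ge0.
Qed.

Lemma posdef_congr n (A P : 'M[R]_n) : P \in unitmx -> posdef A ->
  posdef (P *m A *m P^T).
Proof.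
move=> Pu [As Ap]; split; first by rewrite !trmx_mul trmxK As mulmxA.
move=> x x0; rewrite !mulmxA dot_mxl trmxK; apply: Ap.
by apply: contra_neq x0 => /(congr1 (mulmx^~ (invmx P))); rewrite mulmxK // mul0mx.
Qed.

Lemma posdef_comb n (A B : 'M[R]_n) (a b : R) : posdef A -> posdef B ->
  0 < a -> 0 <= b -> posdef (a *: A + b *: B).
Proof.
move=> [As Ap] [Bs Bp] a0 b0; split; first by rewrite linearD !linearZ /= As Bs.
move=> x x0; rewrite mulmxDr -!scalemxAr dotDl !dotZl.
by rewrite ltr_wpDr ?mulr_ge0 ?mulr_gt0 ?Ap // ltW ?Bp.
Qed.

(** In suitable coordinates a positive definite form is the standard one. *)
Lemma posdef_whiten n (B : 'M[R]_n) : posdef B ->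
  exists2 P : 'M[R]_n, P \in unitmx & P *m B *m P^T = 1%:M.
Proof.
move=> Bp; have [L [Lt LE]] := cholesky Bp.
have Lu : L \in unitmx.
  by have := posdef_unit Bp; rewrite LE unitmx_mul => /andP[].
exists (invmx L); first by rewrite unitmx_inv.
by rewrite LE !mulmxA mulVmx // mul1mx trmx_inv mulmxV // unitmx_tr.
Qed.

(** A bound on the determinant, relative to that of B, may be proved in the
    coordinates P in which B is the standard form. *)
Lemma det_congr_le n (A P : 'M[R]_n) (c : R) : P \in unitmx ->
  \det (P *m A *m P^T) <= c -> forall B, P *m B *m P^T = 1%:M ->
  \det A <= c * \det B.
Proof.
move=> Pu h B /(congr1 determinant).
move: h; rewrite !det_mulmx det_tr det1 => h hB.
have P0 : \det P != 0 by move: Pu; rewrite unitmxE unitfE.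
have P2 : 0 < \det P * \det P by rewrite -expr2 exprn_even_gt0 //= P0.
have -> : \det B = (\det P * \det P)^-1.
  by apply: (mulfI (lt0r_neq0 P2)); rewrite mulfV ?lt0r_neq0 // -hB; ring.
by rewrite ler_pdivlMr // -[X in X <= _](_ : \det P * \det A * \det P = _) //; ring.
Qed.

Lemma posdef_det_le n (A B : 'M[R]_n) : posdef A -> posdef B ->
  (forall x, dot (x *m A) x <= dot (x *m B) x) -> \det A <= \det B.
Proof.
move=> Ap Bp AB; have [P Pu PE] := posdef_whiten Bp.
rewrite -[leRHS]mul1r; apply: (det_congr_le Pu _ PE).
apply: le_trans (hadamard (posdef_congr Pu Ap)) _.
apply: prodr_ile1 => i; rewrite ltW ?(posdef_gt0 _ (posdef_congr Pu Ap)) //=.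
have E (M : 'M[R]_n) : (P *m M *m P^T) i i = dot (row i P *m M) (row i P).
  by rewrite /dot tr_row -row_mul !mxE; apply: eq_bigr => j _; rewrite !mxE.
rewrite E (le_trans (AB (row i P))) // -E PE mxE eqxx //.
Qed.

(** For positive definite M and A the eigenvalues of M^-1 A are positive, so
   that their product is at most the corresponding power of their mean. *)
Lemma posdef_det_AGM n (A M : 'M[R]_n) : (0 < n)%N -> posdef A -> posdef M ->
  0 < \tr (invmx M *m A) /\
  \det A <= (\tr (invmx M *m A) / n%:R) ^+ n * \det M.
Proof.
move=> n0 Ap Mp; have [P Pu PE] := posdef_whiten Mp.
set X := P *m A *m P^T; have Xp : posdef X by exact: posdef_congr.
have -> : \tr (invmx M *m A) = \tr X.
  have PTu : P^T \in unitmx by rewrite unitmx_tr.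
  have -> : invmx M = P^T *m P.
    have : M = invmx P *m invmx P^T.
      by rewrite -[M](mulKmx Pu) -[P *m M](mulmxK PTu) PE mul1mx.
    move=> ->; have iP : invmx P \in unitmx by rewrite unitmx_inv.
    have iPT : invmx P^T \in unitmx by rewrite unitmx_inv.
    apply: (@row_free_inj _ _ _ _ (invmx P *m invmx P^T)).
      by rewrite row_free_unit unitmx_mul iP iPT.
    rewrite mulVmx ?unitmx_mul ?iP ?iPT // !mulmxA mulmxK // mulmxV //.
  by rewrite /X [RHS]mxtrace_mulC mulmxA.
split.
  rewrite /mxtrace (bigD1 (Ordinal n0)) //= ltr_wpDr ?posdef_gt0 // sumr_ge0 // => i _.
  by rewrite ltW // posdef_gt0.
apply: (det_congr_le Pu _ PE); apply: le_trans (hadamard Xp) _.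
have := @leif_AGM _ _ 'I_n (fun i => X i i) _.
by rewrite card_ord => -[] // i _; rewrite ltW // posdef_gt0.
Qed.

End PositiveDefinite.

(** * Concavity of powers of the determinant *)

Section Concavity.
Context {R : realType}.
Implicit Types (p x y : R).

(** The weighted arithmetic-geometric mean inequality. *)
Lemma weighted_AGM p x y : 0 < p < 1 -> 0 <= x -> 0 <= y ->
  x `^ (1 - p) * y `^ p <= (1 - p) * x + p * y.
Proof.
move=> /andP[p0 p1] x0 y0.
have q0 : 0 < 1 - p by rewrite subr_gt0.
have := @conjugate_powR R (x `^ (1 - p)) (y `^ p) (1 - p)^-1 p^-1.
rewrite !powR_ge0 !invr_gt0 !invrK -!powRrM !mulfV ?gt_eqF // !powRr1 //.
by rewrite subrK (mulrC x) (mulrC y); apply.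
Qed.

(** The function of a positive number a and a positive definite m x m matrix A
    with value a^(1-p) (det A)^(p/m) is concave: it lies below its tangent at
    the barycentre, by the arithmetic-geometric mean inequality for the
    eigenvalues of M^-1 A and the weighted one. *)
Lemma det_pow_concave p m (A0 A1 : 'M[R]_m) (a0 a1 l0 l1 : R) :
  (0 < m)%N -> 0 < p < 1 -> posdef A0 -> posdef A1 ->
  0 < a0 -> 0 < a1 -> 0 < l0 -> 0 < l1 -> l0 + l1 = 1 ->
  l0 * (a0 `^ (1 - p) * \det A0 `^ (p / m%:R)) +
  l1 * (a1 `^ (1 - p) * \det A1 `^ (p / m%:R)) <=
  (l0 * a0 + l1 * a1) `^ (1 - p) *
  \det (l0 *: A0 + l1 *: A1) `^ (p / m%:R).
Proof.
move=> m0 p01 A0p A1p a0p a1p l0p l1p l01; case/andP: (p01) => p0 p1.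
set M := l0 *: A0 + l1 *: A1; set a := l0 * a0 + l1 * a1.
have Mp : posdef M by apply: posdef_comb => //; exact: ltW.
have ap : 0 < a by rewrite addr_gt0 ?mulr_gt0.
have mR : (m%:R : R) != 0 by rewrite pnatr_eq0 -lt0n.
pose t (A : 'M[R]_m) := \tr (invmx M *m A) / m%:R.
pose c := a `^ (1 - p) * \det M `^ (p / m%:R).
have key (A : 'M[R]_m) b : posdef A -> 0 < b ->
    b `^ (1 - p) * \det A `^ (p / m%:R) <= c * ((1 - p) * (b / a) + p * t A).
  move=> Ap b0; have [tr0 dA] := posdef_det_AGM m0 Ap Mp.
  have t0 : 0 <= t A by rewrite divr_ge0 ?ltW // ltr0n.
  have dM : 0 <= \det M by rewrite ltW // posdef_det_gt0.
  have h : \det A `^ (p / m%:R) <= t A `^ p * \det M `^ (p / m%:R).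
    have -> : t A `^ p * \det M `^ (p / m%:R) = (t A ^+ m * \det M) `^ (p / m%:R).
      rewrite [in RHS]powRM ?exprn_ge0 // -powR_mulrn // -powRrM; congr (_ `^ _ * _).
      by rewrite mulrC divfK.
    apply: ge0_ler_powR => //; first by rewrite divr_ge0 ?ler0n // ltW.
      by rewrite nnegrE ltW // posdef_det_gt0.
    by rewrite nnegrE mulr_ge0 ?exprn_ge0.
  apply: le_trans (ler_wpM2l (powR_ge0 _ _) h) _.
  have -> : b `^ (1 - p) = a `^ (1 - p) * (b / a) `^ (1 - p).
    by rewrite -powRM ?ltW ?divr_gt0 // mulrC divfK // gt_eqF.
  have -> : a `^ (1 - p) * (b / a) `^ (1 - p) * (t A `^ p * \det M `^ (p / m%:R))
      = c * ((b / a) `^ (1 - p) * t A `^ p) by rewrite /c; ring.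
  apply: ler_wpM2l; first by rewrite mulr_ge0 ?powR_ge0.
  by apply: weighted_AGM => //; rewrite ltW // divr_gt0.
have e : l0 * t A0 + l1 * t A1 = 1.
  rewrite /t !mulrA -mulrDl -!mxtraceZ !scalemxAr -mxtraceD -mulmxDr.
  by rewrite mulVmx ?posdef_unit // mxtrace1 mulfV.
apply: (@le_trans _ _ (l0 * (c * ((1 - p) * (a0 / a) + p * t A0)) +
                       l1 * (c * ((1 - p) * (a1 / a) + p * t A1)))).
  by apply: lerD; apply: ler_wpM2l; rewrite ?key ?ltW.
rewrite [leLHS](_ : _ = c * ((1 - p) * ((l0 * a0 + l1 * a1) / a) +
  p * (l0 * t A0 + l1 * t A1))); last by ring.
by rewrite e -/a mulfV ?gt_eqF // !mulr1 subrK mulr1.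
Qed.

End Concavity.

(** * Determinants on hyperplanes *)

Section Hyperplane.
Context {R : realType} {n : nat}.
Implicit Types (z u v G : 'rV[R]_n) (B : 'M[R]_n).

(** B is symmetric and positive definite on the orthogonal of z. *)
Definition orth_posdef z B : Prop :=
  B^T = B /\ forall u, u != 0 -> dot u z = 0 -> 0 < dot (u *m B) u.

(** The determinant of the bilinear form with matrix B on the orthogonal of z. *)
Definition det_form z B : R := det_orth z (fun u v => dot (u *m B) v).

Lemma rank_orth z : z != 0 -> \rank (kermx z^T) = n.-1.
Proof. by move=> z0; rewrite mxrank_ker mxrank_tr rank_rV z0 subn1. Qed.

Lemma row_base_orth z : row_base (kermx z^T) *m z^T = 0.
Proof. by apply/sub_kermxP; rewrite eq_row_base. Qed.

Lemma orth_row_base z u : dot u z = 0 ->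
  exists c, u = c *m row_base (kermx z^T).
Proof.
move=> uz; have : (u <= row_base (kermx z^T))%MS.
  by rewrite eq_row_base; apply/sub_kermxP/rowP => i; rewrite ord1 [RHS]mxE.
by move=> /submxP.
Qed.

Lemma form_matrix r (E : 'M[R]_(r, n)) B :
  \matrix_(i, j) dot (row i E *m B) (row j E) = E *m B *m E^T.
Proof.
apply/matrixP => i j; rewrite mxE /dot tr_row -row_mul !mxE.
by apply: eq_bigr => k _; rewrite !mxE.
Qed.

Lemma gram_matrix r (E : 'M[R]_(r, n)) :
  \matrix_(i, j) dot (row i E) (row j E) = E *m E^T.
Proof.
have := form_matrix E 1%:M; rewrite mulmx1 => <-.
by apply/matrixP => i j; rewrite !mxE mulmx1.
Qed.

Lemma det_formE z B : det_form z B =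
  let E := row_base (kermx z^T) in \det (E *m B *m E^T) / \det (E *m E^T).
Proof. by rewrite /det_form /det_orth form_matrix gram_matrix. Qed.

Lemma det_orth_eq z h B :
  (forall u v, dot u z = 0 -> dot v z = 0 -> h u v = dot (u *m B) v) ->
  det_orth z h = det_form z B.
Proof.
move=> hB; rewrite /det_form /det_orth; congr (\det _ / _).
apply/matrixP => i j; rewrite !mxE; apply: hB.
  by rewrite /dot -row_mul row_base_orth row0 mxE.
by rewrite /dot -row_mul row_base_orth row0 mxE.
Qed.

Lemma orth_posdef1 z : orth_posdef z 1%:M.
Proof. by split; [exact: trmx1|move=> u u0 _; rewrite mulmx1 dot_gt0]. Qed.

Lemma orth_posdef_base z B : orth_posdef z B ->
  posdef (row_base (kermx z^T) *m B *m (row_base (kermx z^T))^T).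
Proof.
move=> [Bs Bp]; have := row_base_orth z; have := row_base_free (kermx z^T).
move: (row_base _) => E fE Ez.
split; first by rewrite !trmx_mul trmxK Bs mulmxA.
move=> x x0; rewrite /dot -!mulmxA -trmx_mul !mulmxA; apply: Bp.
  by apply: contra_neq x0 => h; apply: (row_free_inj fE); rewrite h mul0mx.
by rewrite /dot -mulmxA Ez mulmx0 mxE.
Qed.

Lemma gram_det_gt0 z :
  0 < \det (row_base (kermx z^T) *m (row_base (kermx z^T))^T).
Proof.
by have /posdef_det_gt0 := orth_posdef_base (orth_posdef1 z); rewrite mulmx1.
Qed.

Lemma det_form_gt0 z B : orth_posdef z B -> 0 < det_form z B.
Proof.
move=> h; rewrite det_formE divr_gt0 ?gram_det_gt0 //.
exact: posdef_det_gt0 (orth_posdef_base h).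
Qed.

Lemma det_form_le z B B' : orth_posdef z B -> orth_posdef z B' ->
  (forall u, dot u z = 0 -> dot (u *m B) u <= dot (u *m B') u) ->
  det_form z B <= det_form z B'.
Proof.
move=> h h' le; rewrite !det_formE /=.
apply: ler_wpM2r; first by rewrite invr_ge0 ltW // gram_det_gt0.
have := orth_posdef_base h; have := orth_posdef_base h'; have := row_base_orth z.
move: (row_base _) => E Ez P' P.
apply: posdef_det_le P P' _ => x.
rewrite /dot -!mulmxA -trmx_mul !mulmxA; apply: le.
by rewrite /dot -mulmxA Ez mulmx0 mxE.
Qed.

Lemma det_formZ z c B : z != 0 -> det_form z (c *: B) = c ^+ n.-1 * det_form z B.
Proof.
move=> z0; rewrite !det_formE /= -scalemxAr -scalemxAl detZ -(rank_orth z0).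
by rewrite mulrA.
Qed.

Lemma orth_posdefZ z c B : 0 < c -> orth_posdef z B -> orth_posdef z (c *: B).
Proof.
move=> c0 [Bs Bp]; split; first by rewrite linearZ /= Bs.
by move=> u u0 uz; rewrite -scalemxAr dotZl mulr_gt0 ?Bp.
Qed.

Lemma orth_posdefD z B B' : orth_posdef z B -> orth_posdef z B' ->
  orth_posdef z (B + B').
Proof.
move=> [Bs Bp] [Bs' Bp']; split; first by rewrite linearD /= Bs Bs'.
by move=> u u0 uz; rewrite mulmxDr dotDl addr_gt0 ?Bp ?Bp'.
Qed.

Lemma det_form_concave p z B0 B1 (a0 a1 l0 l1 : R) : (1 < n)%N -> z != 0 ->
  0 < p < 1 -> orth_posdef z B0 -> orth_posdef z B1 ->
  0 < a0 -> 0 < a1 -> 0 < l0 -> 0 < l1 -> l0 + l1 = 1 ->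
  l0 * (a0 `^ (1 - p) * det_form z B0 `^ (p / n.-1%:R)) +
  l1 * (a1 `^ (1 - p) * det_form z B1 `^ (p / n.-1%:R)) <=
  (l0 * a0 + l1 * a1) `^ (1 - p) *
  det_form z (l0 *: B0 + l1 *: B1) `^ (p / n.-1%:R).
Proof.
move=> n1 z0 p01 h0 h1 a0p a1p l0p l1p l01.
have h01 : orth_posdef z (l0 *: B0 + l1 *: B1).
  by apply: orth_posdefD; apply: orth_posdefZ.
have := orth_posdef_base h01; have := orth_posdef_base h0.
have := orth_posdef_base h1; have := gram_det_gt0 z.
have m0 : (0 < \rank (kermx z^T))%N by rewrite rank_orth //; case: (n) n1 => [|[]].
rewrite !det_formE /= -(rank_orth z0); move: (row_base _) => E g0 P1 P0 P01.
have E01 : E *m (l0 *: B0 + l1 *: B1) *m E^T =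
    l0 *: (E *m B0 *m E^T) + l1 *: (E *m B1 *m E^T).
  by rewrite mulmxDr mulmxDl -!scalemxAr -!scalemxAl.
rewrite E01 in P01 *.
have gi : 0 <= (\det (E *m E^T))^-1 by rewrite invr_ge0 ltW.
have d0 := ltW (posdef_det_gt0 P0); have d1 := ltW (posdef_det_gt0 P1).
have d01 := ltW (posdef_det_gt0 P01).
rewrite !powRM // !mulrA -mulrDl.
apply: ler_wpM2r; first exact: powR_ge0.
have := det_pow_concave m0 p01 P0 P1 a0p a1p l0p l1p l01.
by rewrite !mulrA.
Qed.

(** The determinant of c B + d z^T z in a basis adapted to the decomposition of
    the space into the orthogonal of z and the line of z; here B is symmetric
    with kernel containing z. *)
Lemma det_hyperplane r (E : 'M[R]_(r, n)) z B (c d : R) : (r + 1)%N = n ->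
  E *m z^T = 0 -> dot z z = 1 -> B^T = B -> z *m B = 0 ->
  \det (c *: B + d *: (z^T *m z)) * \det (E *m E^T) =
  c ^+ r * d * \det (E *m B *m E^T).
Proof.
move=> e; subst n => Ez zz Bs zB.
have Bz : B *m z^T = 0 by rewrite -Bs -trmx_mul zB trmx0.
have zE : z *m E^T = 0 by rewrite -[z]trmxK -trmx_mul Ez trmx0.
have zz1 : z *m z^T = 1%:M.
  by apply/matrixP => i j; rewrite !ord1 [LHS]zz mxE eqxx.
pose P := col_mx E z.
have hP (M : 'M[R]_(r + 1)) : P *m M *m P^T =
    block_mx (E *m M *m E^T) (E *m M *m z^T) (z *m M *m E^T) (z *m M *m z^T).
  by rewrite /P tr_col_mx mul_col_mx mul_col_row.
have h1 := congr1 determinant (hP 1%:M).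
have h2 := congr1 determinant (hP (c *: B + d *: (z^T *m z))).
rewrite !mulmx1 Ez zE zz1 det_lblock det1 mulr1 det_mulmx det_tr in h1.
have e1 : E *m (c *: B + d *: (z^T *m z)) = c *: (E *m B).
  by rewrite mulmxDr -!scalemxAr mulmxA Ez mul0mx scaler0 addr0.
have e2 : z *m (c *: B + d *: (z^T *m z)) = d *: z.
  by rewrite mulmxDr -!scalemxAr mulmxA zB zz1 mul1mx scaler0 add0r.
rewrite e1 e2 -!scalemxAl -(mulmxA E B z^T) Bz mulmx0 zE zz1 !scaler0 det_lblock in h2.
rewrite !detZ det1 expr1 mulr1 !det_mulmx det_tr in h2.
rewrite -h1 [LHS](_ : _ = \det P * \det (c *: B + d *: (z^T *m z)) * \det P).
  by rewrite h2; ring.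
by ring.
Qed.

Lemma det_form_full z B (c d : R) : sphere z -> B^T = B -> z *m B = 0 ->
  \det (c *: B + d *: (z^T *m z)) = c ^+ n.-1 * d * det_form z B.
Proof.
move=> zS Bs zB; have z0 := sphere_neq0 zS.
have n0 : (0 < n)%N.
  rewrite lt0n; apply: contra_neq z0 => n0; apply/rowP => - [i hi].
  by have := leq_trans hi (eq_leq n0).
have e : (\rank (kermx z^T) + 1)%N = n by rewrite rank_orth // addn1 prednK.
have := det_hyperplane c d e (row_base_orth z) (sphere_dot zS) Bs zB.
rewrite det_formE /= -(rank_orth z0) mulrA => <-.
by rewrite mulfK // gt_eqF // gram_det_gt0.
Qed.

(** The matrix determinant lemma: both sides are the determinant of the same
    bordered matrix X. *)
Lemma det_rank1 (u w : 'rV[R]_n) : \det (1%:M + u^T *m w) = 1 + dot w u.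
Proof.
pose X := block_mx (1%:M : 'M[R]_1) (- w) u^T 1%:M.
have e1 : X = block_mx 1%:M 0 u^T 1%:M *m block_mx 1%:M (- w) 0 (1%:M + u^T *m w).
  rewrite mulmx_block !mul1mx !mulmx1 !mul0mx !addr0 mulmxN.
  by rewrite addrCA addNr addr0.
have e2 : X = block_mx (1%:M + w *m u^T) (- w) 0 1%:M *m block_mx 1%:M 0 u^T 1%:M.
  rewrite mulmx_block !mul1mx !mulmx1 !mul0mx ?mulmx0 !add0r mulNmx.
  by rewrite addrK.
have : \det X = \det X by [].
rewrite {1}e1 e2 !det_mulmx !det_lblock !det_ublock !det1 !mul1r !mulr1 => ->.
by rewrite det_mx11 !mxE eqxx /dot mxE.
Qed.

(** When B is the Hessian at z of a 1-homogeneous function h with gradient G,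
    the matrix on the left is the Hessian of h^2/2 and dot G z = h(z). *)
Lemma det_homogeneous z B G : (0 < n)%N -> sphere z -> B^T = B -> z *m B = 0 ->
  0 < dot G z ->
  \det (dot G z *: B + G^T *m G) = dot G z ^+ n.+1 * det_form z B.
Proof.
move=> n0 zS Bs zB; set s := dot G z => s0.
have sn0 : s != 0 by rewrite gt_eqF.
have zz := sphere_dot zS.
have Bz : B *m z^T = 0 by rewrite -Bs -trmx_mul zB trmx0.
(* U is unimodular and maps z to a multiple of G, while it does not affect B. *)
pose w := s^-1 *: G - z.
have wz : dot w z = 0 by rewrite dotBl dotZl zz mulVf // subrr.
pose U := 1%:M + z^T *m w.
have dU : \det U = 1 by rewrite det_rank1 wz addr0.
have BU : B *m U = B by rewrite mulmxDr mulmx1 mulmxA Bz mul0mx addr0.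
have zU : z *m U = s^-1 *: G.
  rewrite mulmxDr mulmx1 mulmxA; have -> : z *m z^T = 1%:M.
    by apply/matrixP => i j; rewrite !ord1 [LHS]zz mxE eqxx.
  by rewrite mul1mx addrC subrK.
clearbody U.
have UB : U^T *m B = B by rewrite -{1}Bs -trmx_mul BU Bs.
have e : U^T *m (s *: B + s ^+ 2 *: (z^T *m z)) *m U = s *: B + G^T *m G.
  rewrite mulmxDr mulmxDl -!scalemxAr -!scalemxAl UB BU; congr (_ + _).
  rewrite mulmxA -trmx_mul zU -mulmxA zU [(_ *: _)^T]linearZ /= -scalemxAl -scalemxAr.
  rewrite !scalerA [X in X *: _](_ : _ = 1) ?scale1r //.
  by rewrite expr2 mulfK // mulfV.
rewrite -e !det_mulmx det_tr dU mul1r mulr1 det_form_full //.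
by rewrite -exprD addn2 prednK.
Qed.

End Hyperplane.

(** * Gradients and Jacobian matrices *)

Section FrechetDerivative.
Context {R : realType} {V W : normedModType R}.

Lemma is_diff_epsP (f : V -> W) (df : {linear V -> W}) x : continuous df ->
  is_diff x f df <-> forall e, 0 < e ->
    \forall y \near x, `|f y - f x - df (y - x)| <= e * `|y - x|.
Proof.
move=> dfc; split=> [h e e0|h].
  have /diff_locally := @ex_diff _ _ _ _ _ _ _ h.
  rewrite (@diff_val _ _ _ _ _ _ _ h) => /eqaddoP /(_ e e0).
  rewrite [X in _ -> X](near_shift 0) /=; apply: filter_app; near=> y => /=.
  by rewrite !fctE /= subr0 addrK opprD addrA.
have E : f \o shift x = cst (f x) + df +o_ 0 id.
  apply/eqaddoP => e e0.
  have := h e e0; rewrite [X in X -> _](near_shift 0) /=.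
  apply: filter_app; near=> y => /=.
  by rewrite !fctE /= subr0 addrK opprD addrA.
have d : 'd f x = df :> (_ -> _) by exact: diff_unique E.
by constructor => //; apply/diff_locallyP; rewrite d.
Unshelve. all: by end_near. Qed.

End FrechetDerivative.

Section Gradient.
Context {R : realType} {n : nat}.
Implicit Types (x y z u v w g : 'rV[R]_n) (f : 'rV[R]_n -> R).

Lemma coord_le_norm m k (A : 'M[R]_(m, k)) i j : `|A i j| <= `|A|.
Proof. by rewrite [leRHS]mx_normrE (le_bigmax _ _ (i, j)). Qed.

Lemma norm_le_coord m k (A : 'M[R]_(m, k)) e : 0 <= e ->
  (forall i j, `|A i j| <= e) -> `|A| <= e.
Proof. by move=> e0 h; rewrite [leLHS]mx_normrE bigmax_le. Qed.

Lemma dot_le_norm u v : `|dot u v| <= n%:R * `|u| * `|v|.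
Proof.
rewrite dotE (le_trans (ler_norm_sum _ _ _)) //.
apply: (@le_trans _ _ (\sum_(i < n) `|u| * `|v|)).
  by apply: ler_sum => i _; rewrite normrM ler_pM ?coord_le_norm.
by rewrite sumr_const card_ord -mulrA mulr_natl.
Qed.

Lemma norm_le_enorm u : `|u| <= enorm u.
Proof.
apply: norm_le_coord => [|i j]; first exact: enorm_ge0.
rewrite ord1 -sqrtr_sqr ler_wsqrtr // dotE (bigD1 j) //= -expr2 lerDl.
by apply: sumr_ge0 => k _; rewrite -expr2 sqr_ge0.
Qed.

Lemma cvg_dot (T : Type) (F : set_system T) (FF : Filter F)
    (a b : T -> 'rV[R]_n) (u v : 'rV[R]_n) :
  a @ F --> u -> b @ F --> v -> dot (a t) (b t) @[t --> F] --> dot u v.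
Proof.
move=> au bv; rewrite dotE.
under eq_fun do rewrite dotE.
apply: cvg_big => [|i _]; first exact: add_continuous.
apply: cvgM.
  exact: (@continuous_cvg _ _ _ F FF a (fun M : 'rV[R]_n => M 0 i) u
    (@coord_continuous R 1 n 0 i u) au).
exact: (@continuous_cvg _ _ _ F FF b (fun M : 'rV[R]_n => M 0 i) v
  (@coord_continuous R 1 n 0 i v) bv).
Qed.

Lemma near_norm_lt x e : 0 < e -> \forall y \near x, `|y - x| < e.
Proof.
move=> e0; apply/nbhs_ballP; exists e => // y.
by rewrite -ball_normE /ball_ /= distrC.
Qed.

(** The vector g is the gradient at x of f, which is differentiable at x, in the
    sense of the Euclidean inner product. *)
Definition has_grad f x g : Prop := forall e, 0 < e ->
  \forall y \near x, `|f y - f x - dot (y - x) g| <= e * `|y - x|.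

(** The linear form represented by g. *)
Definition dotl g v : R := dot v g.

Lemma dotl_linear g : linear_for *%R (dotl g).
Proof. by move=> a u v; rewrite /dotl dotDl dotZl. Qed.

HB.instance Definition _ g :=
  GRing.isLinear.Build R 'rV[R]_n R *%R (dotl g) (dotl_linear g).

Lemma dotl_continuous g : continuous (dotl g).
Proof.
move=> x; apply: (@cvg_dot _ (nbhs x) _ id (cst g) x g); first exact: cvg_id.
exact: cvg_cst.
Qed.

Lemma has_gradP f x g : has_grad f x g <-> is_diff x f (dotl g).
Proof.
by rewrite is_diff_epsP //; exact: dotl_continuous.
Qed.

Lemma has_grad_continuous f x g : has_grad f x g -> {for x, continuous f}.
Proof. by move=> /has_gradP h; apply: differentiable_continuous. Qed.

Lemma has_grad_derive f x g v : has_grad f x g -> is_derive x v f (dot v g).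
Proof.
move=> /has_gradP h; apply: DeriveDef; first exact: diff_derivable.
by rewrite deriveE // diff_val.
Qed.

Lemma differentiable_has_grad f x : differentiable f x -> has_grad f x (grad f x).
Proof.
move=> d; apply/has_gradP; apply: DiffDef => //; apply/funext => v.
rewrite /dotl dotE [in LHS](row_sum_delta v) linear_sum /=.
by apply: eq_bigr => i _; rewrite linearZ /= mxE deriveE.
Qed.

Lemma has_grad_ext f f' x g : (\forall y \near x, f y = f' y) ->
  has_grad f x g -> has_grad f' x g.
Proof.
move=> ff' h e e0; have fx := nbhs_singleton ff'.
have := h e e0; apply: filter_app; apply: filter_app ff'.
by near=> y => -> ; rewrite fx.
Unshelve. all: by end_near. Qed.

Lemma has_gradM f f' x g g' : has_grad f x g -> has_grad f' x g' ->
  has_grad (fun y => f y * f' y) x (f x *: g' + f' x *: g).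
Proof.
move=> /has_gradP h /has_gradP h'; apply/has_gradP.
apply: (@is_diff_eq _ _ _ _ (f x *: dotl g' + f' x *: dotl g)).
by apply/funext => v; rewrite /dotl dotDr !dotZr.
Qed.

Lemma has_gradD f f' x g g' : has_grad f x g -> has_grad f' x g' ->
  has_grad (fun y => f y + f' y) x (g + g').
Proof.
move=> /has_gradP h /has_gradP h'; apply/has_gradP.
apply: (@is_diff_eq _ _ _ _ (dotl g + dotl g')).
by apply/funext => v; rewrite /dotl dotDr.
Qed.

Lemma has_gradZ f x g c : has_grad f x g -> has_grad (fun y => c * f y) x (c *: g).
Proof.
move=> /has_gradP h; apply/has_gradP.
apply: (@is_diff_eq _ _ _ _ (c *: dotl g)).
by apply/funext => v; rewrite /dotl dotZr.
Qed.

Lemma has_grad_cst c x : has_grad (fun=> c) x 0.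
Proof.
by move=> e e0; near=> y; rewrite subrr dot0r subrr normr0 mulr_ge0 // ltW.
Unshelve. all: by end_near. Qed.

Lemma has_grad_comp (h : R -> R) f x g l : has_grad f x g ->
  is_derive (f x) 1 h l -> has_grad (fun y => h (f y)) x (l *: g).
Proof.
move=> /has_gradP hf hh; apply/has_gradP.
have dh : is_diff (f x) h (fun t => t *: l).
  have dd : differentiable h (f x) by apply/derivable1_diffP; exact: ex_derive.
  by apply: DiffDef => //; rewrite deriv1E // derive1E derive_val.
apply: is_diff_eq; apply/funext => v.
by rewrite /= /dotl dotZr -[LHS]/(_ * _) mulrC.
Qed.

Lemma has_gradV f x g : f x != 0 -> has_grad f x g ->
  has_grad (fun y => (f y)^-1) x (- (f x) ^- 2 *: g).
Proof.
move=> f0 h; apply: (has_grad_comp (h := GRing.inv)) => //.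
have := @is_deriveV R id (f x) 1 1 f0 (is_derive_id _ _).
by rewrite [_ *: _]mulr1.
Qed.

Lemma has_grad_sqnorm x : has_grad (fun y => dot y y) x (2 *: x).
Proof.
move=> e e0; near=> y.
have -> : dot y y - dot x x - dot (y - x) (2 *: x) = dot (y - x) (y - x).
  by rewrite !(dotBl, dotBr, dotZr) (dotC x y); ring.
apply: le_trans (dot_le_norm _ _) _; apply: ler_wpM2r => //.
apply: (@le_trans _ _ ((n%:R + 1) * `|y - x|)).
  by apply: ler_wpM2r => //; rewrite lerDl.
have n1 : 0 < n%:R + 1 :> R by rewrite ltr_wpDl ?ler0n.
rewrite -ler_pdivlMl // mulrC ltW //; near: y.
by apply: near_norm_lt; rewrite divr_gt0.
Unshelve. all: by end_near. Qed.

Lemma has_grad_enorm x : x != 0 -> has_grad enorm x ((enorm x)^-1 *: x).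
Proof.
move=> x0; have xx : 0 < dot x x by rewrite dot_gt0.
have := has_grad_comp (h := @Num.sqrt R) (has_grad_sqnorm x) (is_derive1_sqrt xx).
by rewrite scalerA -/(enorm x) invfM mulrAC mulVf ?mul1r.
Qed.

Lemma cvg_ray x w : (x + s *: w) @[s --> (0 : R)^'+] --> x.
Proof.
have : (x + s *: w) @[s --> (0 : R)] --> x + 0 *: w.
  by apply: cvgD; [exact: cvg_cst|apply: cvgZr_tmp].
by rewrite scale0r addr0; apply: cvg_trans; apply: cvg_app; exact: cvg_within.
Qed.

(** First-order descent: f decreases along w when the slope is negative. *)
Lemma descent f x g w : has_grad f x g -> dot w g < 0 ->
  \forall s \near (0 : R)^'+, f (x + s *: w) < f x.
Proof.
move=> h wg.
have w0 : w != 0 by apply: contraTneq wg => ->; rewrite dot0l ltxx.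
have nw : 0 < `|w| by rewrite normr_gt0.
pose e := - dot w g / (2 * `|w|).
have e0 : 0 < e by rewrite divr_gt0 ?mulr_gt0 // oppr_gt0.
have c := @cvg_ray x w.
have hs : \forall s \near (0 : R)^'+,
    `|f (x + s *: w) - f x - dot (x + s *: w - x) g| <= e * `|x + s *: w - x|.
  exact: c _ (h e e0).
near=> s.
have s0 : 0 < s by near: s; exact: nbhs_right_gt.
have : `|f (x + s *: w) - f x - dot (x + s *: w - x) g| <= e * `|x + s *: w - x|.
  by near: s.
have -> : x + s *: w - x = s *: w by rewrite addrAC subrr add0r.
rewrite dotZl normrZ gtr0_norm // => /ler_normlP [_].
have -> : e * (s * `|w|) = - (s * dot w g) / 2.
  by rewrite /e; field; rewrite gt_eqF.
have : s * dot w g < 0 by rewrite pmulr_rlt0.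
lra.
Unshelve. all: by end_near. Qed.

Lemma min_grad0 f x g : has_grad f x g -> (\forall y \near x, f x <= f y) -> g = 0.
Proof.
move=> h m; apply/eqP/negPn/negP => g0.
have d : dot (- g) g < 0 by rewrite dotNl oppr_lt0 dot_gt0.
have c := @cvg_ray x (- g).
have h1 := descent h d; have h2 := c _ m.
have /= [s [h3 h4]] := @filter_ex _ _ (at_right_proper_filter (0:R)) _ (filterI h1 h2).
by move: h3; rewrite ltNge h4.
Qed.

(** Two linear conditions, one implying the other: a vector is a nonnegative
    multiple of g if it has nonpositive product with all w such that
    dot w g < 0. *)
Lemma halfspace g m : g != 0 ->
  (forall w, dot w g < 0 -> dot w m <= 0) ->
  exists2 a, 0 <= a & m = a *: g.
Proof.
move=> g0 h; have gg : 0 < dot g g by rewrite dot_gt0.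
pose a := dot m g / dot g g; exists a.
  apply: divr_ge0; last exact: ltW.
  by have := h (- g); rewrite !dotNl oppr_lt0 gg oppr_le0 dotC; apply.
apply/eqP; rewrite -subr_eq0 -dot_eq0; set r := m - a *: g.
have rg : dot r g = 0 by rewrite dotBl dotZl /a divfK ?subrr // gt_eqF.
have me : m = r + a *: g by rewrite subrK.
clearbody r.
have rm : dot r m = dot r r by rewrite me dotDr dotZr rg mulr0 addr0.
rewrite eq_le dot_ge0 andbT leNgt; apply/negP => rr.
(* Tilt r slightly towards -g. *)
pose d := dot r r / (2 * (`|dot g m| + 1)).
have dp : 0 < `|dot g m| + 1 by rewrite ltr_wpDl.
have d0 : 0 < d by rewrite divr_gt0 // mulr_gt0.
have := h (r - d *: g); rewrite !dotBl !dotZl rg rm sub0r oppr_lt0 mulr_gt0 //.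
move=> /(_ isT); apply/negP; rewrite -ltNge subr_gt0.
apply: (@le_lt_trans _ _ (d * (`|dot g m| + 1))).
  by rewrite ler_pM2l // (le_trans (ler_norm _)) // lerDl.
rewrite /d invfM mulrA mulfVK ?gt_eqF // ; lra.
Qed.

Lemma is_derive_line f x u (s : R) g : has_grad f (x + s *: u) g ->
  is_derive s 1 (fun s => f (x + s *: u)) (dot u g).
Proof.
move=> /(has_grad_derive u) [d v].
have E : (fun h : R => h^-1 *: (((fun s => f (x + s *: u)) \o shift s) (h *: 1) -
      f (x + s *: u))) =
    (fun h => h^-1 *: ((f \o shift (x + s *: u)) (h *: u) - f (x + s *: u))).
  apply/funext => h /=; congr (_ *: (f _ - _)).
  by rewrite scalerDl [in LHS]addrCA -[h *: 1]/(h * 1) mulr1.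
by split; rewrite /derivable /derive E.
Qed.

End Gradient.

Section Jacobian.
Context {R : realType} {n m : nat}.
Implicit Types (x y z u v : 'rV[R]_n) (F : 'rV[R]_n -> 'rV[R]_m) (A : 'M[R]_(n, m)).

(** A is the Jacobian matrix of F at x, acting on row vectors. *)
Definition has_jac F x A : Prop := forall e, 0 < e ->
  \forall y \near x, `|F y - F x - (y - x) *m A| <= e * `|y - x|.

Lemma mulmx_coord v A j : (v *m A) 0 j = dot v (col j A)^T.
Proof. by rewrite /dot trmxK !mxE; apply: eq_bigr => i _; rewrite mxE. Qed.

Lemma mulmx_bound A : exists2 c, 0 < c & forall v, `|v *m A| <= c * `|v|.
Proof.
exists (n%:R * `|A| + 1) => [|v]; first by rewrite ltr_wpDl ?mulr_ge0 ?ler0n.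
have c0 : 0 <= n%:R * `|A| by rewrite mulr_ge0 ?ler0n.
apply: norm_le_coord => [|i j]; first by rewrite mulr_ge0 // addr_ge0.
rewrite ord1 mulmx_coord (le_trans (dot_le_norm _ _)) //.
rewrite mulrAC ler_wpM2r // -[leLHS]addr0 lerD // ler_wpM2l ?ler0n //.
by apply: norm_le_coord => // k l; rewrite !mxE coord_le_norm.
Qed.

Lemma has_jacP F x A : has_jac F x A <->
  forall j, has_grad (fun y => F y 0 j) x (col j A)^T.
Proof.
have E y j : F y 0 j - F x 0 j - dot (y - x) (col j A)^T =
    (F y - F x - (y - x) *m A) 0 j by rewrite -mulmx_coord !mxE.
split=> [h j e e0|h e e0].
  have := h e e0; apply: filter_app; near=> y; apply: le_trans.
  by rewrite E coord_le_norm.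
have hj : \forall y \near x, forall j,
    `|F y 0 j - F x 0 j - dot (y - x) (col j A)^T| <= e * `|y - x|.
  exact: (@filter_forall _ _ (fun j y =>
    `|F y 0 j - F x 0 j - dot (y - x) (col j A)^T| <= e * `|y - x|) (nbhs x) _
    (fun j => h j e e0)).
apply: filter_app hj; near=> y => hj.
apply: norm_le_coord => [|i j]; first by rewrite mulr_ge0 // ltW.
by rewrite ord1 -E.
Unshelve. all: by end_near. Qed.

Lemma has_jac_derive F x A u : has_jac F x A -> is_derive x u F (u *m A).
Proof.
move=> /has_jacP h.
have d : derivable F x u.
  apply/derivable_mxP => i j; rewrite ord1.
  exact: (@ex_derive _ _ _ _ _ _ _ (has_grad_derive u (h j))).
split=> //; rewrite derive_mx //; apply/rowP => j; rewrite mxE mulmx_coord.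
exact: (@derive_val _ _ _ _ _ _ _ (has_grad_derive u (h j))).
Qed.

Lemma has_jac_unique F x A A' : has_jac F x A -> has_jac F x A' -> A = A'.
Proof.
move=> h h'; apply/row_matrixP => i; rewrite !rowE.
rewrite -(@derive_val _ _ _ _ _ _ _ (has_jac_derive (delta_mx 0 i) h)).
by rewrite -(@derive_val _ _ _ _ _ _ _ (has_jac_derive (delta_mx 0 i) h')).
Qed.

Lemma has_jac_lip F x A : has_jac F x A ->
  exists2 c, 0 < c & \forall y \near x, `|F y - F x| <= c * `|y - x|.
Proof.
move=> h; have [c c0 cA] := mulmx_bound A; exists (c + 1); first exact: addr_gt0.
have := h 1 ltr01; apply: filter_app; near=> y => hy.
rewrite -[F y - F x](subrK ((y - x) *m A)) (le_trans (ler_normD _ _)) //.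
by rewrite mulrDl addrC lerD.
Unshelve. all: by end_near. Qed.

Lemma has_jac_continuous F x A : has_jac F x A -> {for x, continuous F}.
Proof.
move=> /has_jac_lip [c c0 h].
suff: F y @[y --> x] --> F x by [].
have FF : Filter (nbhs x) by exact: nbhs_filter.
apply/cvgrPdist_lt => e e0.
have hn : \forall y \near x, `|y - x| < e / c by apply: near_norm_lt; rewrite divr_gt0.
near=> y; have h1 : `|F y - F x| <= c * `|y - x| by near: y.
have h2 : `|y - x| < e / c by near: y.
by rewrite distrC (le_lt_trans h1) // mulrC -ltr_pdivlMr.
Unshelve. all: by end_near. Qed.

Lemma has_jac_ext F F' x A : (\forall y \near x, F y = F' y) ->
  has_jac F x A -> has_jac F' x A.
Proof.
move=> ff' h e e0; have fx := nbhs_singleton ff'.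
have := h e e0; apply: filter_app; apply: filter_app ff'.
by near=> y => -> ; rewrite fx.
Unshelve. all: by end_near. Qed.

Lemma has_jacZ f F x g A : has_grad f x g -> has_jac F x A ->
  has_jac (fun y => f y *: F y) x (g^T *m F x + f x *: A).
Proof.
move=> h /has_jacP hF; apply/has_jacP => j.
have := has_gradM h (hF j).
have -> : (fun y => (f y *: F y) 0 j) = (fun y => f y * F y 0 j).
  by apply/funext => y; rewrite mxE.
congr (has_grad _ _ _); apply/rowP => i; rewrite !mxE big_ord1 !mxE.
by rewrite addrC [in RHS]mulrC.
Qed.

Lemma has_jacD F F' x A A' : has_jac F x A -> has_jac F' x A' ->
  has_jac (fun y => F y + F' y) x (A + A').
Proof.
move=> /has_jacP h /has_jacP h'; apply/has_jacP => j.
have := has_gradD (h j) (h' j).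
have -> : (fun y => (F y + F' y) 0 j) = (fun y => F y 0 j + F' y 0 j).
  by apply/funext => y; rewrite mxE.
by congr (has_grad _ _ _); apply/rowP => i; rewrite !mxE.
Qed.

Lemma has_jac_cst c x : has_jac (fun=> c) x 0.
Proof.
by move=> e e0; near=> y; rewrite subrr mulmx0 subrr normr0 mulr_ge0 // ltW.
Unshelve. all: by end_near. Qed.

(** The derivative of a function which is constant along rays. *)
Lemma has_jac_ray F x A c : 0 < c -> (forall y, F (c *: y) = F y) ->
  has_jac F x A -> has_jac F (c *: x) (c^-1 *: A).
Proof.
move=> c0 hF h e e0; have c1 : c != 0 by rewrite gt_eqF.
have FF : Filter (nbhs (c *: x)) by exact: nbhs_filter.
have cv : (c^-1 *: y) @[y --> c *: x] --> x.
  have : (c^-1 *: y) @[y --> c *: x] --> c^-1 *: (c *: x).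
    by apply: cvgZ; [exact: cvg_cst|exact: cvg_id].
  by rewrite scalerA mulVf // scale1r.
have h1 : \forall y \near c *: x,
    `|F (c^-1 *: y) - F x - (c^-1 *: y - x) *m A| <= e * c * `|c^-1 *: y - x|.
  exact: cv _ (h (e * c) (mulr_gt0 e0 c0)).
apply: filter_app h1; near=> y.
have -> : F (c^-1 *: y) = F y by rewrite -hF scalerA mulfV // scale1r.
have -> : c^-1 *: y - x = c^-1 *: (y - c *: x).
  by rewrite scalerBr scalerA mulVf // scale1r.
have -> : `|c^-1 *: (y - c *: x)| = c^-1 * `|y - c *: x|.
  by rewrite normrZ gtr0_norm // invr_gt0.
by rewrite hF mulrA mulfK // -scalemxAl -scalemxAr.
Unshelve. all: by end_near. Qed.

End Jacobian.

Section SquareJacobian.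
Context {R : realType} {n : nat}.
Implicit Types (x y z u v : 'rV[R]_n) (F G : 'rV[R]_n -> 'rV[R]_n) (A B : 'M[R]_n).

Lemma has_jac_id x : has_jac id x 1%:M.
Proof.
move=> e e0; near=> y.
by rewrite mulmx1 subrr normr0 mulr_ge0 // ltW.
Unshelve. all: by end_near. Qed.

(** A continuous local right inverse G (up to a differentiable change T) of a
    map F with invertible derivative is differentiable. *)
Lemma has_jac_inverse F G (T : 'rV[R]_n -> 'rV[R]_n) x J A :
  has_jac F (G x) J -> J \in unitmx -> {for x, continuous G} ->
  (\forall y \near x, F (G y) = T y) -> has_jac T x A ->
  has_jac G x (A *m invmx J).
Proof.
move=> hF Ju cG FG hT.
have [c c0 hc] := mulmx_bound (invmx J).
have [d d0 hd] := has_jac_lip hT.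
have FGx := nbhs_singleton FG.
have base e : 0 < e -> \forall y \near x,
    `|T y - T x - (G y - G x) *m J| <= e * `|G y - G x|.
  move=> e0; have h1 : \forall y \near x,
      `|F (G y) - F (G x) - (G y - G x) *m J| <= e * `|G y - G x|.
    exact: cG _ (hF e e0).
  by apply: filter_app h1; apply: filter_app FG; near=> y => ->; rewrite FGx.
have solve y : G y - G x =
    (T y - T x) *m invmx J - (T y - T x - (G y - G x) *m J) *m invmx J.
  by rewrite (mulmxBl (T y - T x) (_ *m J)) mulmxK // subKr.
have lip : \forall y \near x, `|G y - G x| <= 2 * c * d * `|y - x|.
  have e0 : 0 < (2 * c)^-1 by rewrite invr_gt0 mulr_gt0.
  apply: filter_app (filterI (base _ e0) hd); near=> y => -[h1 h2].
  have h3 : `|G y - G x| <= c * (d * `|y - x|) + c * ((2 * c)^-1 * `|G y - G x|).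
    rewrite {1}solve (le_trans (ler_normB _ _)) // lerD //.
      by rewrite (le_trans (hc _)) // ler_pM2l.
    by rewrite (le_trans (hc _)) // ler_pM2l.
  have e1 : c * ((2 * c)^-1 * `|G y - G x|) = `|G y - G x| / 2.
    by field; rewrite gt_eqF.
  rewrite e1 in h3; rewrite -!mulrA; lra.
move=> e e0.
pose e1 := e / (2 * c); pose e2 := e1 / (2 * c * d).
have e10 : 0 < e1 by rewrite divr_gt0 // mulr_gt0.
have e20 : 0 < e2 by rewrite divr_gt0 // !mulr_gt0.
apply: filter_app (filterI lip (filterI (base _ e20) (hT _ e10))).
near=> y => -[h1 [h2 h3]].
have -> : G y - G x - (y - x) *m (A *m invmx J) =
    (T y - T x - (y - x) *m A) *m invmx J
    - (T y - T x - (G y - G x) *m J) *m invmx J.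
  rewrite {1}(solve y) mulmxA (mulmxBl (T y - T x) (_ *m A)).
  by rewrite addrAC.
rewrite (le_trans (ler_normB _ _)) //.
have -> : e * `|y - x| = c * (e1 * `|y - x|) + c * (e1 * `|y - x|).
  by rewrite /e1; field; rewrite gt_eqF.
apply: lerD; apply: le_trans (hc _) _; rewrite ler_pM2l //.
apply: le_trans h2 _; rewrite /e2 mulrAC ler_pdivrMr ?mulr_gt0 //.
by rewrite -(mulrA e1 `|y - x|) ler_pM2l // [leRHS]mulrC.
Unshelve. all: by end_near. Qed.

Lemma jac_line_bound G x B u v e : has_jac G x B -> 0 < e ->
  \forall h \near (0 : R)^'+, forall s, 0 <= s <= h -> forall c, c = 0 \/ c = h ->
    `|G (x + s *: u + c *: v) - G x - (s *: u + c *: v) *m B| <= e * h.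
Proof.
move=> hG e0; set k := `|u| + `|v| + 1.
have k0 : 0 < k by rewrite ltr_wpDl ?addr_ge0.
have /nbhs_ballP [d d0 hd] := hG _ (divr_gt0 e0 k0).
near=> h => s /andP[s0 sh] c hc.
have h0 : 0 < h by near: h; exact: nbhs_right_gt.
have hd' : h < d / k by near: h; apply: nbhs_right_lt; rewrite divr_gt0.
have ch : `|c| <= h by case: hc => ->; rewrite ?normr0 ?gtr0_norm // ltW.
have le : `|s *: u + c *: v| <= h * k.
  rewrite (le_trans (ler_normD _ _)) // !normrZ ger0_norm // /k !mulrDr mulr1.
  apply: ler_wpDr; first exact: ltW.
  by apply: lerD; apply: ler_wpM2r.
have := hd (x + s *: u + c *: v).
have E : x + s *: u + c *: v - x = s *: u + c *: v.
  by rewrite -[x + _ + _]addrA (addrC x) addrK.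
rewrite /= E; move=> H; apply: le_trans (H _) _.
  rewrite -ball_normE /ball_ /= distrC E (le_lt_trans le) //.
  by rewrite -ltr_pdivlMr.
rewrite mulrAC ler_pdivrMr // -mulrA ler_pM2l //.
Unshelve. all: by end_near. Qed.

(** Symmetry of second derivatives; second differences are estimated by the
    mean value theorem. *)
Lemma has_jac_sym (f : 'rV[R]_n -> R) G x B :
  (\forall y \near x, has_grad f y (G y)) -> has_jac G x B -> B^T = B.
Proof.
move=> hf hG.
pose D u v (h : R) := f (x + h *: u + h *: v) - f (x + h *: u) - f (x + h *: v) + f x.
have key u v e : 0 < e -> \forall h \near (0 : R)^'+,
    `|D u v h - h ^+ 2 * dot u (v *m B)| <= e * h ^+ 2.
  move=> e0; set k := 2 * (n%:R * `|u| + 1).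
  have k0 : 0 < k by rewrite mulr_gt0 // ltr_wpDl ?mulr_ge0 ?ler0n.
  have hb := @jac_line_bound G x B u v _ hG (divr_gt0 e0 k0).
  have hgr : \forall h \near (0 : R)^'+, forall s, 0 <= s <= h -> forall c,
      c = 0 \/ c = h -> has_grad f (x + s *: u + c *: v) (G (x + s *: u + c *: v)).
    have l0 : 0 < `|u| + `|v| + 1 by rewrite ltr_wpDl ?addr_ge0.
    have /nbhs_ballP [d d0 hd] := hf.
    near=> h => s /andP[s0 sh] c hc; apply: hd.
    have h0 : 0 < h by near: h; exact: nbhs_right_gt.
    have hd' : h < d / (`|u| + `|v| + 1).
      by near: h; apply: nbhs_right_lt; rewrite divr_gt0.
    have ch : `|c| <= h by case: hc => ->; rewrite ?normr0 ?gtr0_norm // ltW.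
    rewrite -ball_normE /ball_ /= -addrA opprD addrA subrr sub0r normrN.
    apply: (@le_lt_trans _ _ (h * (`|u| + `|v| + 1))); last by rewrite -ltr_pdivlMr.
    rewrite (le_trans (ler_normD _ _)) // !normrZ ger0_norm // !mulrDr mulr1.
    apply: ler_wpDr; first exact: ltW.
    by apply: lerD; apply: ler_wpM2r.
  apply: filter_app (filterI hb hgr); near=> h => -[hb' hgr'].
  have h0 : 0 < h by near: h; exact: nbhs_right_gt.
  pose phi s := f (x + s *: u + h *: v) - f (x + s *: u).
  pose dphi s := dot u (G (x + s *: u + h *: v)) - dot u (G (x + s *: u)).
  have dP s : 0 <= s <= h -> is_derive s 1 phi (dphi s).
    move=> sh.
    have d1 : is_derive s 1 (fun s => f (x + h *: v + s *: u)) (dot u (G (x + s *: u + h *: v))).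
      by apply: is_derive_line; rewrite addrAC; apply: hgr' => //; right.
    have d2 : is_derive s 1 (fun s => f (x + s *: u)) (dot u (G (x + s *: u))).
      apply: is_derive_line; have := hgr' s sh 0 (or_introl erefl).
      by rewrite scale0r addr0.
    have -> : phi = (fun s => f (x + h *: v + s *: u)) - (fun s => f (x + s *: u)).
      by apply/funext => r; rewrite /phi addrAC.
    exact: is_deriveB.
  have cP : {within `[0, h], continuous phi}.
    apply: derivable_within_continuous => s; rewrite in_itv /= => sh.
    exact: (@ex_derive _ _ _ _ _ _ _ (dP s sh)).
  have dP' s : s \in `]0, h[ -> is_derive s 1 phi (dphi s).
    by rewrite in_itv /= => /andP[s1 s2]; apply: dP; rewrite !ltW.
  have [s sin] := MVT h0 dP' cP.
  rewrite subr0 => E.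
  have sh : 0 <= s <= h by move: sin; rewrite in_itv /= => /andP[s1 s2]; rewrite !ltW.
  have -> : D u v h = dphi s * h.
    rewrite -E /phi /D scale0r addr0; ring.
  have b1 := hb' s sh h (or_intror erefl).
  have b2 := hb' s sh 0 (or_introl erefl).
  rewrite scale0r !addr0 in b2.
  have -> : dphi s * h - h ^+ 2 * dot u (v *m B) =
     h * (dot u (G (x + s *: u + h *: v) - G x - (s *: u + h *: v) *m B) -
          dot u (G (x + s *: u) - G x - (s *: u) *m B)).
    by rewrite /dphi mulmxDl -!scalemxAl !(dotDr, dotNr, dotZr); ring.
  rewrite normrM gtr0_norm // expr2 mulrCA ler_pM2l //.
  rewrite (le_trans (ler_normB _ _)) //.
  have bb w : `|w| <= e / k * h -> `|dot u w| <= e * h / 2.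
    move=> wb; apply: le_trans (dot_le_norm _ _) _.
    apply: (@le_trans _ _ ((n%:R * `|u| + 1) * (e / k * h))).
      by apply: ler_pM => //; rewrite ?mulr_ge0 ?ler0n ?lerDl.
    rewrite /k le_eqVlt; apply/orP; left; apply/eqP; field.
    by rewrite gt_eqF // ltr_wpDl ?mulr_ge0 ?ler0n.
  by rewrite [leRHS]splitr lerD ?bb.
have sym u v : dot u (v *m B) = dot v (u *m B).
  apply/eqP/negPn/negP => ne.
  set a := dot u _ in ne *; set b := dot v _ in ne *.
  have e0 : 0 < `|a - b| / 4 by rewrite divr_gt0 // normr_gt0 subr_eq0.
  have [h [[h1 h2] h0]] := @filter_ex _ _ (at_right_proper_filter (0 : R)) _
     (filterI (filterI (key u v _ e0) (key v u _ e0)) (nbhs_right_gt 0)).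
  have hh : 0 < h ^+ 2 by rewrite exprn_gt0.
  have DD : D v u h = D u v h.
    by rewrite /D (addrAC x (h *: v)); ring.
  rewrite DD in h2.
  have := ler_normB (D u v h - h ^+ 2 * b) (D u v h - h ^+ 2 * a).
  have -> : D u v h - h ^+ 2 * b - (D u v h - h ^+ 2 * a) = h ^+ 2 * (a - b) by ring.
  rewrite normrM gtr0_norm // => h3.
  have h4 : h ^+ 2 * `|a - b| <= h ^+ 2 * (`|a - b| / 2).
    apply: le_trans h3 _; apply: le_trans (lerD h2 h1) _.
    rewrite le_eqVlt; apply/orP; left; apply/eqP; by field.
  move: h4; rewrite ler_pM2l // leNgt => /negP; apply.
  by move: e0; lra.
apply/matrixP => i j; rewrite mxE.
have := sym (delta_mx 0 i) (delta_mx 0 j).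
by rewrite -!rowE !(dotC (delta_mx _ _)) !dot_delta !mxE.
Unshelve. all: by end_near. Qed.

(** The second-order condition at a minimum. *)
Lemma min_hess_ge0 (f : 'rV[R]_n -> R) G x B u :
  (\forall y \near x, has_grad f y (G y)) -> has_jac G x B ->
  (\forall y \near x, f x <= f y) -> 0 <= dot (u *m B) u.
Proof.
move=> hf hG fmin; have Gx : G x = 0 by exact: min_grad0 (nbhs_singleton hf) fmin.
rewrite leNgt; apply/negP => neg.
set a := dot _ _ in neg.
pose k : R := n%:R * `|u| * `|u| + 1.
have k0 : 0 < k by rewrite ltr_wpDl ?mulr_ge0 ?ler0n.
have e0 : 0 < - a / k by rewrite divr_gt0 // oppr_gt0.
have l0 : 0 < `|u| + 1 by rewrite ltr_wpDl.
have /nbhs_ballP [d d0 hd] : \forall y \near x, (has_grad f y (G y) /\ f x <= f y) /\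
    `|G y - G x - (y - x) *m B| <= - a / k * `|y - x|.
  by apply: filterI (hG _ e0); apply: filterI hf fmin.
pose h := d / 2 / (`|u| + 1).
have h0 : 0 < h by rewrite !divr_gt0.
have inb s : 0 <= s <= h -> ball x d (x + s *: u).
  move=> /andP[s0 sh]; rewrite -ball_normE /ball_ /= opprD addrA subrr sub0r normrN.
  rewrite normrZ ger0_norm //; apply: (@le_lt_trans _ _ (h * (`|u| + 1))).
    by apply: ler_pM => //; rewrite lerDl.
  by rewrite /h divfK ?gt_eqF // ltr_pdivrMr // ltr_pMr // ltr1n.
pose phi s := f (x + s *: u); pose dphi s := dot u (G (x + s *: u)).
have dP s : 0 <= s <= h -> is_derive s 1 phi (dphi s).
  by move=> /inb /hd [[h1 _] _]; exact: is_derive_line.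
have cP : {within `[0, h], continuous phi}.
  apply: derivable_within_continuous => s; rewrite in_itv /= => sh.
  exact: (@ex_derive _ _ _ _ _ _ _ (dP s sh)).
have dP' s : s \in `]0, h[ -> is_derive s 1 phi (dphi s).
  by rewrite in_itv /= => /andP[s1 s2]; apply: dP; rewrite !ltW.
have [s sin] := MVT h0 dP' cP.
rewrite subr0 /phi scale0r addr0.
have [s0 sh] : 0 < s /\ s <= h.
  by move: sin; rewrite in_itv /= => /andP[s1 s2]; rewrite ltW.
have hh : 0 <= h <= h by rewrite lexx ltW.
have [[_ m] _] := hd _ (inb h hh).
have ss : 0 <= s <= h by rewrite ltW.
have [[_ _] b] := hd _ (inb s ss).
move=> E; have : 0 <= dphi s * h by rewrite -E subr_ge0.
rewrite pmulr_lge0 // => dp.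
have E1 : x + s *: u - x = s *: u by rewrite (addrC x) addrK.
move: b; rewrite /= Gx subr0 E1 => b.
have : `|dphi s - s * a| <= n%:R * `|u| * (- a / k * `|s *: u|).
  have -> : dphi s - s * a = dot u (G (x + s *: u) - (s *: u) *m B).
    by rewrite dotBr -scalemxAl dotZr (dotC u (u *m B)).
  apply: le_trans (dot_le_norm _ _) _; apply: ler_wpM2l.
    by rewrite mulr_ge0 ?ler0n.
  exact: b.
rewrite normrZ gtr0_norm // => /ler_normlP [_ h1].
move: h1; rewrite [leRHS](_ : _ = - (s * a) * ((k - 1) / k)); last first.
  by rewrite /k; field; rewrite gt_eqF.
have : - (s * a) * ((k - 1) / k) < - (s * a).
  by rewrite gtr_pMr ?ltr_pdivrMr ?mul1r ?ltrBlDr ?ltrDl // oppr_gt0 pmulr_rlt0.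
lra.
Qed.

End SquareJacobian.

(** * Support functions of compact sets *)

Section CompactMin.
Context {R : realType} {n : nat}.

(** On a compact set, small values of a continuous function with a unique zero
    are taken near that zero only. *)
Lemma compact_unique_zero (L : set 'rV[R]_n) (f : 'rV[R]_n -> R) y0 e :
  compact L -> {within L, continuous f} ->
  (forall y, L y -> f y <= 0 -> y = y0) -> 0 < e ->
  exists2 d, 0 < d & forall y, L y -> f y < d -> `|y - y0| < e.
Proof.
move=> cL cf uf e0.
pose A := L `&` [set y | e <= `|y - y0|].
have cA : compact A.
  apply: compact_closedI => //.
  have -> : [set y | e <= `|y - y0|] = ~` ball y0 e.
    apply/seteqP; split => y /=; rewrite -ball_normE /ball_ /= distrC.
      by rewrite leNgt => /negP.
    by move/negP; rewrite -leNgt.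
  by apply: open_closedC; exact: ball_open.
have [A0|/set0P/negP] := pselect (A !=set0); last first.
  rewrite negbK => /eqP A0; exists 1 => // y Ly _; rewrite ltNge; apply/negP => ey.
  have : A y by [].
  by rewrite A0.
have [c /set_mem [Lc ec] cmin] := EVT_min_rV A0 cA (continuous_subspaceW (@subIsetl _ _ _) cf).
exists (f c) => [|y Ly fy].
  rewrite ltNge; apply/negP => /(uf _ Lc) cy0; move: ec.
  by rewrite /= cy0 subrr normr0 leNgt e0.
rewrite ltNge; apply/negP => ey.
by have := cmin y (mem_set (conj Ly ey)); rewrite leNgt fy.
Qed.

End CompactMin.

Section SupportFunction.
Context {R : realType} {n : nat} (L : set 'rV[R]_n).
Hypothesis cL : compact L.
Implicit Types x y z u v : 'rV[R]_n.
Local Notation h := (support_fun L).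

(** The point y of L is a support point in direction x. *)
Definition is_max x y := L y /\ forall y', L y' -> dot x y' <= dot x y.

Lemma near_neq0 x : x != 0 -> \forall y \near x, y != 0.
Proof.
move=> x0; have := near_norm_lt x (e := `|x|); rewrite normr_gt0 => /(_ x0).
apply: filter_app; near=> y; apply: contraTneq => ->.
by rewrite sub0r normrN ltxx.
Unshelve. all: by end_near. Qed.

Lemma boundary_sub y : boundary L y -> L y.
Proof.
move=> [+ _]; have /closure_id <- // : closed L.
by apply: compact_closed => //; exact: norm_hausdorff.
Qed.

Lemma support_max x y : x != 0 -> is_max x y -> h x = dot x y /\ boundary L y.
Proof.
move=> x0 [Ly ymax].
have by_ : boundary L y.
  split; first exact: subset_closure.
  move=> /nbhs_ballP [e e0 eL].
  pose s := e / 2 / `|x|; have nx : 0 < `|x| by rewrite normr_gt0.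
  have s0 : 0 < s by rewrite !divr_gt0.
  have : L (y + s *: x).
    apply: eL; rewrite -ball_normE /ball_ /= opprD addrA subrr sub0r normrN.
    by rewrite normrZ gtr0_norm // /s divfK ?gt_eqF // ltr_pdivrMr // ltr_pMr // ltr1n.
  move=> /ymax; rewrite dotDr dotZr gerDl leNgt pmulr_rgt0 // => /negP.
  by rewrite dot_gt0.
split=> //; apply/eqP; rewrite eq_le; apply/andP; split.
  apply: ge_sup; first by exists (dot x y), y.
  by move=> _ [z /boundary_sub Lz <-]; exact: ymax.
apply: sup_upper_bound; last by exists y.
split; first by exists (dot x y), y.
by exists (dot x y) => _ [z /boundary_sub Lz <-]; exact: ymax.
Qed.

Lemma is_max_ex x : L !=set0 -> exists y, is_max x y.
Proof.
move=> L0; have cd : continuous (dot x : 'rV[R]_n -> R).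
  have -> : (dot x : 'rV[R]_n -> R) = dotl x by apply/funext => y; rewrite /dotl dotC.
  exact: dotl_continuous.
have [y /set_mem Ly ymax] := EVT_max_rV L0 cL (continuous_subspaceT cd).
by exists y; split=> // y' Ly'; apply: ymax; exact: mem_set.
Qed.

Lemma support_ge x y : x != 0 -> L y -> dot x y <= h x.
Proof.
move=> x0 Ly; have [z zmax] := is_max_ex x (ex_intro _ y Ly).
by have [-> _] := support_max x0 zmax; apply: zmax.2.
Qed.

(** A support point in direction x: the gradient of the support function where
    it is unique. The default value 0 is only taken when L is empty. *)
Definition max_point x := xget 0 [set y | is_max x y].

Hypothesis L0 : L !=set0.

Lemma max_pointP x : is_max x (max_point x).
Proof. by apply: (xgetPex 0); exact: is_max_ex. Qed.

Lemma max_point_in x : L (max_point x).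
Proof. exact: (max_pointP x).1. Qed.

Lemma support_max_point x : x != 0 -> h x = dot x (max_point x).
Proof. by move=> x0; have [] := support_max x0 (max_pointP x). Qed.

Lemma max_point_boundary x : x != 0 -> boundary L (max_point x).
Proof. by move=> x0; have [] := support_max x0 (max_pointP x). Qed.

Lemma is_max_ray c x y : 0 < c -> is_max (c *: x) y <-> is_max x y.
Proof.
move=> c0; rewrite /is_max; split=> -[Ly m]; split=> // y' /m.
  by rewrite !dotZl ler_pM2l.
by rewrite !dotZl ler_pM2l.
Qed.

Lemma max_point_ray c x : 0 < c -> max_point (c *: x) = max_point x.
Proof.
move=> c0; rewrite /max_point; congr (xget _ _); apply/seteqP.
by split=> y /=; rewrite is_max_ray.
Qed.

Lemma support_ray c x : 0 < c -> x != 0 -> h (c *: x) = c * h x.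
Proof.
move=> c0 x0; rewrite !support_max_point ?max_point_ray ?dotZl //.
by rewrite scaler_eq0 negb_or gt_eqF.
Qed.

Lemma support_lip x x' c : x != 0 -> x' != 0 -> (forall y, L y -> enorm y <= c) ->
  h x - h x' <= enorm (x - x') * c.
Proof.
move=> x0 x'0 Lc; rewrite support_max_point //.
have : dot x' (max_point x) <= h x' by apply: support_ge => //; exact: max_point_in.
have := dot_le_enorm (x - x') (max_point x); rewrite dotBl.
have := ler_wpM2l (enorm_ge0 (x - x')) (Lc _ (max_point_in x)).
lra.
Qed.

(** From here on each direction has a unique maximiser: the support function
    is then differentiable and the maximiser is its gradient. *)
Hypothesis uniq : forall x y y', x != 0 -> is_max x y -> is_max x y' -> y = y'.

Lemma max_point_continuous x : x != 0 -> {for x, continuous max_point}.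
Proof.
move=> x0; suff: max_point y @[y --> x] --> max_point x by [].
have FF : Filter (nbhs x) by exact: nbhs_filter.
apply/cvgrPdist_lt => e e0.
have cf : continuous (fun y => h x - dotl x y).
  move=> y; have FFy : Filter (nbhs y) by exact: nbhs_filter.
  by apply: cvgB; [exact: cvg_cst|exact: dotl_continuous].
have uf y : L y -> h x - dotl x y <= 0 -> y = max_point x.
  move=> Ly; rewrite /dotl subr_le0 dotC => le; apply: (uniq x0) (max_pointP x).
  by split=> // y' Ly'; apply: le_trans le; exact: support_ge.
have [d d0 hd] := compact_unique_zero cL (continuous_subspaceT cf) uf e0.
have [c c0 Lc] : exists2 c, 0 < c & forall y, L y -> `|y| <= c.
  have [M [_ hM]] := compact_bounded cL.
  exists (`|M| + 1) => [|y Ly]; first by rewrite ltr_wpDl.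
  by apply: hM => //; rewrite ltr_pwDr // ler_norm.
have k0 : 0 < n%:R * (2 * c) + 1 by rewrite ltr_wpDl // !mulr_ge0 ?ler0n // ltW.
have h1 := near_neq0 x0.
have h2 : \forall y \near x, `|y - x| < d / (n%:R * (2 * c) + 1).
  by apply: near_norm_lt; rewrite divr_gt0.
near=> y.
have y0 : y != 0 by near: y.
have yd : `|y - x| < d / (n%:R * (2 * c) + 1) by near: y.
rewrite distrC; apply: hd; first exact: max_point_in.
rewrite support_max_point // /dotl.
have m := (max_pointP y).2 _ (max_point_in x).
apply: (@le_lt_trans _ _ (dot (x - y) (max_point x - max_point y))).
  rewrite !(dotDl, dotDr, dotNl, dotNr) (dotC (max_point y) x); lra.
apply: (@le_lt_trans _ _ ((n%:R * (2 * c) + 1) * `|y - x|)); last first.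
  by rewrite mulrC -ltr_pdivlMr.
apply: le_trans (ler_norm _) _; apply: le_trans (dot_le_norm _ _) _.
rewrite distrC mulrAC; apply: ler_wpM2r => //.
rewrite -[leLHS]addr0; apply: lerD => //; apply: ler_wpM2l; first exact: ler0n.
rewrite mulr_natl mulr2n; apply: le_trans (ler_normB _ _) _.
by apply: lerD; apply: Lc; exact: max_point_in.
Unshelve. all: by end_near. Qed.

Lemma support_has_grad x : x != 0 -> has_grad h x (max_point x).
Proof.
move=> x0 e e0.
have c := @cvgr_dist_lt _ _ _ _ (nbhs_filter x) _ _ (max_point_continuous x0).
have k0 : 0 < n%:R + 1 :> R by rewrite ltr_wpDl // ler0n.
have h0 := near_neq0 x0.
have h1 := c _ (divr_gt0 e0 k0).
near=> y.
have y0 : y != 0 by near: y.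
have yd : `|max_point x - max_point y| < e / (n%:R + 1) by near: y.
have m1 := (max_pointP y).2 _ (max_point_in x).
have m2 := (max_pointP x).2 _ (max_point_in y).
rewrite !support_max_point //.
have E : dot (y - x) (max_point y - max_point x) <= e * `|y - x|.
  apply: le_trans (ler_norm _) _; apply: le_trans (dot_le_norm _ _) _.
  rewrite mulrAC; apply: ler_wpM2r => //.
  apply: (@le_trans _ _ ((n%:R + 1) * `|max_point y - max_point x|)).
    by apply: ler_wpM2r => //; rewrite lerDl.
  by rewrite distrC -ler_pdivlMl // mulrC ltW.
move: E; rewrite !(dotDl, dotDr, dotNl, dotNr) => E.
by rewrite ger0_norm; lra.
Unshelve. all: by end_near. Qed.

Section SecondOrder.
Variables (x : 'rV[R]_n) (B : 'M[R]_n).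
Hypotheses (x0 : x != 0) (jB : has_jac max_point x B).

Lemma support_hess_sym : B^T = B.
Proof.
apply: (@has_jac_sym _ _ (support_fun L) max_point x) => //; have := near_neq0 x0.
by apply: filter_app; near=> y => y0; exact: support_has_grad.
Unshelve. all: by end_near. Qed.

Lemma support_hess_ge0 u : 0 <= dot (u *m B) u.
Proof.
apply: (@min_hess_ge0 _ _ (fun y => h y + dotl (- max_point x) y)
  (fun y => max_point y + - max_point x) x).
- have := near_neq0 x0; apply: filter_app; near=> y => y0.
  apply: has_gradD; first exact: support_has_grad.
  move=> e e0; near=> z; rewrite /dotl dotBl subrr normr0 mulr_ge0 //.
  exact: ltW.
- by rewrite -[B]addr0; apply: has_jacD => //; exact: has_jac_cst.
have := near_neq0 x0; apply: filter_app; near=> y => y0.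
rewrite /dotl !dotNr -support_max_point // subrr subr_ge0.
by apply: support_ge => //; exact: max_point_in.
Unshelve. all: by end_near. Qed.

Lemma support_hess_ray : x *m B = 0.
Proof.
have [_ <-] := has_jac_derive x jB.
apply: lim_near_cst => //.
have h1 : \forall s \near (0 : R)^', `|s| < 1.
  by apply: nbhs_dnbhs; apply/nbhs_ballP; exists 1; rewrite /= ?ltr01 // => s;
    rewrite -ball_normE /ball_ /= sub0r normrN.
apply: filter_app h1; near=> s => s1 /=.
have -> : s *: x + x = (s + 1) *: x by rewrite scalerDl scale1r.
rewrite max_point_ray ?subrr ?scaler0 //.
by move: s1 => /ltr_normlP [? _]; lra.
Unshelve. all: by end_near. Qed.

(** A semidefinite form without kernel is definite. *)
Lemma support_hess_orth_posdef :
  (forall u, dot u x = 0 -> u *m B = 0 -> u = 0) -> orth_posdef x B.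
Proof.
move=> inj; split; first exact: support_hess_sym.
move=> u u0 ux; rewrite lt_neqAle support_hess_ge0 andbT eq_sym.
apply: contra_neq u0 => quu; apply: inj => //.
apply/eqP; rewrite -dot_eq0; set w := u *m B in quu *.
have := dot_ge0 w; rewrite le_eqVlt => /orP [/eqP <- //|ww].
have b0 := support_hess_ge0 w.
have uBw : dot (w *m B) u = dot w w by rewrite dot_mxl support_hess_sym.
set a := dot w w in ww uBw *; set b := dot _ _ in b0.
have b1 : 0 < b + 1 by rewrite ltr_wpDl.
have := support_hess_ge0 (u - (a / (b + 1)) *: w).
rewrite mulmxDl mulNmx -scalemxAl !(dotDl, dotDr, dotNl, dotNr, dotZl, dotZr).
rewrite -/w quu uBw -/a -/b.
have -> : 0 + - (a / (b + 1) * a) + (- (a / (b + 1) * a) -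
   - (a / (b + 1) * (a / (b + 1) * b))) = - (a ^+ 2 / (b + 1) * (1 + (b + 1)^-1)).
  by field; rewrite gt_eqF.
rewrite oppr_ge0 leNgt => /negP []; rewrite mulr_gt0 ?divr_gt0 ?exprn_gt0 //.
by rewrite addr_gt0 ?invr_gt0.
Qed.

End SecondOrder.

End SupportFunction.

(** * Derivatives on the sphere of homogeneous functions *)

Section SphereHomogeneous.
Context {R : realType} {n : nat}.
Variables (h : 'rV[R]_n -> R) (G : 'rV[R]_n -> 'rV[R]_n).
Implicit Types x y z u v : 'rV[R]_n.
Hypothesis h_ray : forall c x, 0 < c -> x != 0 -> h (c *: x) = c * h x.
Hypothesis G_ray : forall c x, 0 < c -> G (c *: x) = G x.
Hypothesis h_grad : forall x, x != 0 -> has_grad h x (G x).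

Lemma enorm_inv_gt0 x : x != 0 -> 0 < (enorm x)^-1.
Proof. by move=> x0; rewrite invr_gt0 enorm_gt0. Qed.

Lemma has_grad_gradE f x (g : 'rV[R]_n) : has_grad f x g -> grad f x = g.
Proof.
move=> hf; apply/rowP => i; rewrite mxE.
have [_ ->] := has_grad_derive (delta_mx 0 i) hf.
by rewrite dotC dot_delta.
Qed.

Lemma has_grad_inv_enorm x : x != 0 ->
  has_grad (fun y => (enorm y)^-1) x (- (enorm x) ^- 3 *: x).
Proof.
move=> x0; have e0 : enorm x != 0 by rewrite gt_eqF // enorm_gt0.
have -> : - (enorm x) ^- 3 *: x = - (enorm x) ^- 2 *: ((enorm x)^-1 *: x).
  by rewrite scalerA mulNr -invfM -exprSr.
exact: has_gradV e0 (has_grad_enorm x0).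
Qed.

Lemma sgrad_homogeneous x : x != 0 ->
  sgrad h x = (enorm x)^-1 *: G x - (h x * (enorm x) ^- 3) *: x.
Proof.
move=> x0; apply: has_grad_gradE.
have := has_gradM (has_grad_inv_enorm x0) (h_grad x0).
rewrite scalerA mulrN scaleNr; apply: has_grad_ext.
have := near_neq0 x0; apply: filter_app; near=> y => y0 /=.
by rewrite /normalize h_ray // enorm_inv_gt0.
Unshelve. all: by end_near. Qed.

Lemma sgrad_homogeneous_sphere z : sphere z -> sgrad h z = G z - h z *: z.
Proof.
move=> zS; rewrite sgrad_homogeneous ?sphere_neq0 //.
by move: zS; rewrite /sphere /= => ->; rewrite expr1n invr1 scale1r mulr1.
Qed.

(** S_(n-1) is the determinant of the Euclidean Hessian of the 1-homogeneous
    extension of the support function on the tangent hyperplane. *)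
Lemma Sn1_homogeneous z B : sphere z -> has_jac G z B -> Sn1 h z = det_form z B.
Proof.
move=> zS jB; apply: det_orth_eq => u v uz vz.
have z0 := sphere_neq0 zS; have ez : enorm z = 1 by [].
pose k y := - (h y * (enorm y)^-1 * (enorm y)^-1).
have [gk hk] : exists g, has_grad k z g.
  have i := has_grad_inv_enorm z0.
  have := has_gradZ (-1) (has_gradM (has_gradM (h_grad z0) i) i).
  have -> : (fun y => -1 * (h y * (enorm y)^-1 * (enorm y)^-1)) = k.
    by apply/funext => y; rewrite mulN1r.
  by move=> ?; eexists; eassumption.
have kz : k z = - h z by rewrite /k ez invr1 !mulr1.
have j : has_jac (sgrad h \o normalize) z (B + (gk^T *m z + k z *: 1%:M)).
  have := has_jacD jB (has_jacZ hk (has_jac_id z)); apply: has_jac_ext.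
  have := near_neq0 z0; apply: filter_app; near=> y => y0 /=.
  rewrite sgrad_homogeneous_sphere; last exact: normalize_sphere.
  rewrite /normalize G_ray ?h_ray ?enorm_inv_gt0 // scalerA /k scaleNr.
  by rewrite (mulrC (h y)).
rewrite /shess /scov /tproj (@derive_val _ _ _ _ _ _ _ (has_jac_derive u j)).
rewrite dotBl dotZl (dotC z) vz mulr0 subr0.
rewrite !mulmxDr dotDl mulmxA -scalemxAr mulmx1 dotDl dotZl kz.
have -> : u *m gk^T *m z = dot u gk *: z.
  by rewrite -mul_scalar_mx; congr (_ *m _); apply/matrixP => a b;
    rewrite !ord1 [RHS]mxE eqxx.
by rewrite dotZl (dotC z) vz mulr0 add0r mulNr (mulrC (h z)) subrK.
Unshelve. all: by end_near. Qed.

End SphereHomogeneous.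

(** * Continuity of matrix-valued functions *)

Section MatrixContinuity.
Context {R : realType} (T : Type) (F : set_system T) (FF : Filter F).

Lemma cvg_mx m k (A : T -> 'M[R]_(m, k)) (l : 'M[R]_(m, k)) :
  (forall i j, A t i j @[t --> F] --> l i j) -> A t @[t --> F] --> l.
Proof.
move=> h; apply/cvgrPdist_le => e e0.
have h1 : \forall t \near F, forall i j, `|l i j - A t i j| <= e.
  apply: filter_forall => i; apply: filter_forall => j.
  by have /cvgrPdist_le := h i j; apply.
apply: filter_app h1; near=> t => h1.
by apply: norm_le_coord => [|i j]; [exact: ltW|rewrite !mxE].
Unshelve. all: by end_near. Qed.

Lemma cvg_mx_coord m k (A : T -> 'M[R]_(m, k)) (l : 'M[R]_(m, k)) i j :
  A t @[t --> F] --> l -> A t i j @[t --> F] --> l i j.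
Proof.
move=> Al.
exact: (@continuous_cvg _ _ _ F FF A (fun M : 'M[R]_(m, k) => M i j) l
  (@coord_continuous R m k i j l) Al).
Qed.

Lemma cvg_mulmx m k r (A : T -> 'M[R]_(m, k)) (B : T -> 'M[R]_(k, r))
  (a : 'M[R]_(m, k)) (b : 'M[R]_(k, r)) :
  A t @[t --> F] --> a -> B t @[t --> F] --> b ->
  A t *m B t @[t --> F] --> a *m b.
Proof.
move=> Aa Bb; apply: cvg_mx => i j; rewrite mxE.
under eq_fun do rewrite mxE.
apply: cvg_big => [|l _]; first exact: add_continuous.
by apply: cvgM; exact: cvg_mx_coord.
Qed.

Lemma cvg_trmx m k (A : T -> 'M[R]_(m, k)) (a : 'M[R]_(m, k)) :
  A t @[t --> F] --> a -> (A t)^T @[t --> F] --> a^T.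
Proof.
move=> Aa; apply: cvg_mx => i j; rewrite mxE.
by under eq_fun do rewrite mxE; exact: cvg_mx_coord.
Qed.

Lemma cvg_det m (A : T -> 'M[R]_m) (a : 'M[R]_m) :
  A t @[t --> F] --> a -> \det (A t) @[t --> F] --> \det a.
Proof.
move=> Aa; rewrite /determinant.
apply: cvg_big => [|s _]; first exact: add_continuous.
apply: cvgM; first exact: cvg_cst.
apply: cvg_big => [|i _]; first exact: mul_continuous.
exact: cvg_mx_coord.
Qed.

End MatrixContinuity.

Lemma near_right_le1 {R : realType} : \forall s \near (0 : R)^'+, 0 <= s <= 1.
Proof.
near=> s; rewrite ltW ?andTb; last by near: s; exact: nbhs_right_gt.
by rewrite ltW //; near: s; apply: nbhs_right_lt.
Unshelve. all: by end_near. Qed.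

(** * Calculus of compositions *)

Section Composition.
Context {R : realType} {n m : nat}.

Lemma has_grad_jac (f : 'rV[R]_m -> R) (F : 'rV[R]_n -> 'rV[R]_m) x g A :
  has_grad f (F x) g -> has_jac F x A -> has_grad (fun y => f (F y)) x (g *m A^T).
Proof.
move=> hf hF e e0.
have [c c0 hc] := has_jac_lip hF.
have e1 : 0 < e / 2 / c by rewrite !divr_gt0.
pose k : R := m%:R * `|g| + 1.
have k0 : 0 < k by rewrite ltr_wpDl // mulr_ge0 ?ler0n.
have e2 : 0 < e / 2 / k by rewrite !divr_gt0.
have h1 : \forall y \near x,
    `|f (F y) - f (F x) - dot (F y - F x) g| <= e / 2 / c * `|F y - F x|.
  exact: (has_jac_continuous hF) _ (hf _ e1).
have h2 := hF _ e2.
near=> y.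
have -> : f (F y) - f (F x) - dot (y - x) (g *m A^T) =
    (f (F y) - f (F x) - dot (F y - F x) g) + dot (F y - F x - (y - x) *m A) g.
  rewrite (_ : dot (y - x) (g *m A^T) = dot ((y - x) *m A) g); last first.
    by rewrite /dot trmx_mul trmxK mulmxA.
  by rewrite (dotBl (F y - F x)); ring.
have h1' : `|f (F y) - f (F x) - dot (F y - F x) g| <= e / 2 / c * `|F y - F x|.
  by near: y.
have hc' : `|F y - F x| <= c * `|y - x| by near: y.
have h2' : `|F y - F x - (y - x) *m A| <= e / 2 / k * `|y - x| by near: y.
have -> : e * `|y - x| = e / 2 * `|y - x| + e / 2 * `|y - x| by field.
apply: le_trans (ler_normD _ _) (lerD _ _).
  apply: le_trans h1' _; rewrite -mulrA ler_pM2l ?divr_gt0 //.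
  by rewrite ler_pdivrMl.
apply: le_trans (dot_le_norm _ _) _.
apply: (@le_trans _ _ (k * (e / 2 / k * `|y - x|))).
  rewrite mulrAC; apply: ler_pM => //; rewrite ?mulr_ge0 ?ler0n //.
  by rewrite /k lerDl.
by rewrite mulrA [k * _]mulrC divfK // gt_eqF.
Unshelve. all: by end_near. Qed.

(** The derivative vanishes in a direction along which F is constant. *)
Lemma has_jac_stationary (F : 'rV[R]_n -> 'rV[R]_m) x w A : has_jac F x A ->
  (\forall s \near (0 : R)^'+, F (x + s *: w) = F x) -> w *m A = 0.
Proof.
move=> hF hs; apply/eqP/negPn/negP => wA.
have k0 : 0 < `|w| + 1 by rewrite ltr_wpDl.
have nA : 0 < `|w *m A| by rewrite normr_gt0.
have e0 : 0 < `|w *m A| / 2 / (`|w| + 1) by rewrite !divr_gt0.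
have c := @cvg_ray _ _ x w.
have h1 : \forall s \near (0 : R)^'+, `|F (x + s *: w) - F x - (x + s *: w - x) *m A|
    <= `|w *m A| / 2 / (`|w| + 1) * `|x + s *: w - x|.
  exact: c _ (hF _ e0).
have [s [[h2 h3] s0]] := @filter_ex _ _ (at_right_proper_filter (0 : R)) _
  (filterI (filterI hs h1) (nbhs_right_gt 0)).
have E : x + s *: w - x = s *: w by rewrite (addrC x) addrK.
move: h3; rewrite E h2 subrr sub0r normrN -scalemxAl !normrZ gtr0_norm //.
apply/negP; rewrite -ltNge mulrCA ltr_pM2l // mulrAC -mulrA -mulrA gtr_pMr //.
by rewrite mulrA ltr_pdivrMr // mul1r mulrC; lra.
Unshelve. all: by end_near. Qed.

End Composition.

Section ChainRule.
Context {R : realType} {n m k : nat}.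

Lemma has_jac_comp (G : 'rV[R]_m -> 'rV[R]_k) (F : 'rV[R]_n -> 'rV[R]_m) x A B :
  has_jac G (F x) B -> has_jac F x A -> has_jac (fun y => G (F y)) x (A *m B).
Proof.
move=> /has_jacP hG hF; apply/has_jacP => j.
have := has_grad_jac (hG j) hF; congr (has_grad _ _ _).
apply/rowP => i; rewrite !mxE; apply: eq_bigr => l _.
by rewrite !mxE mulrC.
Qed.

End ChainRule.

Section Normalize.
Context {R : realType} {n : nat}.
Implicit Types x y u v : 'rV[R]_n.

(** Jacobian matrix of the projection onto the sphere along rays. *)
Definition normalize_jac x : 'M[R]_n :=
  (- (enorm x) ^- 3 *: x)^T *m x + (enorm x)^-1 *: 1%:M.

Lemma has_jac_normalize x : x != 0 -> has_jac normalize x (normalize_jac x).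
Proof. by move=> x0; exact: has_jacZ (has_grad_inv_enorm x0) (has_jac_id x). Qed.

Lemma normalize_jac_orth x u : dot u x = 0 ->
  u *m normalize_jac x = (enorm x)^-1 *: u.
Proof.
move=> ux; rewrite mulmxDr -scalemxAr mulmx1 mulmxA.
have -> : u *m (- (enorm x) ^- 3 *: x)^T = 0.
  apply/matrixP => i j; rewrite !ord1 [LHS](_ : _ = dot u (- (enorm x) ^- 3 *: x)) //.
  by rewrite dotZr ux mulr0 mxE.
by rewrite mul0mx add0r.
Qed.

Lemma normalize_jac_tr x : x != 0 -> normalize_jac x *m x^T = 0.
Proof.
move=> x0; have e0 : enorm x != 0 by rewrite gt_eqF // enorm_gt0.
rewrite mulmxDl -mulmxA -scalemxAl mul1mx.
have -> : x *m x^T = (enorm x ^+ 2)%:M.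
  by apply/matrixP => i j; rewrite !ord1 sqr_enorm [RHS]mxE eqxx.
rewrite mul_mx_scalar linearZ /= scalerA -scalerDl.
by rewrite [X in X *: _](_ : _ = 0) ?scale0r //; field.
Qed.

End Normalize.

(** * Local charts of a smooth strictly convex body *)

Section Body.
Context {R : realType} {n : nat} (K : set 'rV[R]_n).
Implicit Types x y z u v w nu : 'rV[R]_n.
Hypothesis Kss : smooth_strictly_convex K.

Lemma body_compact : compact K.
Proof. by have [[]] := Kss. Qed.

Lemma body_closed : closed K.
Proof. by apply: compact_closed body_compact; exact: norm_hausdorff. Qed.

Lemma body_nonempty : K !=set0.
Proof. by have [[_ _ [x /interior_subset Kx]] _] := Kss; exists x. Qed.

Lemma body_convex x y s : K x -> K y -> 0 <= s <= 1 -> K (x + s *: (y - x)).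
Proof.
move=> Kx Ky /andP[s0 s1]; have [[_ + _] _] := Kss.
move=> /(_ y x (Itv01 s0 s1) (mem_set Ky) (mem_set Kx)) /set_mem.
congr K; rewrite -[LHS]/(s *: y + (1 - s) *: x).
by rewrite scalerBl scale1r scalerBr addrCA addrA.
Qed.

(** From a boundary point y, every direction w pointing to the negative side of
    the local equation leads into K: on a segment which moves the initial
    direction from one pointing to an interior point of K to w, the points at
    scale s where phi is negative cannot leave K through its boundary. *)
Lemma inward_direction U phi y w : U y -> boundary K y ->
  boundary_equation K U phi -> dot w (grad phi y) < 0 ->
  exists2 s, 0 < s & K (y + s *: w).
Proof.
move=> Uy by_ [Uo sm eqb neg gn0] wg.
have Ky : K y by exact: boundary_sub body_compact _ by_.
set g := grad phi y in wg.
have g0 : g != 0 by exact: gn0.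
have phiy : phi y = 0 by apply/(eqb y Uy).
have dphi : has_grad phi y g by apply: differentiable_has_grad; exact: (sm [::] y Uy).
have nU : nbhs y U by exact: open_nbhs_nbhs.
have le0 x : K x -> dot (x - y) g <= 0.
  move=> Kx; rewrite leNgt; apply/negP => pos.
  have hN : has_grad (fun z => -1 * phi z) y (-1 *: g) by exact: has_gradZ.
  have hw : dot (x - y) (-1 *: g) < 0 by rewrite dotZr mulN1r oppr_lt0.
  have hU : \forall s \near (0 : R)^'+, U (y + s *: (x - y))
    by have c := @cvg_ray _ _ y (x - y); exact: c _ nU.
  have [s [[h1 h2] h3]] := @filter_ex _ _ (at_right_proper_filter (0 : R)) _
    (filterI (filterI (descent hN hw) hU) near_right_le1).
  have := neg _ h2 (body_convex Ky Kx h3).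
  by move: h1; rewrite phiy !mulN1r oppr0 oppr_lt0 ltNge => /negP.
have [[_ _ [x1 x1i]] _] := Kss.
set v := x1 - y.
have vg : dot v g < 0.
  have hi : \forall s \near (0 : R)^'+, K (x1 + s *: g)
    by have c := @cvg_ray _ _ x1 g; exact: c _ x1i.
  have [s [h1 s0]] := @filter_ex _ _ (at_right_proper_filter (0 : R)) _
    (filterI hi (nbhs_right_gt 0)).
  have := le0 _ h1; rewrite addrAC dotDl dotZl -/v => h2.
  by apply: lt_le_trans h2; rewrite ltrDl mulr_gt0 // dot_gt0.
(* Move from the interior direction v to w through directions on which phi
   decreases at a uniform rate. *)
pose wl (l : R) := v + l *: (w - v).
pose c : R := Num.min (- dot v g) (- dot w g).
have c0 : 0 < c by rewrite lt_min !oppr_gt0 vg wg.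
have wlg l : 0 <= l <= 1 -> dot (wl l) g <= - c.
  move=> /andP[l0 l1]; rewrite /wl dotDl dotZl dotBl.
  have c1 : dot v g <= - c by rewrite lerNr ge_min lexx.
  have c2 : dot w g <= - c by rewrite lerNr ge_min lexx orbT.
  have := ler_wpM2l l0 c2; have : (1 - l) * dot v g <= (1 - l) * - c.
    by apply: ler_wpM2l => //; rewrite subr_ge0.
  lra.
pose M := `|v| + `|w - v| + 1.
have M0 : 0 < M by rewrite ltr_wpDl // addr_ge0.
have wlM l : 0 <= l <= 1 -> `|wl l| <= M.
  move=> /andP[l0 l1]; apply: le_trans (ler_normD _ _) _.
  rewrite normrZ ger0_norm // /M -addrA lerD2l.
  by apply: ler_wpDr => //; rewrite -[leRHS]mul1r; apply: ler_wpM2r.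
have e0 : 0 < c / 2 / M by rewrite !divr_gt0.
have /nbhs_ballP [d d0 hd] : \forall z \near y, U z /\
    `|phi z - phi y - dot (z - y) g| <= c / 2 / M * `|z - y|.
  by apply: filterI nU (dphi _ e0).
pose s := Num.min 1 (d / 2 / M).
have s0 : 0 < s by rewrite lt_min ltr01 !divr_gt0.
have s1 : s <= 1 by rewrite ge_min lexx.
have sM : s * M < d.
  apply: (@le_lt_trans _ _ (d / 2 / M * M)).
    by apply: ler_wpM2r; [exact: ltW|rewrite ge_min lexx orbT].
  by rewrite divfK ?gt_eqF // ltr_pdivrMr // ltr_pMr // ltr1n.
exists s => //.
pose p l := y + s *: wl l.
have pphi l : 0 <= l <= 1 -> U (p l) /\ phi (p l) < 0.
  move=> l01; have E : p l - y = s *: wl l by rewrite /p (addrC y) addrK.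
  have nb : `|p l - y| <= s * M.
    by rewrite E normrZ gtr0_norm // ler_wpM2l ?wlM // ltW.
  have [] := hd (p l).
    by rewrite -ball_normE /ball_ /= distrC (le_lt_trans nb).
  rewrite phiy subr0 E dotZl => Up le; split=> //.
  have h1 : s * dot (wl l) g <= s * - c by rewrite ler_wpM2l ?wlg // ltW.
  have h2 : c / 2 / M * `|s *: wl l| <= s * (c / 2).
    rewrite -E; apply: (@le_trans _ _ (c / 2 / M * (s * M))).
      by apply: ler_wpM2l => //; exact: ltW.
    by rewrite mulrCA divfK // gt_eqF.
  have sc : 0 < s * c by rewrite mulr_gt0.
  move: le => /ler_normlP [_ le]; lra.
have pK l : 0 <= l <= 1 -> K (p l) -> interior K (p l).
  move=> l01 Kp; apply: contrapT => ni; have [Up] := pphi l l01.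
  have -> : phi (p l) = 0 by apply/(eqb _ Up); split => //; exact: subset_closure.
  by rewrite ltxx.
have cp : continuous p.
  move=> l; apply: cvgD; first exact: cvg_cst.
  apply: cvgZ; first exact: cvg_cst.
  apply: cvgD; first exact: cvg_cst.
  by apply: cvgZr_tmp; exact: cvg_id.
(* The set of l with p l in K is nonempty, open and closed in [0, 1]. *)
have := @segment_connected R 0 1 (`[0, 1] `&` p @^-1` K).
have -> : y + s *: w = p 1 by rewrite /p /wl scale1r (addrC v) subrK.
move=> conn; suff : (`[0, 1] `&` p @^-1` K) 1 by case.
rewrite conn /=; first by rewrite in_itv /= ler01 lexx.
- exists 0; split; first by rewrite /= in_itv /= lexx ler01.
  rewrite /= /p /wl scale0r addr0 /v; apply: body_convex => //.
    exact: interior_subset.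
  by rewrite ltW.
- exists (p @^-1` interior K).
    by apply: open_comp => [z _|]; [exact: cp|exact: open_interior].
  apply/seteqP; split => l /= [h1 h2]; split=> //.
    by apply: pK => //; move: h1; rewrite in_itv.
  exact: interior_subset.
- exists (p @^-1` K) => //.
  by apply: closed_comp => [z _|]; [exact: cp|exact: body_closed].
Qed.

(** A normal vector in the sense of support functions is a positive multiple of
    the gradient of the local equation. *)
Lemma normal_grad U phi y nu : U y -> boundary K y ->
  boundary_equation K U phi -> nu != 0 -> is_max K nu y ->
  normalize nu = unit_normal phi y.
Proof.
move=> Uy by_ beq nu0 [_ ymax]; have [_ _ _ _ gn0] := beq.
have [a a0 E] : exists2 a, 0 <= a & nu = a *: grad phi y.
  apply: halfspace => [|w /(inward_direction Uy by_ beq) [s s0 Ks]].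
    exact: gn0.
  by have := ymax _ Ks; rewrite dotDr dotZr gerDl pmulr_rle0 // dotC.
have a1 : 0 < a.
  by rewrite lt_neqAle a0 andbT; apply: contra_neq nu0 => a00; rewrite E -a00 scale0r.
by rewrite E normalizeZ.
Qed.

End Body.

Section Chart.
Context {R : realType} {n : nat}.
Implicit Types x y z u v w nu : 'rV[R]_n.

Lemma det_form_inj z (B : 'M[R]_n) w : det_form z B != 0 -> dot w z = 0 ->
  w *m B = 0 -> w = 0.
Proof.
rewrite det_formE /= mulf_eq0 negb_or => /andP[d0 _] /orth_row_base [c wE] wB.
move: d0 wE; move: (row_base _) => E d0 wE.
have Eu : E *m B *m E^T \in unitmx by rewrite unitmxE unitfE.
have : c *m (E *m B *m E^T) = 0 by rewrite !mulmxA -wE wB mul0mx.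
move=> /(congr1 (mulmx^~ (invmx (E *m B *m E^T)))); rewrite mulmxK // mul0mx => c0.
by rewrite wE c0 mul0mx.
Qed.

Lemma cvg_normalize_jac x : x != 0 ->
  normalize_jac y @[y --> x] --> normalize_jac x.
Proof.
move=> x0; have FF : Filter (nbhs x) by exact: nbhs_filter.
have ce : (enorm y)^-1 @[y --> x] --> (enorm x)^-1.
  exact: has_grad_continuous (has_grad_inv_enorm x0).
have ce3 : (- (enorm y) ^- 3) @[y --> x] --> - (enorm x) ^- 3.
  rewrite -exprVn; under eq_fun do rewrite -exprVn.
  by apply: cvgN; rewrite !exprS expr0; under eq_fun do rewrite !exprS expr0;
    do ?[apply: cvgM => //]; exact: cvg_cst.
apply: cvgD.
  apply: cvg_mulmx; last exact: cvg_id.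
  apply: cvg_trmx; apply: cvgZ => //; exact: cvg_id.
by apply: cvgZ => //; exact: cvg_cst.
Qed.

Section LocalEquation.
Variables (U : set 'rV[R]_n) (phi : 'rV[R]_n -> R).
Hypotheses (Uo : open U) (sm : smooth_on U phi).

(** The Hessian matrix, acting on row vectors. *)
Definition hess phi y : 'M[R]_n :=
  \matrix_(i, j) 'D_(delta_mx 0 i) (fun z => grad phi z 0 j) y.

Lemma grad_coord j : (fun z => grad phi z 0 j) = (fun z => 'D_(delta_mx 0 j) phi z).
Proof. by apply/funext => z; rewrite mxE. Qed.

Lemma has_jac_grad y : U y -> has_jac (grad phi) y (hess phi y).
Proof.
move=> Uy; apply/has_jacP => j.
have d : differentiable (fun z => grad phi z 0 j : R) y.
  by rewrite grad_coord; have := @sm [:: delta_mx 0 j] y Uy; apply.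
have := differentiable_has_grad d; congr (has_grad _ _ _).
by apply/rowP => i; rewrite !mxE.
Qed.

Lemma cvg_hess y : U y -> hess phi z @[z --> y] --> hess phi y.
Proof.
move=> Uy; have FF : Filter (nbhs y) by exact: nbhs_filter.
apply: cvg_mx => i j; rewrite mxE grad_coord; under eq_fun do rewrite mxE grad_coord.
have d := @sm [:: delta_mx 0 i; delta_mx 0 j] y Uy.
by have := differentiable_continuous d; apply.
Qed.

(** Jacobian matrix of the outward unit normal field. *)
Definition normal_jac y : 'M[R]_n := hess phi y *m normalize_jac (grad phi y).

Lemma has_jac_normal y : U y -> grad phi y != 0 ->
  has_jac (unit_normal phi) y (normal_jac y).
Proof.
move=> Uy gy; exact: has_jac_comp (has_jac_normalize gy) (has_jac_grad Uy).
Qed.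

Lemma cvg_grad y : U y -> grad phi z @[z --> y] --> grad phi y.
Proof. by move=> /has_jac_grad /has_jac_continuous. Qed.

Lemma cvg_normal_jac y : U y -> grad phi y != 0 ->
  normal_jac z @[z --> y] --> normal_jac y.
Proof.
move=> Uy gy; have FF : Filter (nbhs y) by exact: nbhs_filter.
apply: cvg_mulmx; first exact: cvg_hess.
exact: (cvg_comp _ _ (cvg_grad Uy) (cvg_normalize_jac gy)).
Qed.

End LocalEquation.

(** Near a boundary point y0 of a smooth strictly convex body there is a C^1 map
    Psi with invertible derivative which, at boundary points, is the outward
    unit normal; off the boundary, the value of the local equation is added in
    the direction of the normal at y0. *)
Lemma normal_chart (K : set 'rV[R]_n) y0 :
  smooth_strictly_convex K -> boundary K y0 ->
  exists (Psi : 'rV[R]_n -> 'rV[R]_n) (J : 'rV[R]_n -> 'M[R]_n),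
  [/\ \forall y \near y0, forall nu, nu != 0 -> boundary K y -> is_max K nu y ->
        normalize nu = Psi y,
      \forall y \near y0, has_jac Psi y (J y),
      J y0 \in unitmx &
      J y @[y --> y0] --> J y0].
Proof.
move=> Kss by0; have [_ /(_ y0 by0) [U [phi [Uy0 beq curv]]]] := Kss.
have [Uo sm eqb neg gn0] := beq.
have g0 : grad phi y0 != 0 by exact: gn0.
set n0 := unit_normal phi y0.
have phi0 : phi y0 = 0 by apply/(eqb y0 Uy0).
have nU : \forall y \near y0, U y by exact: open_nbhs_nbhs.
have FF : Filter (nbhs y0) by exact: nbhs_filter.
exists (fun y => unit_normal phi y + phi y *: n0).
exists (fun y => normal_jac phi y + (grad phi y)^T *m n0).
have dphi y : U y -> has_grad phi y (grad phi y).
  by move=> Uy; apply: differentiable_has_grad; exact: (sm [::] y Uy).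
have inj w : dot w (grad phi y0) = 0 -> w *m normal_jac phi y0 = 0 -> w = 0.
  move=> wg; apply: (@det_form_inj n0).
    move: curv; rewrite /gauss_curvature (@det_orth_eq _ _ _ _ (normal_jac phi y0)).
      by move=> /lt0r_neq0.
    move=> u v _ _.
    by have [_ ->] := has_jac_derive u (has_jac_normal sm Uy0 g0).
  by rewrite /n0 /unit_normal /normalize dotZr wg mulr0.
split.
- near=> y => nu nu0 by_ ymax; have Uy : U y by near: y.
  have -> : phi y = 0 by apply/(eqb y Uy).
  rewrite scale0r addr0; exact: normal_grad Uy by_ beq nu0 ymax.
- have gne : \forall y \near y0, grad phi y != 0.
    exact: (cvg_grad sm Uy0) _ (near_neq0 g0).
  near=> y; have Uy : U y by near: y.
  have gy : grad phi y != 0 by near: y.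
  have j2 := has_jacZ (dphi y Uy) (has_jac_cst n0 y); rewrite scaler0 addr0 in j2.
  exact: (has_jacD (has_jac_normal sm Uy gy) j2).
(* A vector w in the kernel is tangent, since the derivatives of the unit
   normal field are, and the Gauss curvature does not vanish. *)
- rewrite -row_free_unit -kermx_eq0; apply/eqP/row_matrixP => i.
  rewrite row0; set w := row i _.
  have wJ : w *m (normal_jac phi y0 + (grad phi y0)^T *m n0) = 0.
    by rewrite /w -row_mul mulmx_ker row0.
  rewrite mulmxDr (mulmxA w (grad phi y0)^T) in wJ.
  have wg1 : w *m (grad phi y0)^T = (dot w (grad phi y0))%:M.
    by apply/matrixP => a b; rewrite !ord1 [RHS]mxE eqxx.
  rewrite wg1 mul_scalar_mx in wJ.
  have n0n0 : sphere n0 by exact: normalize_sphere.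
  have wJn : dot (w *m normal_jac phi y0) n0 = 0.
    rewrite /n0 /unit_normal /normalize dotZr /dot -(mulmxA w) /normal_jac.
    by rewrite -(mulmxA (hess phi y0)) normalize_jac_tr // !mulmx0 mxE mulr0.
  have wg : dot w (grad phi y0) = 0.
    have := congr1 (fun v => dot v n0) wJ.
    by rewrite dotDl dotZl wJn add0r sphere_dot // mulr1 dot0l.
  by apply: (inj _ wg); move: wJ; rewrite wg scale0r addr0.
- have c2 : (grad phi z)^T *m n0 @[z --> y0] --> (grad phi y0)^T *m n0.
    exact: (cvg_mulmx FF (cvg_trmx FF (cvg_grad sm Uy0)) (cvg_cst n0)).
  exact: (cvgD (cvg_normal_jac sm Uy0 g0) c2).
Unshelve. all: by end_near. Qed.

End Chart.

(** * The support function of a smooth strictly convex body *)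

Section BodySupport.
Context {R : realType} {n : nat} (K : set 'rV[R]_n).
Implicit Types x y z u v w nu : 'rV[R]_n.
Hypothesis Kss : smooth_strictly_convex K.
Let cK := body_compact Kss.
Let K0 := body_nonempty Kss.
Local Notation h := (support_fun K).
Local Notation G := (max_point K).

Lemma normal_unique y nu nu' : nu != 0 -> nu' != 0 -> is_max K nu y ->
  is_max K nu' y -> normalize nu = normalize nu'.
Proof.
move=> n0 n0' m m'; have [_ by_] := support_max cK n0 m.
have [Psi [J [/nbhs_singleton h1 _ _ _]]] := normal_chart Kss by_.
by rewrite (h1 nu) // (h1 nu').
Qed.

(** If a direction had two support points, the normal, which is the chart Psi
    with invertible derivative, would be constant on the segment between them. *)
Lemma body_max_unique x y y' : x != 0 -> is_max K x y -> is_max K x y' -> y = y'.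
Proof.
move=> x0 m m'; have [_ by_] := support_max cK x0 m.
have [Psi [J [h1 /nbhs_singleton h2 Ju _]]] := normal_chart Kss by_.
have seg s : 0 <= s <= 1 -> is_max K x (y + s *: (y' - y)).
  move=> s01; split; first exact: body_convex Kss _ _ _ m.1 m'.1 s01.
  move=> z /m.2; rewrite dotDr dotZr dotBr.
  have -> : dot x y' = dot x y by apply/eqP; rewrite eq_le (m.2 _ m'.1) (m'.2 _ m.1).
  by rewrite subrr mulr0 addr0.
have st : \forall s \near (0 : R)^'+, Psi (y + s *: (y' - y)) = Psi y.
  have h3 : \forall s \near (0 : R)^'+, forall nu, nu != 0 ->
      boundary K (y + s *: (y' - y)) -> is_max K nu (y + s *: (y' - y)) ->
      normalize nu = Psi (y + s *: (y' - y)).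
    by have c := @cvg_ray _ _ y (y' - y); exact: c _ h1.
  near=> s; have s01 : 0 <= s <= 1 by near: s; exact: near_right_le1.
  have ms := seg s s01; have [_ bs] := support_max cK x0 ms.
  have h3s : forall nu, nu != 0 -> boundary K (y + s *: (y' - y)) ->
      is_max K nu (y + s *: (y' - y)) -> normalize nu = Psi (y + s *: (y' - y)).
    by near: s.
  by rewrite -(h3s x x0 bs ms); apply: (nbhs_singleton h1).
have := has_jac_stationary h2 st.
move=> /(congr1 (mulmx^~ (invmx (J y)))); rewrite mulmxK // mul0mx.
by move=> /eqP; rewrite subr_eq0 => /eqP.
Unshelve. all: by end_near. Qed.

Let uniq := body_max_unique.

(** The Gauss map is a local homeomorphism with differentiable chart, hence the
    support point is a differentiable function of the normal; its derivative is
    computed in the chart. *)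
Lemma body_hess x0 : x0 != 0 -> exists (J : 'rV[R]_n -> 'M[R]_n),
  J (G x) @[x --> x0] --> J (G x0) /\
  \forall x \near x0, [/\ x != 0, J (G x) \in unitmx &
    has_jac G x (normalize_jac x *m invmx (J (G x)))].
Proof.
move=> x00; have by_ := max_point_boundary cK K0 x00.
have [Psi [J [h1 h2 Ju cJ]]] := normal_chart Kss by_.
exists J.
have FF : Filter (nbhs x0) by exact: nbhs_filter.
have cG : G x @[x --> x0] --> G x0 by exact: max_point_continuous uniq _ x00.
have cJG : J (G x) @[x --> x0] --> J (G x0) by exact: cvg_comp _ _ cG cJ.
split=> //.
have nx := near_neq0 x00.
have eqP1 : \forall x \near x0, Psi (G x) = normalize x.
  have h3 : \forall x \near x0, forall nu, nu != 0 ->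
      boundary K (G x) -> is_max K nu (G x) -> normalize nu = Psi (G x).
    exact: cG _ h1.
  near=> x; have xn : x != 0 by near: x.
  have h3x : forall nu, nu != 0 -> boundary K (G x) -> is_max K nu (G x) ->
      normalize nu = Psi (G x) by near: x.
  apply/esym; exact: (h3x x xn (max_point_boundary cK K0 xn) (max_pointP cK K0 x)).
have eqP2 := nbhs_interior eqP1.
have jPsi : \forall x \near x0, has_jac Psi (G x) (J (G x)) by exact: cG _ h2.
have dJ : \forall x \near x0, \det (J (G x)) != 0.
  have d0 : \det (J (G x0)) != 0 by move: Ju; rewrite unitmxE unitfE.
  exact: (cvgr_neq0 _ (cvg_det FF cJG) d0).
near=> x; have xn : x != 0 by near: x.
have Jxu : J (G x) \in unitmx by rewrite unitmxE unitfE; near: x.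
split => //.
have j1 : has_jac Psi (G x) (J (G x)) by near: x.
have j2 : \forall y \near x, Psi (G y) = normalize y by near: x.
exact: has_jac_inverse j1 Jxu (max_point_continuous cK K0 uniq xn) j2 (has_jac_normalize xn).
Unshelve. all: by end_near. Qed.

Lemma body_has_jac x : x != 0 -> exists2 B, has_jac G x B & orth_posdef x B.
Proof.
move=> x0; have [J [_ /nbhs_singleton [_ Ju jB]]] := body_hess x0.
eexists; first exact: jB.
apply: (support_hess_orth_posdef cK K0 uniq x0 jB) => u ux.
rewrite mulmxA normalize_jac_orth // -scalemxAl => /eqP.
rewrite scaler_eq0 gt_eqF ?enorm_inv_gt0 //= => /eqP.
by move=> /(congr1 (mulmx^~ (J (G x)))); rewrite mulmxKV // mul0mx.
Qed.

Lemma Sn1_body z B : sphere z -> has_jac G z B -> Sn1 h z = det_form z B.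
Proof.
move=> zS jB; apply: (@Sn1_homogeneous _ _ _ G) => //.
- by move=> c x; exact: support_ray.
- by move=> c x; exact: max_point_ray.
- by move=> x; exact: support_has_grad.
Qed.

Lemma Sn1_body_gt0 z : sphere z -> 0 < Sn1 h z.
Proof.
move=> zS; have [B jB Bp] := body_has_jac (sphere_neq0 zS).
by rewrite (Sn1_body zS jB) det_form_gt0.
Qed.

(** In the chart, S_(n-1) is a quotient of continuous functions. *)
Lemma Sn1_body_continuous z0 e : sphere z0 -> 0 < e ->
  exists2 d, 0 < d & forall z, sphere z -> `|z - z0| < d ->
    `|Sn1 h z - Sn1 h z0| < e.
Proof.
move=> z0S e0; have z00 := sphere_neq0 z0S.
have [J [cJ hJ]] := body_hess z00.
have FF : Filter (nbhs z0) by exact: nbhs_filter.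
have SE z : sphere z -> J (G z) \in unitmx ->
    has_jac G z (normalize_jac z *m invmx (J (G z))) ->
    Sn1 h z = dot (z *m J (G z)) z / \det (J (G z)).
  move=> zS Ju jB; rewrite (Sn1_body zS jB).
  have zn := sphere_neq0 zS; set B := _ *m invmx _ in jB *.
  have Bs : B^T = B by exact: (support_hess_sym cK K0 uniq zn jB).
  have zB : z *m B = 0 by exact: support_hess_ray jB.
  have := det_form_full 1 1 zS Bs zB; rewrite !scale1r expr1n !mul1r => <-.
  have d0 : \det (J (G z)) != 0 by move: Ju; rewrite unitmxE unitfE.
  apply: (mulIf d0); rewrite divfK // -det_mulmx mulmxDl /B mulmxKV //.
  have -> : normalize_jac z = 1%:M - z^T *m z.
    rewrite /normalize_jac; move: (zS); rewrite /sphere /= => ->.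
    by rewrite expr1n invr1 scale1r scaleN1r linearN /= mulNmx addrC.
  rewrite (_ : _ + _ = 1%:M + z^T *m (z *m J (G z) - z)); last first.
    by rewrite mulmxBr mulmxA addrAC addrA.
  by rewrite det_rank1 dotBl sphere_dot // addrC subrK.
have c : dot (z *m J (G z)) z / \det (J (G z)) @[z --> z0] -->
    dot (z0 *m J (G z0)) z0 / \det (J (G z0)).
  have [_ Ju0 _] := nbhs_singleton hJ.
  apply: cvgM; last first.
    apply: cvgV; last exact: cvg_det.
    by move: Ju0; rewrite unitmxE unitfE.
  apply: cvg_dot; last exact: cvg_id.
  by apply: cvg_mulmx => //; exact: cvg_id.
have [_ Ju0 j0] := nbhs_singleton hJ.
have hc := cvgr_dist_lt _ _ c _ e0.
have /nbhs_ballP [d d0 hd] : \forall z \near z0,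
    [/\ z != 0, J (G z) \in unitmx & has_jac G z (normalize_jac z *m invmx (J (G z)))] /\
    `|dot (z0 *m J (G z0)) z0 / \det (J (G z0)) -
      dot (z *m J (G z)) z / \det (J (G z))| < e.
  by near=> z; split; near: z; [exact: hJ|exact: hc].
exists d => // z zS zd.
have [] := hd z; first by rewrite -ball_normE /ball_ /= distrC.
by move=> [_ Ju jz]; rewrite (SE z) // (SE z0) // distrC.
Unshelve. all: by end_near. Qed.

End BodySupport.

(** * The dual body *)

Section Dual.
Context {R : realType} {n : nat} (K : set 'rV[R]_n).
Implicit Types x y z u v w nu eta : 'rV[R]_n.
Hypothesis Kss : smooth_strictly_convex K.
Hypothesis K_0 : interior K 0.
Let cK := body_compact Kss.
Let K0 := body_nonempty Kss.
Let uniq := body_max_unique Kss.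
Local Notation h := (support_fun K).
Local Notation G := (max_point K).
Local Notation D := (dual_body K).
Local Notation g := (support_fun (dual_body K)).
Local Notation q := (max_point (dual_body K)).

Lemma body_inner : exists2 r, 0 < r & forall y, `|y| < r -> K y.
Proof.
have /nbhs_ballP [r r0 rK] := K_0; exists r => // y yr; apply: rK.
by rewrite -ball_normE /ball_ /= sub0r normrN.
Qed.

Lemma body_inner_ray : exists2 r, 0 < r & forall y, y != 0 -> K ((r / `|y|) *: y).
Proof.
have [r r0 rK] := body_inner; exists (r / 2); first by rewrite divr_gt0.
move=> y y0; apply: rK; have ny : 0 < `|y| by rewrite normr_gt0.
rewrite normrZ gtr0_norm ?divr_gt0 // divfK ?gt_eqF //.
by rewrite ltr_pdivrMr // ltr_pMr // ltr1n.
Qed.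

Lemma support_gt0 x : x != 0 -> 0 < h x.
Proof.
move=> x0; have [r r0 rK] := body_inner_ray.
apply: lt_le_trans (support_ge cK x0 (rK x x0)).
by rewrite dotZr mulr_gt0 ?dot_gt0 // divr_gt0 // normr_gt0.
Qed.

Lemma dual_compact : compact D.
Proof.
apply: bounded_closed_compact.
  have [r r0 rK] := body_inner_ray.
  exists r^-1; split; first exact: num_real.
  move=> M rM y Dy; apply: le_trans (ltW rM).
  have [->|y0] := eqVneq y 0; first by rewrite normr0 invr_ge0 ltW.
  have ny : 0 < `|y| by rewrite normr_gt0.
  have := Dy _ (rK y y0); rewrite dotZl => le1.
  have : r / `|y| * `|y| ^+ 2 <= 1.
    apply: le_trans le1; apply: ler_wpM2l; first by rewrite divr_ge0 ?ltW.
    by rewrite -sqr_enorm lerXn2r ?nnegrE ?enorm_ge0 // norm_le_enorm.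
  by rewrite expr2 mulrA divfK ?gt_eqF // -ler_pdivlMl // mulr1.
have -> : D = \bigcap_(x in K) (dotl x @^-1` [set t | t <= 1]).
  apply/seteqP; split => y /= hy x Kx; first by rewrite /= /dotl dotC; exact: hy.
  by have := hy x Kx; rewrite /= /dotl dotC.
apply: closed_bigI => x Kx; apply: closed_comp; last exact: closed_le.
by move=> y _; exact: dotl_continuous.
Qed.
Let cD := dual_compact.

Lemma dual_nonempty : D !=set0.
Proof. by exists 0 => x _; rewrite dot0r. Qed.
Let D0 := dual_nonempty.

Lemma dual_support eta : eta != 0 -> D eta <-> h eta <= 1.
Proof.
move=> e0; split=> [De|le x Kx].
  by rewrite (support_max_point cK K0 e0) dotC; apply: De; exact: max_point_in.
by apply: le_trans le; rewrite dotC; exact: support_ge.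
Qed.

Lemma dual_unit eta : eta != 0 -> D ((h eta)^-1 *: eta).
Proof.
move=> e0; have h0 := support_gt0 e0.
apply/dual_support; first by rewrite scaler_eq0 negb_or invr_eq0 gt_eqF.
by rewrite (support_ray cK K0) ?invr_gt0 // mulVf // gt_eqF.
Qed.

Lemma dual_support_ge z nu : z != 0 -> nu != 0 -> dot z nu / h nu <= g z.
Proof.
move=> z0 nu0; rewrite mulrC -dotZr; apply: (support_ge cD z0).
exact: dual_unit.
Qed.

Lemma dual_gt0 z : z != 0 -> 0 < g z.
Proof.
move=> z0; apply: lt_le_trans (dual_support_ge z0 z0).
by rewrite divr_gt0 ?dot_gt0 ?support_gt0.
Qed.

Lemma dual_max_neq0 z eta : z != 0 -> is_max D z eta -> eta != 0.
Proof.
move=> z0 m; have := dual_gt0 z0; have [-> _] := support_max cD z0 m.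
by apply: contraTneq => ->; rewrite dot0r ltxx.
Qed.

Lemma dual_max_support z eta : z != 0 -> is_max D z eta -> h eta = 1.
Proof.
move=> z0 m; have e0 := dual_max_neq0 z0 m; have h0 := support_gt0 e0.
have gz := dual_gt0 z0; have [gE _] := support_max cD z0 m; rewrite gE in gz.
apply/eqP; rewrite eq_le (dual_support e0).1 ?m.1 //=; last exact: m.1.
have := m.2 _ (dual_unit e0); rewrite dotZr.
by rewrite -[leRHS]mul1r ler_pM2r // invf_le1.
Qed.

(** Lagrange multipliers: where the linear function given by z is maximal on
    the set where h <= 1, z is a multiple of the gradient of h. *)
Lemma dual_max_point z eta : z != 0 -> is_max D z eta -> z = g z *: G eta.
Proof.
move=> z0 m; have e0 := dual_max_neq0 z0 m; have h1 := dual_max_support z0 m.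
have eG : dot eta (G eta) = 1 by rewrite -(support_max_point cK K0 e0).
have G0 : G eta != 0.
  by apply: contra_eq_neq eG => ->; rewrite dot0r eq_sym oner_eq0.
have [a a0 zE] : exists2 a, 0 <= a & z = a *: G eta.
  apply: halfspace => // w wG.
  have d := descent (support_has_grad cK K0 uniq e0) wG.
  have c := @cvg_ray _ _ eta w.
  have ne : \forall s \near (0 : R)^'+, eta + s *: w != 0 by exact: c _ (near_neq0 e0).
  have [s [[h2 h3] s0]] := @filter_ex _ _ (at_right_proper_filter (0 : R)) _
    (filterI (filterI d ne) (nbhs_right_gt 0)).
  have Ds : D (eta + s *: w) by apply/dual_support => //; rewrite -h1 ltW.
  by have := m.2 _ Ds; rewrite dotDr dotZr gerDl pmulr_rle0 // dotC.
have [gE _] := support_max cD z0 m.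
have -> : g z = a by rewrite gE {1}zE dotZl dotC eG mulr1.
exact: zE.
Qed.

(** The support point of the dual body is determined by its direction, since K
    has a unique normal at each boundary point. *)
Lemma dual_max_unique z eta eta' : z != 0 -> is_max D z eta -> is_max D z eta' ->
  eta = eta'.
Proof.
move=> z0 m m'; have e0 := dual_max_neq0 z0 m; have e0' := dual_max_neq0 z0 m'.
have h1 := dual_max_support z0 m; have h1' := dual_max_support z0 m'.
have gz := dual_gt0 z0.
have GG : G eta = G eta'.
  have := dual_max_point z0 m; rewrite {1}(dual_max_point z0 m') => /(scalerI _) -> //.
  by rewrite gt_eqF.
have nn : normalize eta = normalize eta'.
  apply: (normal_unique Kss e0 e0' (y := G eta)); first exact: max_pointP.
  by rewrite GG; exact: max_pointP.
have nE x : x != 0 -> x = enorm x *: normalize x.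
  by move=> x0; rewrite /normalize scalerA mulfV ?scale1r // gt_eqF // enorm_gt0.
have n0 : normalize eta != 0 by exact: sphere_neq0 (normalize_sphere e0).
have k0 : h (normalize eta) != 0 by rewrite gt_eqF // support_gt0.
have kE x : x != 0 -> h x = enorm x * h (normalize x).
  move=> x0; rewrite {1}(nE x x0) (support_ray cK K0) ?enorm_gt0 //.
  exact: sphere_neq0 (normalize_sphere x0).
move: h1 h1'; rewrite (kE _ e0) (kE _ e0') -nn => <- /(mulIf k0) ee.
by rewrite (nE _ e0) (nE _ e0') -nn ee.
Qed.
Let uniqD := dual_max_unique.

(** The hypothesis is that c z satisfies the support inequalities of K. *)
Lemma dual_le z c : z != 0 -> 0 < c ->
  (forall nu, sphere nu -> c * dot nu z <= h nu) -> g z <= c^-1.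
Proof.
move=> z0 c0 hc; have m := max_pointP cD D0 z.
have e0 := dual_max_neq0 z0 m; have h1 := dual_max_support z0 m.
have := hc _ (normalize_sphere e0).
rewrite dotZl (support_ray cK K0) ?enorm_inv_gt0 // h1 mulr1.
rewrite mulrCA -[leRHS]mulr1 ler_pM2l ?enorm_inv_gt0 // dotC -support_max_point //.
by move=> le; rewrite -[leRHS]mul1r ler_pdivlMr // mulrC.
Qed.

(** The outward normal of K at the boundary point in direction z. *)
Definition dual_normal z := normalize (q z).

Section DualPoint.
Variable z : 'rV[R]_n.
Hypothesis zS : sphere z.
Let z0 : z != 0. Proof. exact: sphere_neq0. Qed.
Let m : is_max D z (q z). Proof. exact: max_pointP cD D0 z. Qed.
Let q0 : q z != 0. Proof. exact: dual_max_neq0 z0 m. Qed.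
Local Notation nu0 := (dual_normal z).

Lemma dual_normal_sphere : sphere nu0.
Proof. exact: normalize_sphere. Qed.

Lemma dual_normal_max : G nu0 = (g z)^-1 *: z.
Proof.
rewrite /dual_normal /normalize max_point_ray ?enorm_inv_gt0 //.
rewrite [X in _ = _ *: X](dual_max_point z0 m) scalerA mulVf ?scale1r //.
by rewrite gt_eqF // dual_gt0.
Qed.

Lemma dual_normal_support : h nu0 = (enorm (q z))^-1.
Proof.
rewrite /dual_normal /normalize (support_ray cK K0) ?enorm_inv_gt0 //.
by rewrite (dual_max_support z0 m) mulr1.
Qed.

Lemma dual_normal_dot : dot nu0 z = g z * h nu0.
Proof.
rewrite (support_max_point cK K0) ?dual_normal_max; last first.
  exact: sphere_neq0 dual_normal_sphere.
by rewrite dotZr mulrA mulfV ?mul1r // gt_eqF // dual_gt0.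
Qed.

(** The support inequality at the boundary point in direction z is strict except
    in the normal direction. *)
Lemma dual_normal_unique nu : sphere nu -> h nu <= (g z)^-1 * dot nu z -> nu = nu0.
Proof.
move=> nuS le; have n0 := sphere_neq0 nuS.
have n0' := sphere_neq0 dual_normal_sphere.
rewrite -(normalize_id nuS) -(normalize_id dual_normal_sphere).
apply: (normal_unique Kss n0 n0' (y := G nu0)); last exact: max_pointP.
split=> [|y Ky]; first exact: max_point_in.
apply: le_trans (support_ge cK n0 Ky) _.
by rewrite dual_normal_max dotZr.
Qed.

Lemma dual_sgrad : sgrad g z = q z - g z *: z.
Proof.
apply: sgrad_homogeneous_sphere zS.
- by move=> c x; exact: support_ray.
- by move=> x x0; exact: support_has_grad.
Qed.

Lemma dual_sqnorm : g z ^+ 2 + enorm (sgrad g z) ^+ 2 = enorm (q z) ^+ 2.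
Proof.
rewrite dual_sgrad !sqr_enorm !(dotDl, dotDr, dotNl, dotNr, dotZl, dotZr).
rewrite (dotC (q z) z) -(support_max_point cD D0 z0) (sphere_dot zS); ring.
Qed.

Let P x := h x *: G x.
Let Q y := g y *: q y.

Let PQ y : y != 0 -> P (Q y) = y.
Proof.
move=> y0; have my := max_pointP cD D0 y; have gy := dual_gt0 y0.
rewrite /P /Q (support_ray cK K0) // ?(dual_max_neq0 y0 my) //.
rewrite max_point_ray // (dual_max_support y0 my) mulr1.
by rewrite -(dual_max_point y0 my).
Qed.

(** The gradients P and Q of h^2/2 and g^2/2 are inverse to each other, so
    their Jacobian determinants, which are h^(n+1) S_(n-1) and its dual
    counterpart, are reciprocal. *)
Lemma dual_Sn1 :
  Sn1 g z * g z ^+ n.+1 * (Sn1 h nu0 * h nu0 ^+ n.+1) = 1.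
Proof.
have n0 : (0 < n)%N.
  rewrite lt0n; apply: contra_neq z0 => n0.
  by apply/rowP => - [i hi]; have := leq_trans hi (eq_leq n0).
have nuS := dual_normal_sphere; have nu0n := sphere_neq0 nuS.
have [B jB Bp] := body_has_jac Kss nu0n.
have BS : Sn1 h nu0 = det_form nu0 B by exact: Sn1_body.
have h0 : 0 < h nu0 by exact: support_gt0.
have Gnu : dot (G nu0) nu0 = h nu0 by rewrite dotC -support_max_point.
have nuB : nu0 *m B = 0 by exact: support_hess_ray jB.
pose JP := (G nu0)^T *m G nu0 + h nu0 *: B.
have dJP : \det JP = Sn1 h nu0 * h nu0 ^+ n.+1.
  have := det_homogeneous (G := G nu0) n0 nuS Bp.1 nuB.
  by rewrite Gnu => /(_ h0); rewrite addrC mulrC BS => ->.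
have dJP0 : 0 < \det JP.
  by rewrite dJP mulr_gt0 ?exprn_gt0 // BS det_form_gt0.
have JPu : JP \in unitmx by rewrite unitmxE unitfE gt_eqF.
have Qz0 : Q z != 0 by rewrite scaler_eq0 negb_or gt_eqF // dual_gt0.
have jP : has_jac P (Q z) JP.
  have c0 : 0 < enorm (Q z) by rewrite enorm_gt0.
  have QE : enorm (Q z) *: nu0 = Q z.
    rewrite /dual_normal -(normalizeZ (q z) (dual_gt0 z0)) -/(Q z).
    by rewrite scalerA mulfV ?scale1r // gt_eqF.
  have jG : has_jac G (Q z) ((enorm (Q z))^-1 *: B).
    by rewrite -{1}QE; apply: has_jac_ray => // y; exact: max_point_ray.
  have hQ : h (Q z) = enorm (Q z) * h nu0 by rewrite -{1}QE (support_ray cK K0).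
  have GQ : G (Q z) = G nu0 by rewrite -{1}QE max_point_ray.
  have := has_jacZ (support_has_grad cK K0 uniq Qz0) jG.
  by rewrite GQ hQ scalerA mulrAC mulfV ?mul1r // gt_eqF.
have jQ : has_jac Q z (1%:M *m invmx JP).
  apply: has_jac_inverse jP JPu _ _ (has_jac_id z).
    have FF : Filter (nbhs z) by exact: nbhs_filter.
    apply: cvgZ.
      exact: has_grad_continuous (support_has_grad cD D0 uniqD z0).
    exact: (max_point_continuous cD D0 uniqD z0).
  by have := near_neq0 z0; apply: filter_app; near=> y => y0; exact: PQ.
rewrite mul1mx in jQ.
have gz := dual_gt0 z0.
have gg := support_has_grad cD D0 uniqD z0.
have [B' jB'] : exists B', has_jac q z B'.
  have gi := has_gradV (lt0r_neq0 gz) gg.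
  have := has_jacZ gi jQ; set A := (X in has_jac _ _ X) => jq.
  exists A; apply: has_jac_ext jq.
  have := near_neq0 z0; apply: filter_app; near=> y => y0.
  by rewrite scalerA mulVf ?scale1r // gt_eqF // dual_gt0.
have jQ' := has_jacZ gg jB'.
have Bs' : B'^T = B' by exact: (support_hess_sym cD D0 uniqD z0 jB').
have zB' : z *m B' = 0 by exact: support_hess_ray jB'.
have qz : dot (q z) z = g z by rewrite dotC -support_max_point.
have BS' : Sn1 g z = det_form z B'.
  apply: (@Sn1_homogeneous _ _ _ q) => //.
  - by move=> c x; exact: support_ray.
  - by move=> c x; exact: max_point_ray.
  - by move=> x x0; exact: support_has_grad.
have := det_homogeneous (G := q z) n0 zS Bs' zB'.
rewrite qz => /(_ gz); rewrite addrC -(has_jac_unique jQ jQ') => dQ.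
rewrite BS' [X in X * _]mulrC -dQ -dJP -det_mulmx mulVmx // det1 //.
Unshelve. all: by end_near. Qed.

End DualPoint.

End Dual.

(** * One-sided derivatives *)

Section DeriveIn.
Context {R : realType}.
Implicit Types (D : set R) (f : R -> R) (t l : R).

Lemma is_derive_inP D f t l : is_derive_in D f t l <->
  forall e, 0 < e -> exists2 d, 0 < d & forall v, D v -> `|v - t| < d ->
    `|f v - f t - l * (v - t)| <= e * `|v - t|.
Proof.
have key v : v != t ->
    `|f v - f t - l * (v - t)| = `|l - (f v - f t) / (v - t)| * `|v - t|.
  move=> vt; rewrite -normrM mulrBl divfK ?subr_eq0 // distrC //.
split=> [/cvgrPdist_le h e e0|h].
  have := h e e0; rewrite near_withinE near_withinE => /nbhs_ballP [d d0 hd].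
  exists d => // v Dv vd; have [->|vt] := eqVneq v t.
    by rewrite !subrr mulr0 subrr normr0 mulr0.
  rewrite key //; apply: ler_wpM2r => //; apply: hd => //.
  by rewrite -ball_normE /ball_ /= distrC.
apply/cvgrPdist_le => e e0; have [d d0 hd] := h e e0.
rewrite near_withinE near_withinE; apply/nbhs_ballP; exists d => // v.
rewrite -ball_normE /ball_ /= distrC => vd vt Dv.
have := hd v Dv vd; rewrite key // ler_pM2r // normr_gt0 subr_eq0 //.
Qed.

Lemma within_continuous_eps (V : normedModType R) (A : set V) (f : V -> R) :
  (forall x, A x -> forall e, 0 < e -> exists2 d, 0 < d &
     forall y, A y -> `|y - x| < d -> `|f y - f x| <= e) ->
  forall x, A x -> f y @[y --> within A (nbhs x)] --> f x.
Proof.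
move=> h x Ax; apply/cvgrPdist_le => e e0; have [d d0 hd] := h x Ax e e0.
rewrite near_withinE; apply/nbhs_ballP; exists d => // y.
rewrite -ball_normE /ball_ /= distrC => yd Ay; rewrite distrC; exact: hd.
Qed.

Lemma derive_in_continuous D f t l e : is_derive_in D f t l -> 0 < e ->
  exists2 d, 0 < d & forall v, D v -> `|v - t| < d -> `|f v - f t| <= e.
Proof.
move=> /is_derive_inP h e0; have [d d0 hd] := h 1 ltr01.
have k0 : 0 < `|l| + 1 by rewrite ltr_wpDl.
exists (Num.min d (e / (`|l| + 1))) => [|v Dv].
  by rewrite lt_min d0 divr_gt0.
rewrite lt_min => /andP[vd ve]; have := hd v Dv vd; rewrite mul1r => le.
have -> : f v - f t = (f v - f t - l * (v - t)) + l * (v - t) by rewrite subrK.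
apply: le_trans (ler_normD _ _) _; rewrite normrM.
apply: (@le_trans _ _ ((`|l| + 1) * `|v - t|)).
  by rewrite mulrDl mul1r addrC lerD2l.
by rewrite -ler_pdivlMl // mulrC ltW.
Qed.

Lemma is_derive_in_scale D D' f (a b t l : R) : (forall v, D' v -> D (a + b * v)) ->
  0 < b -> is_derive_in D f (a + b * t) l ->
  is_derive_in D' (fun v => f (a + b * v)) t (b * l).
Proof.
move=> DD b0 /is_derive_inP h; apply/is_derive_inP => e e0.
have [d d0 hd] := h (e / b) (divr_gt0 e0 b0).
exists (d / b) => [|v Dv vd]; first exact: divr_gt0.
have E : a + b * v - (a + b * t) = b * (v - t) by ring.
have nE : `|b * (v - t)| = b * `|v - t| by rewrite normrM gtr0_norm.
have := hd _ (DD _ Dv); rewrite E nE (_ : b * `|v - t| < d); last first.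
  by rewrite mulrC -ltr_pdivlMr.
move=> /(_ isT); rewrite [e / b * _]mulrA divfK ?gt_eqF //.
by rewrite mulrA (mulrC l).
Qed.

Lemma is_derive_in_comb D f f' (a b t l l' : R) : is_derive_in D f t l ->
  is_derive_in D f' t l' ->
  is_derive_in D (fun v => a * f v + b * f' v) t (a * l + b * l').
Proof.
move=> h h'.
rewrite /is_derive_in.
have -> : (fun v => (a * f v + b * f' v - (a * f t + b * f' t)) / (v - t)) =
    (fun v => a * ((f v - f t) / (v - t)) + b * ((f' v - f' t) / (v - t))).
  by apply/funext => v; ring.
by apply: cvgD; apply: cvgM => //; exact: cvg_cst.
Qed.

Lemma is_derive_in_affine D (a b t : R) : is_derive_in D (fun v => a + v * b) t b.
Proof.
apply/is_derive_inP => e e0; exists 1 => // v _ _.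
rewrite (_ : a + v * b - (a + t * b) - b * (v - t) = 0); last by ring.
by rewrite normr0 mulr_ge0 // ltW.
Qed.

Lemma is_derive_in_inv D f t l : f t != 0 -> is_derive_in D f t l ->
  is_derive_in D (fun v => (f v)^-1) t (- l / f t ^+ 2).
Proof.
move=> f0 h; have FF : Filter (within D t^') by exact: within_filter.
have cf : f v @[v --> within D t^'] --> f t.
  apply/cvgrPdist_le => e e0; have [d d0 hd] := derive_in_continuous h e0.
  rewrite near_withinE near_withinE; apply/nbhs_ballP; exists d => // v.
  by rewrite -ball_normE /ball_ /= distrC => vd _ Dv; rewrite distrC; exact: hd.
have c : - ((f v - f t) / (v - t)) * ((f v)^-1 * (f t)^-1) @[v --> within D t^'] -->
    - l * ((f t)^-1 * (f t)^-1).
  apply: cvgM; first exact: cvgN.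
  by apply: cvgM; [exact: cvgV|exact: cvg_cst].
rewrite /is_derive_in expr2 invfM; apply: cvg_trans c; apply: near_eq_cvg.
have nf : \forall v \near within D t^', f v != 0 by exact: (cvgr_neq0 _ cf f0).
apply: filter_app nf; near=> v => fv.
have e1 : (f v)^-1 - (f t)^-1 = - (f v - f t) * ((f v)^-1 * (f t)^-1).
  by field; rewrite fv f0.
by rewrite /= e1; ring.
Unshelve. all: by end_near. Qed.

(** A function with nonnegative derivative is nondecreasing. *)
Lemma derive_in_nondecreasing D f a b : (forall x, a <= x <= b -> D x) ->
  (forall x, a <= x <= b -> exists2 l, 0 <= l & is_derive_in D f x l) ->
  a <= b -> f a <= f b.
Proof.
move=> abD df; rewrite le_eqVlt => /predU1P[-> //|ab]; rewrite leNgt; apply/negP => fba.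
pose k := (f a - f b) / (b - a).
have k0 : 0 < k by rewrite divr_gt0 // subr_gt0.
pose phi x := f x + k * (x - a).
have phiE : phi b = phi a.
  by rewrite /phi /k subrr mulr0 addr0 divfK ?subrKC // gt_eqF // subr_gt0.
have cphi : {within `[a, b], continuous phi}.
  apply/subspace_continuousP => x xab.
  apply: (@cvgD _ _ _ _ _ f (fun x => k * (x - a))).
    move: x xab; apply: within_continuous_eps => x; rewrite /= in_itv /= => xab e e0.
    have [l _ dl] := df x xab; have [d d0 hd] := derive_in_continuous dl e0.
    by exists d => // y; rewrite /= in_itv /= => /abD; exact: hd.
  apply: cvg_within_filter.
  by apply: cvgM; [exact: cvg_cst|apply: cvgB; [exact: cvg_id|exact: cvg_cst]].
(* To the right of any point of [a, b[ the function phi is larger. *)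
have up c : a <= c < b -> exists2 v, a <= v <= b & phi c < phi v.
  move=> /andP[ac cb]; have [|l l0 /is_derive_inP dl] := df c; first by rewrite ac ltW.
  have k2 : 0 < k / 2 by rewrite divr_gt0.
  have [d d0 hd] := dl (k / 2) k2.
  pose v := c + Num.min (d / 2) (b - c).
  have w0 : 0 < Num.min (d / 2) (b - c) by rewrite lt_min divr_gt0 ?subr_gt0.
  have cv : c < v by rewrite ltrDl.
  have vb : v <= b by rewrite -lerBrDl ge_min lexx orbT.
  have av : a <= v <= b by rewrite vb andbT (le_trans ac) // ltW.
  exists v => //; have := hd v (abD v av).
  rewrite /v addrAC subrr add0r gtr0_norm // -/v.
  have -> : Num.min (d / 2) (b - c) < d.
    by rewrite gt_min ltr_pdivrMr // ltr_pMr // ltr1n.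
  move=> /(_ isT) /ler_normlP [+ _]; rewrite /phi.
  set w := Num.min _ _ in w0 v cv vb av *; have -> : v = c + w by [].
  have lw : 0 <= l * w by rewrite mulr_ge0 // ltW.
  have kw : 0 < k * w by rewrite mulr_gt0.
  lra.
have [c cab cmax] := EVT_max (ltW ab) cphi.
move: cab; rewrite in_itv /= => /andP[ac]; rewrite le_eqVlt => /predU1P[cb|cb].
  have [|v vab] := up a; first by rewrite lexx.
  apply/negP; rewrite -leNgt -phiE -cb; apply: cmax; by rewrite in_itv.
have [|v vab] := up c; first by rewrite ac.
by apply/negP; rewrite -leNgt; apply: cmax; rewrite in_itv.
Qed.

End DeriveIn.

(** * Contact of two families of functions *)

Section Contact.
Context {R : realType} {n : nat}.
Implicit Types (x z u v nu : 'rV[R]_n) (w s : 'rV[R]_n -> R -> R).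

Lemma sphere_compact : compact (@sphere R n).
Proof.
apply: bounded_closed_compact.
  exists 1; split; first exact: num_real.
  by move=> M M1 y yS; apply: le_trans (norm_le_enorm y) _; rewrite yS ltW.
have -> : @sphere R n = (fun x => dot x x) @^-1` [set 1].
  apply/seteqP; split => x /=; first exact: sphere_dot.
  by move=> h; rewrite /sphere /= /enorm h sqrtr1.
apply: closed_comp; last exact: closed_eq.
by move=> x _; exact: has_grad_continuous (has_grad_sqnorm x).
Qed.

(** The product of the sphere and the time interval [0, b]. *)
Definition cyl (b : R) : set ('rV[R]_n * R) := sphere `*` `[0, b].

Lemma cylP b z t : cyl b (z, t) <-> sphere z /\ 0 <= t <= b.
Proof. by rewrite /cyl /= in_itv. Qed.

(** Joint continuity on the product of the sphere and a time interval. *)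
Definition jcont b w : Prop := forall y, cyl b y ->
  w y'.1 y'.2 @[y' --> within (cyl b) (nbhs y)] --> w y.1 y.2.

Lemma jcont_comb b (c c' : R) w w' : jcont b w -> jcont b w' ->
  jcont b (fun z t => c * w z t + c' * w' z t).
Proof.
move=> h h' y yb; apply: cvgD; apply: cvgM; try exact: cvg_cst.
  exact: h.
exact: h'.
Qed.

(** If w is at first at most s but exceeds s somewhere, the quotient w / s has a
    maximum k > 1, which is attained at a positive time. *)
Lemma contact b w s : 0 <= b -> jcont b w -> jcont b s ->
  (forall z t, sphere z -> 0 <= t <= b -> 0 < s z t) ->
  (forall z, sphere z -> w z 0 <= s z 0) ->
  (exists z t, [/\ sphere z, 0 <= t <= b & s z t < w z t]) ->
  exists z t k, [/\ sphere z, 0 < t <= b, 1 < k, w z t = k * s z t &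
    forall z' t', sphere z' -> 0 <= t' <= b -> w z' t' <= k * s z' t'].
Proof.
move=> b0 cw cs s0 ini [z1 [t1 [z1S t1b lt1]]].
pose f (y : 'rV[R]_n * R) := w y.1 y.2 / s y.1 y.2.
have cf : {within cyl b, continuous f}.
  apply/subspace_continuousP => -[z t] yb; have [zS tb] := (cylP b z t).1 yb.
  apply: cvgM; first exact: cw.
  by apply: cvgV; [rewrite gt_eqF // s0|exact: cs].
have cc : compact (cyl b) by apply: compact_setX; [exact: sphere_compact|exact: segment_compact].
have c1 : cyl b (z1, t1) by apply/cylP.
have [[z t] /set_mem /cylP [zS tb] fmax] := compact_EVT_max (ex_intro _ _ c1) cc cf.
exists z, t, (w z t / s z t).
have st := s0 z t zS tb.
have k1 : 1 < w z t / s z t.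
  have := fmax _ (mem_set c1); rewrite /f /=; apply: lt_le_trans.
  by rewrite ltr_pdivlMr ?mul1r // s0.
split => //.
- case/andP: (tb) => t0 ->; rewrite andbT lt_neqAle t0 andbT.
  apply: contraTneq k1 => <-; rewrite -leNgt ler_pdivrMr ?mul1r ?ini //.
  by apply: s0; rewrite // lexx.
- by rewrite divfK // gt_eqF.
move=> z' t' z'S t'b; have c' : cyl b (z', t') by apply/cylP.
by have := fmax _ (mem_set c'); rewrite /f /= ler_pdivrMr // s0.
Qed.

(** The first-order condition in time at a contact point. *)
Lemma contact_time b (f1 f2 : R -> R) (t k l1 l2 : R) : 0 < t <= b ->
  f1 t = k * f2 t -> (forall v : R, 0 <= v <= b -> f1 v <= k * f2 v) ->
  is_derive_in [set v : R | 0 <= v <= b] f1 t l1 ->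
  is_derive_in [set v : R | 0 <= v <= b] f2 t l2 -> k * l2 <= l1.
Proof.
move=> /andP[t0 tb] E le d1 d2; rewrite leNgt; apply/negP => lt.
have /is_derive_inP d := is_derive_in_comb (a := 1) (b := - k) d1 d2.
set l := 1 * l1 + - k * l2 in d.
have l0 : l < 0 by rewrite /l; lra.
have e0 : 0 < - l / 2 by rewrite divr_gt0 // oppr_gt0.
have [r r0 hr] := d _ e0.
set m := Num.min (r / 2) t.
have m0 : 0 < m by rewrite lt_min t0 divr_gt0.
have mr : m < r by rewrite gt_min ltr_pdivrMr // ltr_pMr // ltr1n.
have mt : m <= t by rewrite ge_min lexx orbT.
have vb : 0 <= t - m <= b by rewrite subr_ge0 mt /= (le_trans _ tb) // gerBl ltW.
have nE : `|t - m - t| = m by rewrite addrAC subrr add0r normrN gtr0_norm.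
have := hr (t - m) vb; rewrite nE => /(_ mr) /ler_normlP [+ _].
have := le _ vb; rewrite E; have -> : t - m - t = - m by ring.
have lm : l * m < 0 by rewrite nmulr_rlt0.
lra.
Qed.

(** W is positively 1-homogeneous, with gradient field GW whose derivative at z
    is BW. *)
Definition profile (W : 'rV[R]_n -> R) (GW : 'rV[R]_n -> 'rV[R]_n) z (BW : 'M[R]_n) :=
  [/\ forall c x, 0 < c -> x != 0 -> W (c *: x) = c * W x,
      forall x, x != 0 -> has_grad W x (GW x) & has_jac GW z BW].

Lemma profile_comb W W' GW GW' z B B' c c' : profile W GW z B ->
  profile W' GW' z B' ->
  profile (fun x => c * W x + c' * W' x) (fun x => c *: GW x + c' *: GW' x) z
    (c *: B + c' *: B').
Proof.
move=> [r g j] [r' g' j']; split.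
- by move=> a x a0 x0; rewrite r // r' //; ring.
- by move=> x x0; apply: has_gradD; apply: has_gradZ; [exact: g|exact: g'].
have cst a F A : has_jac F z A -> has_jac (fun x : 'rV[R]_n => a *: F x : 'rV[R]_n) z (a *: A).
  by move=> h; have := has_jacZ (has_grad_cst a z) h; rewrite trmx0 mul0mx add0r.
by apply: has_jacD; exact: cst.
Qed.

Lemma profile_dot a z : profile (fun x => dot x a) (fun=> a) z 0.
Proof.
split; [by move=> c x _ _; rewrite dotZl| |exact: has_jac_cst].
move=> x _ e e0; near=> y.
by rewrite dotBl subrr normr0 mulr_ge0 // ltW.
Unshelve. all: by end_near. Qed.

(** The second-order condition in space at a contact point: by homogeneity the
    inequality on the sphere extends to the whole space, where k S - W has a
    minimum at z. *)
Lemma contact_space W S GW GS z BW BS k : sphere z -> profile W GW z BW ->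
  profile S GS z BS -> (forall nu, sphere nu -> W nu <= k * S nu) ->
  W z = k * S z -> forall v, dot (v *m BW) v <= k * dot (v *m BS) v.
Proof.
move=> zS pW pS le E v.
have [r g j] := profile_comb k (-1) pS pW.
have z0 := sphere_neq0 zS; have nz := near_neq0 z0.
have : 0 <= dot (v *m (k *: BS + -1 *: BW)) v.
  apply: min_hess_ge0 _ j _.
    by apply: filter_app nz; near=> y; exact: g.
  apply: filter_app nz; near=> y => y0; rewrite {1}E mulN1r subrr.
  have -> : y = enorm y *: normalize y.
    by rewrite /normalize scalerA mulfV ?scale1r // gt_eqF // enorm_gt0.
  have yS := normalize_sphere y0.
  rewrite (r _ _ _ (sphere_neq0 yS)) ?enorm_gt0 //.
  by rewrite mulr_ge0 ?enorm_ge0 // mulN1r subr_ge0 le.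
rewrite mulmxDr -!scalemxAr dotDl !dotZl mulN1r subr_ge0 //.
Unshelve. all: by end_near. Qed.

End Contact.

Lemma profile_body (R : realType) n (K : set 'rV[R]_n) z : smooth_strictly_convex K ->
  sphere z -> exists2 B, profile (support_fun K) (max_point K) z B &
    orth_posdef z B /\ Sn1 (support_fun K) z = det_form z B.
Proof.
move=> Kss zS; have [B jB Bp] := body_has_jac Kss (sphere_neq0 zS).
have cK := body_compact Kss; have K0 := body_nonempty Kss.
exists B; last by split=> //; exact: Sn1_body.
split => //.
- by move=> c x; exact: support_ray.
- by move=> x; apply: support_has_grad => //; exact: body_max_unique.
Qed.

Lemma enorm_le_norm (R : realType) n (x : 'rV[R]_n) : enorm x <= (n%:R + 1) * `|x|.
Proof.
have k0 : 0 < n%:R + 1 :> R by rewrite ltr_wpDl ?ler0n.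
rewrite -[leRHS]ger0_norm ?mulr_ge0 ?(ltW k0) // -sqrtr_sqr ler_wsqrtr //.
apply: le_trans (ler_norm _) _; apply: le_trans (dot_le_norm _ _) _.
rewrite exprMn expr2 (expr2 `|x|) -mulrA; apply: ler_wpM2r; first exact: mulr_ge0.
by apply: (@le_trans _ _ ((n%:R + 1) * 1)); [rewrite mulr1 lerDl|
  rewrite ler_pM2l // lerDr ler0n].
Qed.

(** A body whose support function is at least c contains the ball of radius c. *)
Lemma interior_of_support (R : realType) n (K : set 'rV[R]_n) (c : R) :
  smooth_strictly_convex K -> 0 < c ->
  (forall nu, sphere nu -> c <= support_fun K nu) -> interior K 0.
Proof.
move=> Kss c0 hc; have cK := body_compact Kss; have K0 := body_nonempty Kss.
suff sub x : enorm x < c -> K x.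
  have k0 : 0 < n%:R + 1 :> R by rewrite ltr_wpDl ?ler0n.
  have := near_norm_lt (0 : 'rV[R]_n) (divr_gt0 c0 k0).
  apply: filter_app; near=> x; rewrite subr0 => xc; apply: sub.
  have h := enorm_le_norm x.
  by apply: le_lt_trans h _; rewrite mulrC -ltr_pdivlMr.
(* A point outside K is separated from K by the direction to its nearest
   point. *)
move=> xc; apply: contrapT => nKx.
have cd : continuous (fun y : 'rV[R]_n => dot (y - x) (y - x)).
  move=> y; have FF : Filter (nbhs y) by exact: nbhs_filter.
  have cy : (y' - x) @[y' --> y] --> y - x by apply: cvgB; [exact: cvg_id|exact: cvg_cst].
  exact: cvg_dot.
have [y /set_mem Ky ymin] := EVT_min_rV K0 cK (continuous_subspaceT cd).
set nu := x - y.
have nu0 : nu != 0 by rewrite subr_eq0; apply: contra_not_neq nKx => ->.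
have ny : y - x = - nu by rewrite opprB.
have nuE : nu = x - y by [].
clearbody nu.
have ymax y' : K y' -> dot nu y' <= dot nu y.
  move=> Ky'; rewrite -subr_le0 -dotBr leNgt; apply/negP => pos.
  have pd : 0 < dot (y' - y) (y' - y).
    by rewrite dot_gt0; apply: contraTneq pos => ->; rewrite dot0r ltxx.
  pose t := Num.min 1 (dot nu (y' - y) / dot (y' - y) (y' - y)).
  have t0 : 0 < t by rewrite lt_min ltr01 divr_gt0.
  have t1 : t <= 1 by rewrite ge_min lexx.
  have td : t * dot (y' - y) (y' - y) <= dot nu (y' - y).
    by rewrite -ler_pdivlMr // ge_min lexx orbT.
  have tt : 0 <= t <= 1 by rewrite ltW.
  have := ymin _ (mem_set (body_convex Kss Ky Ky' tt)).
  have -> : y + t *: (y' - y) - x = - nu + t *: (y' - y) by rewrite addrAC ny.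
  rewrite ny; move: (y' - y) pos td => w pos td.
  rewrite !(dotDl, dotDr, dotZl, dotZr, dotNl, dotNr) (dotC w nu).
  have : t * (t * dot w w) <= t * dot nu w by rewrite ler_pM2l.
  have : 0 < t * dot nu w by rewrite mulr_gt0.
  lra.
have h1 : support_fun K nu <= dot nu y.
  by rewrite (support_max_point cK K0 nu0); apply: ymax; exact: max_point_in.
have h2 : enorm nu * c <= support_fun K nu.
  have nE : nu = enorm nu *: normalize nu.
    by rewrite /normalize scalerA mulfV ?scale1r // gt_eqF // enorm_gt0.
  have nS := normalize_sphere nu0; have n0 := sphere_neq0 nS.
  rewrite {2}nE (support_ray cK K0) ?enorm_gt0 //.
  by rewrite ler_pM2l ?enorm_gt0 // hc.
have h3 : dot nu y = dot nu x - dot nu nu.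
  by rewrite -dotBr {3}nuE opprB (addrC x) subrK.
have h4 : 0 < dot nu nu by rewrite dot_gt0.
have h5 : enorm nu * enorm x < enorm nu * c by rewrite ltr_pM2l ?enorm_gt0.
have := le_lt_trans (dot_le_enorm nu x) h5.
rewrite ltNge (le_trans h2) // (le_trans h1) // h3 gerBl ltW //.
Unshelve. all: by end_near. Qed.

(** * Elementary inequalities for powers *)

Section Powers.
Context {R : realType}.
Implicit Types p x y k a : R.

Lemma powR_lt_self p k : 0 < p < 1 -> 1 < k -> k `^ p < k.
Proof.
move=> p01 k1; have := weighted_AGM p01 ler01 (ltW (lt_trans ltr01 k1)).
case/andP: p01 => p0 p1; rewrite powR1 mul1r mulr1 => h; apply: le_lt_trans h _.
have : 0 < (1 - p) * (k - 1) by rewrite mulr_gt0 // subr_gt0.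
lra.
Qed.

Lemma powR_le1 p x : 0 < p < 1 -> 0 <= x <= 1 -> x `^ (1 - p) <= 1.
Proof.
move=> p01 /andP[x0 x1]; have := weighted_AGM p01 x0 ler01.
case/andP: p01 => p0 p1; rewrite powR1 !mulr1 => h; apply: le_trans h _.
have : 0 <= (1 - p) * (1 - x) by rewrite mulr_ge0 // subr_ge0 // ltW.
lra.
Qed.

(** Bernoulli inequalities for the time change a |-> a^(1-p). *)
Lemma bernoulli_lower p a : 0 < p < 1 -> 0 < a ->
  (1 - p) * (1 - a) <= 1 - a `^ (1 - p).
Proof.
move=> p01 a0; have := weighted_AGM p01 (ltW a0) ler01.
rewrite powR1 !mulr1; lra.
Qed.

Lemma bernoulli_upper p a : 0 < p < 1 -> 0 < a <= 1 ->
  1 - a `^ (1 - p) <= (1 - p) * ((1 - a) / a).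
Proof.
move=> p01 /andP[a0 a1]; have ai0 : 0 < a^-1 by rewrite invr_gt0.
have aq0 : 0 < a `^ (1 - p) by rewrite powR_gt0.
have aq1 : a `^ (1 - p) <= 1 by rewrite powR_le1 // ltW.
have aV : a^-1 `^ (1 - p) = (a `^ (1 - p))^-1.
  by rewrite -(powR_inv1 (ltW a0)) -powRrM mulN1r powRN.
have := bernoulli_lower p01 ai0; rewrite aV; set b := a `^ (1 - p) in aq0 aq1 *.
case/andP: p01 => p0 p1 h.
have h1 : (1 - p) * (b * (1 - a^-1)) <= b - 1.
  rewrite mulrCA; apply: le_trans (ler_wpM2l (ltW aq0) h) _.
  by rewrite mulrBr mulr1 mulfV // gt_eqF.
have h2 : (1 - p) * (b * (a^-1 - 1)) <= (1 - p) * ((1 - a) / a).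
  apply: ler_wpM2l; first by rewrite subr_ge0 ltW.
  rewrite mulrBl mul1r mulfV ?gt_eqF // -[leRHS]mul1r; apply: ler_wpM2r => //.
  by rewrite subr_ge0 -[leLHS]invr1 lef_pV2 // posrE.
by apply: le_trans h2; move: h1; lra.
Qed.

Lemma powR_scaled_le p (m : nat) x y k : (0 < m)%N -> 0 < p -> 0 < k ->
  0 <= x -> 0 <= y -> x <= k ^+ m * y ->
  x `^ (p / m%:R) <= k `^ p * y `^ (p / m%:R).
Proof.
move=> m0 p0 k0 x0 y0 le.
have mR : (m%:R : R) != 0 by rewrite pnatr_eq0 -lt0n.
have -> : k `^ p * y `^ (p / m%:R) = (k ^+ m * y) `^ (p / m%:R).
  rewrite powRM // ?exprn_ge0 ?(ltW k0) // -powR_mulrn ?ltW // -powRrM.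
  by congr (_ `^ _ * _); rewrite mulrC divfK.
apply: ge0_ler_powR => //; first by rewrite divr_ge0 ?ler0n // ltW.
by rewrite nnegrE mulr_ge0 // exprn_ge0 // ltW.
Qed.

End Powers.

(** * Arithmetic of the barrier and concavity arguments *)

Lemma shrink_factor (R : realType) (x : R) : 0 < x < 1 -> 0 < (1 - x) / 2 < 1.
Proof. by move=> h; lra. Qed.

Lemma split_gap (R : realType) (x y : R) : x < y -> exists2 e, 0 < e & y = x + 2 * e.
Proof.
move=> xy; exists ((y - x) / 2); first by rewrite divr_gt0 // subr_gt0.
by field.
Qed.

Lemma lt_close (R : realType) (A X Y e : R) :
  Y - A < e -> A + 2 * e - X < e -> Y < X.
Proof. by move=> h1 h2; lra. Qed.

Lemma half_compl (R : realType) (x : R) : x <= 2^-1 -> 2^-1 <= 1 - x.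
Proof. by move=> h; lra. Qed.

Lemma time_step_small (R : realType) (g eta a : R) : 0 < g -> 0 < eta -> 2^-1 <= a ->
  g * (eta / a) < 4 * g * eta.
Proof.
move=> g0 e0 ah; have a0 : 0 < a by apply: lt_le_trans ah; rewrite invr_gt0.
rewrite mulrA ltr_pdivrMr // (_ : 4 * g * eta * a = 4 * a * (g * eta)); last by ring.
by rewrite ltr_pMl ?mulr_gt0 //; lra.
Qed.

Lemma speed_margin (R : realType) (F e a1 eta : R) : 2 * (F + 2 * e) * eta <= e ->
  1 - a1 = eta -> 0 < e -> F + e < (F + 2 * e) * a1.
Proof.
move=> h eq e0; have -> : a1 = 1 - eta by rewrite -eq subKr.
by move: h; rewrite mulrBr mulr1 -mulrA; move: (_ * eta) => X h; lra.
Qed.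

(** A value s1, reached from s0 = rho d backward in time at a speed close to F,
    stays above the value reached at a speed c d which is larger by a margin. *)
Lemma earlier_gap_gt0 (R : realType) (s0 s1 t u F e qt eta a1 rho c d : R) :
  - (s1 - s0 - F * (u - t)) <= e * (t - u) -> t - u <= qt * (eta / a1) ->
  0 < F + e -> 0 < a1 -> 0 < qt -> 0 < eta -> F + e < c * d * a1 -> rho * d = s0 ->
  0 < s1 - (rho - eta * (qt * c)) * d.
Proof.
move=> h1 h2 Fe a0 q0 e0 h3 h4.
have h5 : (F + e) * (t - u) <= (F + e) * (qt * (eta / a1)) by rewrite ler_pM2l.
have h6 : (F + e) * (qt * (eta / a1)) < c * d * (qt * eta).
  rewrite (_ : (F + e) * (qt * (eta / a1)) = (F + e) / a1 * (qt * eta)); last by ring.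
  by rewrite ltr_pM2r ?mulr_gt0 // ltr_pdivrMr.
rewrite (_ : s1 - _ = s1 - rho * d + c * d * (qt * eta)); last by ring.
by rewrite h4; lra.
Qed.

Lemma support_gap_bound (R : realType) (s rho x g d : R) : 0 < s -> 0 <= rho -> 0 <= x ->
  x <= g -> `|d| <= 1 -> - (rho + g) <= s - (rho - x) * d.
Proof.
move=> s0 r0 x0 xg d1.
have h1 : (rho - x) * d <= rho + g.
  apply: le_trans (ler_norm _) _; rewrite normrM -[leRHS]mulr1.
  apply: ler_pM => //; apply: le_trans (ler_normB _ _) _.
  by rewrite !ger0_norm // lerD2l.
have h2 : 0 <= rho + g by rewrite addr_ge0 // (le_trans x0).
lra.
Qed.

Lemma earlier_time_gt0 (R : realType) (t u : R) : t - u < t / 2 -> 0 < t -> 0 < u.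
Proof. by move=> h t0; lra. Qed.

(** Subtracting an affine function of a preserves concavity in a. *)
Lemma support_gap_concave (R : realType) (g d rho l0 l1 a a1 s0 s1 sa : R) : l0 + l1 = 1 ->
  l0 * a1 + l1 * 1 = a -> l0 * s0 + l1 * s1 <= sa ->
  l0 * (s0 - (rho - (1 - a1) * g) * d) + l1 * (s1 - rho * d) <=
  sa - (rho - (1 - a) * g) * d.
Proof.
move=> l01 la le; rewrite -subr_ge0.
have -> : sa - (rho - (1 - a) * g) * d - (l0 * (s0 - (rho - (1 - a1) * g) * d) +
  l1 * (s1 - rho * d)) = (sa - (l0 * s0 + l1 * s1)) +
  ((l0 + l1 - 1) * (rho * d) + (1 - a - l0 * (1 - a1)) * g * d) by ring.
have -> : l0 + l1 - 1 = 0 by rewrite l01 subrr.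
have -> : 1 - a - l0 * (1 - a1) = 0 by rewrite -la -{1}l01; ring.
by rewrite !mul0r !addr0 subr_ge0.
Qed.

(** An interpolation is nonnegative when the weight of its possibly negative
    term is small. *)
Lemma interpolation_ge0 (R : realType) (l0 l1 k m M x : R) : l0 + l1 = 1 -> 0 < l0 -> 0 < l1 ->
  - M <= k -> m <= x -> l0 * (m + M) <= m -> 0 <= l0 * k + l1 * x.
Proof.
move=> l01 l00 l10 kM mx le.
have h1 : l0 * - M <= l0 * k by rewrite ler_pM2l.
have h2 : l1 * m <= l1 * x by rewrite ler_pM2l.
have h3 : l1 * m = m - l0 * m.
  have -> : l1 = 1 - l0 by rewrite -l01 addrAC subrr add0r.
  by rewrite mulrBl mul1r.
lra.
Qed.

(** The bounds on the radial function r, with value rho and expected derivative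
    ell at time t, in the form of difference estimates. *)
Lemma radial_forward (R : realType) (rho r tau c ell e : R) : rho + tau * c <= r ->
  tau * (ell - e) <= tau * c -> - (e * tau) <= r - rho - ell * tau.
Proof. by move=> h1 h2; lra. Qed.

Lemma radial_quotient (R : realType) (a rho l x d : R) : d != 0 ->
  (a - rho * d - l * d * x) / d = a / d - rho - l * x.
Proof. by move=> d0; field. Qed.

Lemma radial_backward (R : realType) (rho r t u ell e : R) :
  rho - (t - u) * (ell + e) <= r -> - (e * (t - u)) <= r - rho - ell * (u - t).
Proof. by move=> h1; lra. Qed.

(** The contradiction at a contact point of the forward barrier. *)
Lemma barrier_speed (R : realType) (c r f x xB y rp : R) : 0 < c -> 0 < f -> 0 < x ->
  rp < r / c -> xB <= rp * x -> r * (f * x) <= y -> y < c * (f * xB) -> False.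
Proof.
move=> c0 f0 x0 rk le1 le2 lt2.
have h1 : c * (f * xB) <= c * (f * (rp * x)) by rewrite !ler_pM2l.
have h2 : c * (f * (rp * x)) < r * (f * x).
  have -> : r * (f * x) = c * (f * (r / c * x)) by field; rewrite gt_eqF.
  by rewrite !ltr_pM2l // ltr_pM2r.
by have := lt_le_trans (lt_le_trans lt2 h1) (le_trans (ltW h2) le2); rewrite ltxx.
Qed.

(** The contradiction at a contact point of an interpolation in time. *)
Lemma concave_speed (R : realType) (l0 l1 k f b b0 b1 x x0 x1 xW r : R) :
  0 < f -> 0 < b -> 0 < x -> r < k ->
  xW <= r * x -> l0 * (b0 * x0) + l1 * (b1 * x1) <= b * xW ->
  ~ k * (b * (f * x)) <= l0 * (b0 * (f * x0)) + l1 * (b1 * (f * x1)).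
Proof.
move=> f0 b_0 x_0 rk le conc ct.
have le1 : f * (b * xW) <= f * (b * (r * x)) by rewrite !ler_pM2l.
have le2 : f * (l0 * (b0 * x0) + l1 * (b1 * x1)) <= f * (b * xW) by rewrite ler_pM2l.
have le3 : r * (b * (f * x)) < k * (b * (f * x)) by rewrite ltr_pM2r // !mulr_gt0.
have e1 : f * (b * (r * x)) = r * (b * (f * x)) by ring.
have e2 : f * (l0 * (b0 * x0) + l1 * (b1 * x1)) =
  l0 * (b0 * (f * x0)) + l1 * (b1 * (f * x1)) by ring.
rewrite e1 in le1; rewrite e2 in le2.
by have := lt_le_trans le3 (le_trans ct (le_trans le2 le1)); rewrite ltxx.
Qed.

(** * The flow *)

(** The normal speed Phi S_(n-1)^(p/(n-1)) of K u at the boundary point with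
    normal z: the right-hand side of the flow equation. *)
Definition flow_speed (R : realType) (n : nat) (p : R) (Phi : 'rV[R]_n -> R)
    (K : R -> set 'rV[R]_n) (u : R) (z : 'rV[R]_n) : R :=
  Phi z * Sn1 (support_fun (K u)) z `^ (p / n.-1%:R).

Lemma flow_speedE (R : realType) (n : nat) (Phi : 'rV[R]_n -> R) (p : R)
    (K : R -> set 'rV[R]_n) u z d : Sn1 (support_fun (K u)) z = d ->
  flow_speed p Phi K u z = Phi z * d `^ (p / n.-1%:R).
Proof. by move=> <-. Qed.

Section Flow.
Context (R : realType) (n : nat) (p : R) (Phi : 'rV[R]_n -> R)
  (T : \bar R) (K : R -> set 'rV[R]_n).
(* The time interval. *)
Let D : set R := [set u : R | 0 <= u /\ (u%:E < T)%E].
Local Notation s u := (support_fun (K u)).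
Local Notation F := (flow_speed p Phi K).
Hypotheses (n2 : (2 <= n)%N) (p01 : 0 < p < 1).
Hypothesis Phi_smooth : smooth_sphere Phi.
Hypothesis Phi0 : forall z, sphere z -> 0 < Phi z.
Hypothesis Kss : forall t, D t -> smooth_strictly_convex (K t).
Hypothesis K00 : interior (K 0) 0.
Hypothesis flow : forall z t, sphere z -> D t ->
  is_derive_in D (fun u => s u z) t (F t z).
Implicit Types (t u v : R) (z nu : 'rV[R]_n).

Let m0 : (0 < n.-1)%N. Proof. by case: n n2 => [|[]]. Qed.
Let p0 : 0 < p. Proof. by case/andP: p01. Qed.
Let p1 : p < 1. Proof. by case/andP: p01. Qed.
Let q0 : 0 < 1 - p. Proof. by rewrite subr_gt0. Qed.

Lemma time_le u v : 0 <= u <= v -> D v -> D u.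
Proof.
by move=> /andP[u0 uv] [_ vT]; split=> //; apply: le_lt_trans vT; rewrite lee_fin.
Qed.

Lemma time_extend t : D t -> exists2 d, 0 < d & D (t + d).
Proof.
move=> [t0 tT]; rewrite /D; case: (T) tT => [r| |] //=.
  rewrite lte_fin => tr; exists ((r - t) / 2); first by rewrite divr_gt0 // subr_gt0.
  by split; [rewrite addr_ge0 // divr_ge0 // subr_ge0 ltW|rewrite /= lte_fin; lra].
by exists 1 => //; split; [rewrite addr_ge0|rewrite ltry].
Qed.

Lemma time0 t : D t -> D 0.
Proof. by move=> Dt; apply: (time_le _ Dt); rewrite lexx; case: Dt. Qed.

Lemma speed_gt0 t z : D t -> sphere z -> 0 < F t z.
Proof.
by move=> Dt zS; rewrite mulr_gt0 ?Phi0 // powR_gt0 // Sn1_body_gt0 // ; exact: Kss.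
Qed.

(** Along the sphere the speed at a fixed time is continuous. *)
Lemma speed_continuous t z e : D t -> sphere z -> 0 < e ->
  exists2 d, 0 < d & forall z', sphere z' -> `|z' - z| < d -> `|F t z' - F t z| < e.
Proof.
move=> Dt zS e0; have FF : Filter (nbhs z) by exact: nbhs_filter.
have cS : Sn1 (s t) z' @[z' --> within sphere (nbhs z)] --> Sn1 (s t) z.
  move: z zS {FF}; apply: within_continuous_eps => z zS r r0.
  have [d d0 hd] := Sn1_body_continuous (Kss Dt) zS r0.
  by exists d => // z' z'S zd; rewrite ltW // hd.
have cP : Phi (normalize z') @[z' --> within sphere (nbhs z)] --> Phi z.
  apply: cvg_within_filter; rewrite -{2}(normalize_id zS).
  have d := @Phi_smooth [::] z (sphere_neq0 zS).
  by have := differentiable_continuous d; apply.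
have cF : Phi (normalize z') * Sn1 (s t) z' `^ (p / n.-1%:R)
    @[z' --> within sphere (nbhs z)] --> F t z.
  apply: cvgM cP _.
  apply: (@continuous_cvg _ _ _ _ _ _ (fun x => x `^ (p / n.-1%:R))) cS.
  have Sp : Sn1 (s t) z \in `]0, +oo[ by rewrite in_itv /= andbT; exact: (Sn1_body_gt0 (Kss Dt) zS).
  have /derivable1_diffP := derivable_powR (v := 1) (x := p / n.-1%:R) Sp.
  exact: differentiable_continuous.
have /cvgrPdist_lt /(_ e e0) := cF; rewrite near_withinE => /nbhs_ballP [d d0 hd].
exists d => // z' z'S zd; have bz : ball z d z' by rewrite -ball_normE /ball_ /= distrC.
rewrite distrC; have := hd z' bz z'S; rewrite (normalize_id z'S); exact.
Qed.

Lemma support_nondecreasing t u z : sphere z -> 0 <= t <= u -> D u -> s t z <= s u z.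
Proof.
move=> zS /andP[t0 tu] Du.
have Dx x : t <= x <= u -> D x.
  by move=> /andP[tx xu]; apply: time_le Du; rewrite xu (le_trans t0).
apply: (derive_in_nondecreasing (D := D) (f := fun u => s u z)) tu => // x /Dx Dx'.
by exists (F x z); [rewrite ltW // speed_gt0|exact: flow].
Qed.

(** The support functions are bounded below, uniformly in time. *)
Lemma support_lower t : D t -> exists2 c, 0 < c & forall u nu, D u -> sphere nu ->
  c <= s u nu.
Proof.
move=> Dt; have D0 := time0 Dt.
have [r r0 rK] := body_inner_ray K00.
exists r => // u nu Du nuS; have nu0 := sphere_neq0 nuS.
apply: (@le_trans _ _ (s 0 nu)); last first.
  by apply: support_nondecreasing => //; rewrite lexx; case: Du.
apply: le_trans (support_ge (body_compact (Kss D0)) nu0 (rK _ nu0)).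
rewrite dotZr sphere_dot // mulr1 ler_pdivlMr ?normr_gt0 //.
rewrite -[leRHS]mulr1 ler_pM2l //.
by apply: le_trans (norm_le_enorm nu) _; rewrite nuS.
Qed.

(** The support function increases, so that the origin stays inside. *)
Lemma flow_interior t : D t -> interior (K t) 0.
Proof.
move=> Dt; have [c c0 hc] := support_lower Dt.
by apply: (interior_of_support (Kss Dt) c0) => nu; exact: hc.
Qed.

Lemma flow_bounded t : D t -> exists2 C, 0 < C & forall u y, 0 <= u <= t ->
  K u y -> enorm y <= C.
Proof.
move=> Dt; have [M [_ hM]] := compact_bounded (body_compact (Kss Dt)).
have k0 : 0 < n%:R + 1 :> R by rewrite ltr_wpDl ?ler0n.
exists ((n%:R + 1) * (`|M| + 1)); first by rewrite mulr_gt0 // ltr_wpDl.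
have bt y : K t y -> enorm y <= (n%:R + 1) * (`|M| + 1).
  move=> Ky; apply: le_trans (enorm_le_norm y) _; rewrite ler_pM2l //.
  by apply: hM => //; rewrite ltr_pwDr // ler_norm.
move=> u y ut Ky; have Du : D u by exact: time_le ut Dt.
have [->|y0] := eqVneq y 0.
  by rewrite /enorm dot0l sqrtr0 mulr_ge0 ?ltW // ltr_wpDl.
have nS := normalize_sphere y0; have nn0 := sphere_neq0 nS.
have E : enorm y = dot (normalize y) y.
  by rewrite /normalize dotZl -sqr_enorm expr2 mulrA mulVf ?mul1r // gt_eqF // enorm_gt0.
rewrite E; apply: le_trans (support_ge (body_compact (Kss Du)) nn0 Ky) _.
apply: le_trans (support_nondecreasing nS ut Dt) _.
rewrite (support_max_point (body_compact (Kss Dt)) (body_nonempty (Kss Dt)) nn0).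
apply: le_trans (dot_le_enorm _ _) _; rewrite nS mul1r; apply: bt.
exact: max_point_in (body_compact (Kss Dt)) (body_nonempty (Kss Dt)) _.
Qed.

(** Joint continuity: continuity in time, together with a Lipschitz bound in
    space which is uniform in time. *)
Lemma flow_jcont a c b : 0 <= a -> 0 < c -> D (a + c * b) ->
  jcont b (fun z v => s (a + c * v) z).
Proof.
move=> a0 c0 Db.
have [C C0 hC] := flow_bounded Db.
have ub v : 0 <= v <= b -> 0 <= a + c * v <= a + c * b.
  by move=> /andP[v0 vb]; rewrite addr_ge0 ?mulr_ge0 ?(ltW c0) //= lerD2l ler_pM2l.
have Dv v : 0 <= v <= b -> D (a + c * v) by move=> /ub h; exact: time_le h Db.
apply: (within_continuous_eps (f := fun y => s (a + c * y.2) y.1)).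
move=> -[z v] /cylP [zS vb] e e0 /=.
have [d d0 hd] := derive_in_continuous (flow zS (Dv v vb)) (divr_gt0 e0 (ltr0Sn _ 1)).
have k0 : 0 < n%:R + 1 :> R by rewrite ltr_wpDl ?ler0n.
have r0 : 0 < e / 2 / C / (n%:R + 1) by rewrite !divr_gt0.
exists (Num.min (d / c) (e / 2 / C / (n%:R + 1))) => [|[z' v'] /cylP [z'S v'b]].
  by rewrite lt_min r0 divr_gt0.
rewrite prod_normE gt_max !lt_min => /andP[/andP[_ zz] /andP[vv _]] /=.
have h1 : `|s (a + c * v') z - s (a + c * v) z| <= e / 2.
  apply: hd; first exact: Dv.
  have -> : a + c * v' - (a + c * v) = c * (v' - v) by ring.
  by rewrite normrM gtr0_norm // mulrC -ltr_pdivlMr.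
have h2 : `|s (a + c * v') z' - s (a + c * v') z| <= e / 2.
  have cK := body_compact (Kss (Dv v' v'b)); have K0 := body_nonempty (Kss (Dv v' v'b)).
  have bK y : K (a + c * v') y -> enorm y <= C by apply: hC; exact: ub.
  have z0 := sphere_neq0 zS; have z0' := sphere_neq0 z'S.
  have l1 := support_lip cK K0 z0' z0 bK; have l2 := support_lip cK K0 z0 z0' bK.
  have small (x : 'rV[R]_n) : `|x| < e / 2 / C / (n%:R + 1) -> enorm x * C <= e / 2 :> R.
    move=> xs; rewrite -ler_pdivlMr //; apply: le_trans (enorm_le_norm x) _.
    by rewrite -ler_pdivlMl // mulrC ltW.
  have s1 := small _ zz; have s2 : enorm (z - z') * C <= e / 2.
    by apply: small; rewrite distrC; exact: zz.
  by rewrite ler_norml; apply/andP; split; lra.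
have := ler_normD (s (a + c * v') z' - s (a + c * v') z) (s (a + c * v') z - s (a + c * v) z).
rewrite subrKA; lra.
Qed.

(** The derivative of the support function along a rescaled time. *)
Lemma flow_derive a c b z v : sphere z -> 0 <= a -> 0 < c -> D (a + c * b) -> 0 <= v <= b ->
  is_derive_in [set x : R | 0 <= x <= b] (fun x => s (a + c * x) z) v (c * F (a + c * v) z).
Proof.
move=> zS a0 c0 Db vb.
have Dv x : 0 <= x <= b -> D (a + c * x).
  move=> /andP[x0 xb]; apply: time_le Db.
  by rewrite addr_ge0 ?mulr_ge0 ?(ltW c0) //= lerD2l ler_pM2l.
apply: (is_derive_in_scale (f := fun u => s u z) (D := D)) => //.
exact: flow zS (Dv v vb).
Qed.

(** The support function is a concave function of a after the time change
    t = a^(1-p) th: otherwise the interpolation and the solution touch at a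
    contact point, where concavity of the speed in (a, Hessian) and its
    homogeneity of degree p < 1 in the Hessian contradict each other. *)
Lemma time_concave th a0 a1 l0 l1 z : 0 < th -> 0 < a0 -> 0 < a1 ->
  0 < l0 -> 0 < l1 -> l0 + l1 = 1 ->
  let tm a := a `^ (1 - p) * th in
  D (tm a0) -> D (tm a1) -> D (tm (l0 * a0 + l1 * a1)) -> sphere z ->
  l0 * s (tm a0) z + l1 * s (tm a1) z <= s (tm (l0 * a0 + l1 * a1)) z.
Proof.
move=> th0 a00 a10 l00 l10 l01 tm D0 D1 D2 zS.
set a := l0 * a0 + l1 * a1 in D2 *.
have a0' : 0 < a by rewrite addr_gt0 ?mulr_gt0.
rewrite leNgt; apply/negP => lt.
have pos x : 0 < x -> 0 < x `^ (1 - p) by move=> x0; rewrite powR_gt0.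
have E0 x : 0 + x `^ (1 - p) * th = tm x by rewrite add0r.
have Db x : D (tm x) -> D (0 + x `^ (1 - p) * th) by rewrite E0.
pose S x z v := s (0 + x `^ (1 - p) * v) z.
have cS x : 0 < x -> D (tm x) -> jcont th (S x).
  by move=> x0 Dx; apply: flow_jcont => //; [exact: pos|exact: Db].
have Dx x v : 0 < x -> D (tm x) -> 0 <= v <= th -> D (0 + x `^ (1 - p) * v).
  move=> x0 Dx /andP[v0 vb]; apply: time_le Dx.
  by rewrite add0r mulr_ge0 ?powR_ge0 //= ler_pM2l ?pos.
have [|||z' [t' [k [z'S t'b k1 wE wle]]]] := contact (b := th)
    (w := fun z v => l0 * S a0 z v + l1 * S a1 z v) (s := S a) (ltW th0)
    (jcont_comb (cS a0 a00 D0) (cS a1 a10 D1)) (cS a a0' D2).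
- move=> z' t' z'S t'b; have [c c0 hc] := support_lower D0.
  by apply: lt_le_trans c0 _; apply: hc => //; exact: Dx.
- by move=> z' z'S; rewrite /S !mulr0 addr0 -mulrDl l01 mul1r.
- by exists z, th; split=> //; [rewrite lexx ltW|rewrite /S !E0].
have t'b' : 0 <= t' <= th by case/andP: t'b => ? ->; rewrite ltW.
have Kx x : 0 < x -> D (tm x) -> smooth_strictly_convex (K (0 + x `^ (1 - p) * t')).
  by move=> x0 Dx'; apply: Kss; exact: Dx.
have [B0 P0 [Bp0 S0]] := profile_body (Kx a0 a00 D0) z'S.
have [B1 P1 [Bp1 S1]] := profile_body (Kx a1 a10 D1) z'S.
have [B P [Bp SB]] := profile_body (Kx a a0' D2) z'S.
have d x : 0 < x -> D (tm x) -> is_derive_in [set v : R | 0 <= v <= th] (S x z') t'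
    (x `^ (1 - p) * F (0 + x `^ (1 - p) * t') z').
  by move=> x0 Dx'; apply: flow_derive => //; [exact: pos|exact: Db].
have ct := contact_time t'b wE (fun v vb => wle z' v z'S vb)
  (is_derive_in_comb (a := l0) (b := l1) (d a0 a00 D0) (d a1 a10 D1)) (d a a0' D2).
have cs := contact_space z'S (profile_comb l0 l1 P0 P1) P
  (fun nu nuS => wle nu t' nuS t'b') wE.
have z0 := sphere_neq0 z'S.
have BW : orth_posdef z' (l0 *: B0 + l1 *: B1).
  by apply: orth_posdefD; exact: orth_posdefZ.
have k0 : 0 < k by apply: lt_trans k1.
have dle : det_form z' (l0 *: B0 + l1 *: B1) <= k ^+ n.-1 * det_form z' B.
  rewrite -det_formZ //; apply: det_form_le => //; first exact: orth_posdefZ.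
  by move=> u _; rewrite -[k *: B]/(k *: B) -scalemxAr dotZl; exact: cs.
have ple := powR_scaled_le m0 p0 k0 (ltW (det_form_gt0 BW)) (ltW (det_form_gt0 Bp)) dle.
have conc := det_form_concave n2 z0 p01 Bp0 Bp1 a00 a10 l00 l10 l01.
rewrite -/a in conc.
move: ct; rewrite (flow_speedE Phi p S0) (flow_speedE Phi p S1) (flow_speedE Phi p SB).
have PhiP := Phi0 z'S; have aP := pos a a0'.
have dP : 0 < det_form z' B `^ (p / n.-1%:R) by rewrite powR_gt0 // det_form_gt0.
have kp := powR_lt_self p01 k1.
move: PhiP aP dP ple conc.
by move=> PhiP aP dP ple conc; exact: (concave_speed PhiP aP dP kp ple conc).
Qed.

Section AtTime.
Variables (t : R) (z : 'rV[R]_n).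
Hypotheses (Dt : D t) (zS : sphere z).
Let z0 : z != 0. Proof. exact: sphere_neq0. Qed.
Let cK := body_compact (Kss Dt).
Let K0 := body_nonempty (Kss Dt).
Let Ki := flow_interior Dt.
Local Notation nu0 := (dual_normal (K t) z).
Local Notation sd := (support_fun (dual_body (K t)) z).
Let rho := sd^-1.
Let nuS : sphere nu0 := dual_normal_sphere (Kss Dt) Ki zS.
Let rho0 : 0 < rho. Proof. by rewrite invr_gt0 dual_gt0 //; exact: Kss. Qed.

Let GE : max_point (K t) nu0 = rho *: z.
Proof. exact: (dual_normal_max (Kss Dt) Ki zS). Qed.

Let rho_in : K t (rho *: z).
Proof. by rewrite -GE; exact: max_point_in. Qed.

Let rho_le nu : sphere nu -> rho * dot nu z <= s t nu.
Proof.
by move=> nS; rewrite -dotZr; apply: (support_ge cK (sphere_neq0 nS) rho_in).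
Qed.

Let rho_eq : s t nu0 = rho * dot nu0 z.
Proof. by rewrite (support_max_point cK K0 (sphere_neq0 nuS)) GE dotZr. Qed.

Lemma normal_dot_gt0 : 0 < dot nu0 z.
Proof.
have : 0 < rho * dot nu0 z by rewrite -rho_eq (support_gt0 (Kss Dt) Ki) ?sphere_neq0.
by rewrite pmulr_rgt0.
Qed.

Lemma dot_sphere_le1 nu : sphere nu -> `|dot nu z| <= 1.
Proof.
move=> nS; rewrite ler_norml; apply/andP; split.
  have eN : enorm (- nu) = 1 by rewrite -scaleN1r enormZ normrN1 nS mulr1.
  by have := dot_le_enorm (- nu) z; rewrite dotNl eN zS mulr1 lerNl.
by have := dot_le_enorm nu z; rewrite zS nS mulr1.
Qed.

(** Unit vectors which almost support K t at rho z are close to the normal. *)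
Lemma near_normal e : 0 < e -> exists2 m, 0 < m &
  forall nu, sphere nu -> s t nu - rho * dot nu z < m -> `|nu - nu0| < e.
Proof.
apply: (compact_unique_zero (L := sphere)
  (f := fun nu => s t nu - rho * dot nu z)) sphere_compact _ _.
  apply/subspace_continuousP => nu nS; apply: cvg_within_filter.
  have FF : Filter (nbhs nu) by exact: nbhs_filter.
  apply: cvgB.
    exact: has_grad_continuous (support_has_grad cK K0 (body_max_unique (Kss Dt)) (sphere_neq0 nS)).
  apply: cvgM; first exact: cvg_cst.
  by apply: cvg_dot; [exact: cvg_id|exact: cvg_cst].
move=> nu nS; rewrite subr_le0; exact: (dual_normal_unique (Kss Dt) Ki zS nS).
Qed.

(** Forward in time, the point (rho + (u - t) c) z stays in the body as long
    as the speed c in direction z is slower than the normal speed at rho z: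
    the body K t, shrunk a little towards rho z and then translated in
    direction z, is a barrier. *)
Lemma forward c : 0 < c -> c * dot nu0 z < F t nu0 ->
  exists2 d, 0 < d & forall u, D u -> t <= u < t + d ->
    forall nu, sphere nu -> (rho + (u - t) * c) * dot nu z <= s u nu.
Proof.
move=> c0 cF; have dz := normal_dot_gt0; have F0 := speed_gt0 Dt nuS.
set A := c * dot nu0 z in cF; have A0 : 0 < A by rewrite mulr_gt0.
(* The barrier is K t shrunk by the factor 1 - k. *)
pose k := (1 - A / F t nu0) / 2.
have AF : 0 < A / F t nu0 < 1 by rewrite divr_gt0 // ltr_pdivrMr // mul1r.
have k01 : 0 < k < 1 by apply: shrink_factor.
have [k0 k1] := andP k01; have k1' : 0 < 1 - k by rewrite subr_gt0.
have AkF : A < (1 - k) * F t nu0.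
  have -> : A = (1 - 2 * k) * F t nu0.
    rewrite (_ : 1 - 2 * k = A / F t nu0); last by rewrite /k; field; rewrite gt_eqF.
    by rewrite divfK // gt_eqF.
  rewrite ltr_pM2r // ltrD2l ltrN2 -[ltLHS]mul1r ltr_pM2r // ltr1n //.
have AE : A = c * dot nu0 z by [].
clearbody k A.
have [d1 d10 near1] : exists2 d1, 0 < d1 & forall nu, sphere nu -> `|nu - nu0| < d1 ->
    c * dot nu z < (1 - k) * F t nu.
  pose e := ((1 - k) * F t nu0 - A) / 2.
  have e0 : 0 < e by rewrite divr_gt0 // subr_gt0.
  have [r r0 hr] := speed_continuous Dt nuS (divr_gt0 e0 k1').
  have l0 : 0 < c * (n%:R * `|z|) + 1 by rewrite ltr_wpDl // !mulr_ge0 ?ler0n // ltW.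
  exists (Num.min r (e / (c * (n%:R * `|z|) + 1))) => [|nu nS].
    by rewrite lt_min r0 divr_gt0.
  rewrite lt_min => /andP[/(hr _ nS) h1 h2].
  have h3 : c * dot nu z - A < e.
    rewrite AE -mulrBr -dotBl; apply: (@le_lt_trans _ _ ((c * (n%:R * `|z|) + 1) * `|nu - nu0|)).
      apply: (@le_trans _ _ (c * (n%:R * `|z|) * `|nu - nu0|)); last first.
        by apply: ler_wpM2r => //; rewrite lerDl.
      rewrite -mulrA ler_pM2l //; apply: le_trans (ler_norm _) _.
      by apply: le_trans (dot_le_norm _ _) _; rewrite mulrAC.
    by rewrite mulrC -ltr_pdivlMr.
  have h4 : (1 - k) * F t nu0 - (1 - k) * F t nu < e.
    rewrite -mulrBr mulrC -ltr_pdivlMr //; apply: le_lt_trans (ler_norm _) _.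
    by rewrite distrC.
  have e2 : (1 - k) * F t nu0 = A + 2 * e by rewrite /e; field.
  by apply: (lt_close h3); rewrite -e2; exact: h4.
have [m m_gt0 hm] := near_normal d10.
have [d2 d20 Dd2] := time_extend Dt.
pose th := Num.min d2 (k * m / (2 * c)).
have th0 : 0 < th by rewrite lt_min d20 divr_gt0 ?mulr_gt0.
have t0 : 0 <= t by case: Dt.
have Dth : D (t + 1 * th).
  apply: (time_le _ Dd2); rewrite mul1r addr_ge0 ?(ltW th0) //= lerD2l.
  by rewrite ge_min lexx.
have thm : th * c < k * m.
  apply: (@le_lt_trans _ _ (k * m / (2 * c) * c)).
    by rewrite ler_pM2r // ge_min lexx orbT.
  have -> : k * m / (2 * c) * c = k * m / 2 by field; rewrite gt_eqF.
  by rewrite ltr_pdivrMr // ltr_pMr ?mulr_gt0 // ltr1n.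
(* The support function of the barrier at time t + v. *)
pose w nu v := ((1 - k) * s t nu + k * (rho * dot nu z)) + v * (c * dot nu z).
exists th => // u Du /andP[tu ud] nu nS.
suff : w nu (u - t) <= s (t + 1 * (u - t)) nu.
  rewrite mul1r subrKC; apply: le_trans; rewrite /w mulrDl -mulrA lerD2r.
  have := ler_wpM2l (ltW k1') (rho_le nS).
  by move: (s t nu) (rho * dot nu z) (k)=> *; lra.
have cw : jcont th w.
  move=> [nu' v] /cylP [n'S vb]; apply: cvg_within_filter.
  have FF : Filter (nbhs (nu', v)) by exact: nbhs_filter.
  have c1 : y.1 @[y --> (nu', v)] --> nu' by exact: cvg_fst.
  have c2 : y.2 @[y --> (nu', v)] --> v by exact: cvg_snd.
  have gs := support_has_grad cK K0 (body_max_unique (Kss Dt)) (sphere_neq0 n'S).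
  have c3 : s t y.1 @[y --> (nu', v)] --> s t nu'.
    exact: cvg_comp _ _ c1 (has_grad_continuous gs).
  have c4 : dot y.1 z @[y --> (nu', v)] --> dot nu' z.
    by apply: cvg_dot => //; exact: cvg_cst.
  apply: cvgD; last by apply: cvgM => //; apply: cvgM => //; exact: cvg_cst.
  apply: cvgD; apply: cvgM => //; try exact: cvg_cst.
  by apply: cvgM => //; exact: cvg_cst.
have uth : 0 <= u - t <= th by rewrite subr_ge0 tu /= lerBlDl ltW.
rewrite leNgt; apply/negP => lt.
have Dv v : 0 <= v <= th -> D (t + 1 * v).
  move=> /andP[v0 vb]; apply: time_le Dth.
  by rewrite !mul1r addr_ge0 //= lerD2l.
have [|||nu' [v [r [n'S vb r1 wE wle]]]] :=
    contact (ltW th0) cw (flow_jcont t0 ltr01 Dth).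
- move=> nu' v n'S vb; have [c' c'0 hc'] := support_lower Dt.
  by apply: lt_le_trans c'0 _; apply: hc' => //; exact: Dv.
- move=> nu' n'S; rewrite /w mul0r mulr0 !addr0.
  have := ler_wpM2l (ltW k0) (rho_le n'S).
  by move: (s t nu') (rho * dot nu' z) (k)=> *; lra.
- by exists nu, (u - t).
have vb' : 0 <= v <= th by case/andP: vb => ? ->; rewrite ltW.
have Kv := Kss (Dv v vb').
have r0 : 0 < r by apply: lt_trans r1.
have Sv0 : 0 < s (t + 1 * v) nu'.
  by apply: (support_gt0 Kv (flow_interior (Dv v vb')) (sphere_neq0 n'S)).
have near_nu : `|nu' - nu0| < d1.
  apply: (hm nu' n'S).
  have h1 : s (t + 1 * v) nu' < w nu' v by rewrite wE -[ltLHS]mul1r ltr_pM2r.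
  have h2 : s t nu' <= s (t + 1 * v) nu'.
    apply: (support_nondecreasing n'S _ (Dv v vb')).
    by rewrite t0 /= mul1r lerDl; case/andP: vb'.
  have h3 : v * (c * dot nu' z) <= th * c.
    case/andP: vb' => v0 vth; apply: (@le_trans _ _ (v * c)).
      apply: ler_wpM2l => //; rewrite -[leRHS]mulr1 ler_pM2l //.
      by apply: le_trans (ler_norm _) (dot_sphere_le1 n'S).
    by rewrite ler_pM2r.
  have h4 : k * (s t nu' - rho * dot nu' z) < k * m.
    move: h1 h2 h3 thm; rewrite /w.
    move: (s t nu') (rho * dot nu' z) (v * _) (s (t + _) nu') (k) (m) (th * c).
    by move=> *; lra.
  by move: h4; rewrite ltr_pM2l.
have d1' : is_derive_in [set x : R | 0 <= x <= th] (w nu') v (c * dot nu' z).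
  exact: is_derive_in_affine.
have ct := contact_time vb wE (fun v vb => wle nu' v n'S vb) d1'
  (flow_derive n'S t0 ltr01 Dth vb').
have [Bt Pt [Bpt St]] := profile_body (Kss Dt) n'S.
have [B P [Bp SB]] := profile_body Kv n'S.
have wW x : w x v = (1 - k) * s t x + (k * rho + v * c) * dot x z by rewrite /w; ring.
have cs := contact_space n'S (profile_comb (1 - k) (k * rho + v * c) Pt (profile_dot z nu')) P.
have := cs r _ _; rewrite -wW => /(_ _ wE) cs'.
have z0' := sphere_neq0 n'S.
have dle : det_form nu' Bt <= (r / (1 - k)) ^+ n.-1 * det_form nu' B.
  rewrite -det_formZ //; apply: det_form_le => //.
    by apply: orth_posdefZ => //; rewrite divr_gt0.
  move=> x _; rewrite -[_ *: B]/(_ *: B) -scalemxAr dotZl mulrAC ler_pdivlMr // mulrC.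
  have := cs' _ x; rewrite scaler0 addr0 -scalemxAr dotZl; apply => nu1 n1S.
  by rewrite -wW wle.
have r1' : 1 < r / (1 - k).
  by rewrite ltr_pdivlMr // mul1r (lt_trans _ r1) // ltrBlDr ltrDl.
have ple := powR_scaled_le m0 p0 (lt_trans ltr01 r1') (ltW (det_form_gt0 Bpt))
  (ltW (det_form_gt0 Bp)) dle.
have FtE := flow_speedE Phi p St.
have FvE := flow_speedE Phi p SB.
have := near1 nu' n'S near_nu; move: ct; rewrite FtE FvE mul1r.
have PhiP := Phi0 n'S.
have dP := powR_gt0 (p / n.-1%:R) (det_form_gt0 Bp).
have pw := powR_lt_self p01 r1'.
by move=> le1 lt1; exact: (barrier_speed k1' PhiP dP pw ple le1 lt1).
Qed.

(** Backward in time, the point (rho - (t - u) c) z lies in the body as soon as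
    the speed c is faster than the normal speed at rho z. By concavity the
    support inequalities at one earlier time persist until t; near the normal
    direction they hold at some earlier time, and elsewhere there is room to
    spare at time t. *)
Lemma backward c : 0 < t -> F t nu0 < c * dot nu0 z ->
  exists2 d, 0 < d & forall u, D u -> t - d < u < t ->
    forall nu, sphere nu -> (rho - (t - u) * c) * dot nu z <= s u nu.
Proof.
move=> t0 Fc; have dz := normal_dot_gt0; have F0 := speed_gt0 Dt nuS.
have c0 : 0 < c by rewrite -(pmulr_lgt0 _ dz) (lt_trans F0).
have [e e0 AE] := split_gap Fc.
have /is_derive_inP /(_ e e0) [d1 d10 hd1] := flow nuS Dt.
have A0 : 0 < c * dot nu0 z by rewrite mulr_gt0.
set A := c * dot nu0 z in AE A0.
pose q := 1 - p; have qt0 : 0 < q * t by rewrite mulr_gt0.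
(* The parameter a1 = 1 - eta is so close to 1 that the first-order expansion of
   s in the direction nu0 gives a strict inequality at the time tm a1. *)
pose eta := Num.min 2^-1 (Num.min (d1 / (4 * (q * t))) (e / (2 * A))).
have eta0 : 0 < eta by rewrite !lt_min invr_gt0 ltr0n !divr_gt0 // !mulr_gt0.
have etah : eta <= 2^-1 by rewrite ge_min lexx.
have etad : 4 * (q * t) * eta <= d1.
  by rewrite -ler_pdivlMl ?mulr_gt0 // mulrC !ge_min lexx !orbT.
have etaA : 2 * A * eta <= e.
  by rewrite -ler_pdivlMl ?mulr_gt0 // mulrC !ge_min lexx !orbT.
pose a1 := 1 - eta.
have a1h : 2^-1 <= a1 by rewrite /a1; move: etah => /half_compl.
have a10 : 0 < a1 by apply: lt_le_trans a1h; rewrite invr_gt0.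
have a11 : a1 < 1 by rewrite ltrBlDr ltrDl.
have E1 : 1 - a1 = eta by rewrite /a1 subKr.
clearbody eta.
(* The time change after which s is concave in a, with tm 1 = t. *)
pose tm a := a `^ q * t.
have tm_le a : 0 < a <= 1 -> 0 <= tm a <= t.
  move=> /andP[a0 ale]; rewrite mulr_ge0 ?powR_ge0 ?(ltW t0) //=.
  by rewrite -[leRHS]mul1r ler_pM2r // powR_le1 // (ltW a0).
have Dtm a : 0 < a <= 1 -> D (tm a) by move=> /tm_le h; exact: time_le h Dt.
have tm_up a : 0 < a <= 1 -> t - tm a <= q * t * ((1 - a) / a).
  move=> a01; rewrite -{1}[t]mul1r -mulrBl mulrC [leRHS]mulrAC [leRHS]mulrC.
  by rewrite ler_pM2l //; exact: bernoulli_upper.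
have tm_lo a : 0 < a -> q * t * (1 - a) <= t - tm a.
  move=> a0; rewrite -{2}[t]mul1r -mulrBl mulrAC ler_pM2r //; exact: bernoulli_lower.
have a101 : 0 < a1 <= 1 by rewrite a10 ltW.
pose k nu a := s (tm a) nu - (rho - (1 - a) * (q * t * c)) * dot nu z.
have k1 : 0 < k nu0 a1.
  have h1 := tm_up a1 a101; have h2 := tm_lo a1 a10; rewrite E1 in h1 h2.
  have h3 : 0 <= t - tm a1 by apply: le_trans h2; rewrite mulr_ge0 ?ltW.
  have nE : `|tm a1 - t| = t - tm a1 by rewrite distrC ger0_norm.
  have h4 : t - tm a1 < d1.
    apply: le_lt_trans h1 _; apply: lt_le_trans etad; exact: time_step_small.
  have := hd1 _ (Dtm a1 a101); rewrite nE => /(_ h4) /ler_normlP [h5 _].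
  rewrite /k E1; apply: (earlier_gap_gt0 h5 h1 _ a10 qt0 eta0 _ (esym rho_eq)).
    exact: addr_gt0.
  rewrite -/A AE; apply: (speed_margin _ E1 e0); rewrite -AE; exact: etaA.
have Dtm1 := Dtm a1 a101.
have [d2 d20 hd2] : exists2 d2, 0 < d2 &
    forall nu, sphere nu -> `|nu - nu0| < d2 -> 0 <= k nu a1.
  have FF : Filter (nbhs nu0) by exact: nbhs_filter.
  have ck : k nu a1 @[nu --> nu0] --> k nu0 a1.
    apply: cvgB.
      exact: has_grad_continuous (support_has_grad (body_compact (Kss Dtm1))
        (body_nonempty (Kss Dtm1)) (body_max_unique (Kss Dtm1)) (sphere_neq0 nuS)).
    apply: cvgM; first exact: cvg_cst.
    by apply: cvg_dot; [exact: cvg_id|exact: cvg_cst].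
  have /nbhs_ballP [d2 d20 hd2] : \forall nu \near nu0, 0 < k nu a1.
    exact: (cvgr_gt _ ck _ k1).
  exists d2 => // nu nS nd; apply: ltW; apply: hd2.
  by rewrite -ball_normE /ball_ /= distrC.
have [m m_gt0 hm] := near_normal d20.
pose M := rho + q * t * c.
have M0 : 0 < M by rewrite addr_gt0 // mulr_gt0.
have spos u nu : D u -> sphere nu -> 0 < s u nu.
  by move=> Du nS; apply: (support_gt0 (Kss Du) (flow_interior Du) (sphere_neq0 nS)).
(* Near nu0 the concave function k nu is nonnegative at both a1 and 1; elsewhere
   it is at least m at 1, and bounded below at a1. *)
have kpos a nu : a1 < a < 1 -> (1 - a) * (m + M) <= eta * m -> sphere nu -> 0 <= k nu a.
  move=> /andP[a1a aa1] am nS.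
  have tm1 : tm 1 = t by rewrite /tm powR1 mul1r.
  pose l0 := (1 - a) / eta; pose l1 := (a - a1) / eta.
  have l00 : 0 < l0 by rewrite divr_gt0 // subr_gt0.
  have l10 : 0 < l1 by rewrite divr_gt0 // subr_gt0.
  have l01 : l0 + l1 = 1 by rewrite -mulrDl subrKA E1 mulfV // gt_eqF.
  have la : l0 * a1 + l1 * 1 = a.
    by rewrite mulr1 /l0 /l1 -E1; field; rewrite E1 gt_eqF.
  have D1 : D (1 `^ (1 - p) * t) by have := Dt; rewrite -{1}tm1.
  have D2 : D (tm (l0 * a1 + l1 * 1)).
    by rewrite la; apply: Dtm; rewrite (lt_trans a10) // ltW.
  have := time_concave t0 a10 ltr01 l00 l10 l01 Dtm1 D1 D2 nS.
  rewrite la -/(tm a1) -/(tm 1) -/(tm a) tm1 => conc.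
  have kc : l0 * k nu a1 + l1 * (s t nu - rho * dot nu z) <= k nu a.
    exact: (support_gap_concave (q * t * c) (dot nu z) rho l01 la conc).
  apply: le_trans kc.
  have r1 : 0 <= s t nu - rho * dot nu z by rewrite subr_ge0 rho_le.
  have [lt|ge] := ltP (s t nu - rho * dot nu z) m.
    apply: addr_ge0; last by rewrite mulr_ge0 // ltW.
    by rewrite mulr_ge0 ?(ltW l00) //; apply: (hd2 nu nS); exact: (hm nu nS).
  have k1M : - M <= k nu a1.
    have sp := spos _ _ Dtm1 nS; have := dot_sphere_le1 nS.
    have g0 : 0 < q * t * c by rewrite mulr_gt0.
    rewrite /k E1 => d1'; apply: (support_gap_bound sp (ltW rho0) _ _ d1').
      by rewrite mulr_ge0 // ltW.
    by rewrite ger_pMl // -E1 gerBl ltW.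
  have l0m : l0 * (m + M) <= m by rewrite mulrAC ler_pdivrMr // [leRHS]mulrC.
  exact: interpolation_ge0 l01 l00 l10 k1M ge l0m.
(* The three bounds keep u positive, its parameter a close enough to 1 for the
   interpolation, and rho - (t - u) c positive. *)
pose d := Num.min (t / 2) (Num.min (q * t * (eta * m / (m + M))) (rho / c)).
have mM0 : 0 < m + M by rewrite addr_gt0.
exists d => [|u Du /andP[ud ut] nu nS].
  rewrite /d !lt_min (divr_gt0 rho0 c0) andbT; apply/andP; split.
    by rewrite divr_gt0.
  by rewrite mulr_gt0 // divr_gt0 // mulr_gt0.
have tud : t - u < d by rewrite ltrBlDr -ltrBlDl.
have [ua [ub uc]] : t - u < t / 2 /\ t - u < q * t * (eta * m / (m + M)) /\ t - u < rho / c.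
  by move: tud; rewrite !lt_min => /and3P[].
have u0 := earlier_time_gt0 ua t0.
pose a := (u / t) `^ q^-1.
have ut0 : 0 < u / t by rewrite divr_gt0.
have a0 : 0 < a by rewrite powR_gt0.
have aq : a `^ q = u / t by rewrite -powRrM mulVf ?powRr1 ?(ltW ut0) // gt_eqF.
have tma : tm a = u by rewrite /tm aq divfK // gt_eqF.
have alt1 : a < 1.
  rewrite ltNge; apply/negP => a1le.
  have : 1 `^ q <= a `^ q by apply: ge0_ler_powR; rewrite ?nnegrE ?(ltW q0) ?ler01 ?(ltW a0).
  by rewrite powR1 aq ler_pdivlMr // mul1r leNgt ut.
have h1 := tm_lo a a0; rewrite tma in h1.
have h2 : 1 - a <= eta * m / (m + M).
  by rewrite -(ler_pM2l qt0) (le_trans h1) // ltW.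
have h3 : (1 - a) * (m + M) <= eta * m by rewrite -ler_pdivlMr.
have aa1 : a1 < a.
  rewrite /a1 ltrBlDl -ltrBlDr; apply: le_lt_trans h2 _.
  by rewrite ltr_pdivrMr // ltr_pM2l // ltrDl.
have := kpos a nu _ h3 nS; rewrite aa1 alt1 => /(_ isT).
rewrite /k tma subr_ge0 => h4.
have [dp|dn] := leP 0 (dot nu z).
  apply: le_trans h4; apply: ler_wpM2r => //; rewrite lerD2l lerN2.
  by rewrite mulrA (mulrC (1 - a)) ler_pM2r.
apply: (@le_trans _ _ 0); last by rewrite ltW // spos.
by apply: mulr_ge0_le0; [rewrite subr_ge0 -ler_pdivlMr // ltW|exact: ltW].
Qed.

(** The inverse of the dual support function at z is the radial function r of
    the body, the largest r(u) with r(u) z in K u. Its derivative is the normal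
    speed at the boundary point divided by the inner product of the normal and
    z: from above since the support inequality in the normal direction bounds
    r(u), from below by the lemmas forward and backward. *)
Lemma dual_derivative :
  is_derive_in D (fun u => support_fun (dual_body (K u)) z) t
    (- (sd ^+ 2 * (F t nu0 / dot nu0 z))).
Proof.
have dz := normal_dot_gt0; have F0 := speed_gt0 Dt nuS.
pose ell := F t nu0 / dot nu0 z; have ell0 : 0 < ell by rewrite divr_gt0.
have FE : F t nu0 = ell * dot nu0 z by rewrite /ell divfK // gt_eqF.
pose r u := (support_fun (dual_body (K u)) z)^-1.
have g0 u : D u -> 0 < support_fun (dual_body (K u)) z.
  by move=> Du; apply: (dual_gt0 (Kss Du) (flow_interior Du) z0).
have r_up u : D u -> r u <= s u nu0 / dot nu0 z.
  move=> Du; have Ku := Kss Du; have Iu := flow_interior Du.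
  have su := support_gt0 Ku Iu (sphere_neq0 nuS).
  have := dual_support_ge Ku Iu z0 (sphere_neq0 nuS); rewrite dotC => le.
  rewrite /r -[leRHS]invrK lef_pV2 ?posrE ?invr_gt0 ?divr_gt0 ?g0 //.
  by rewrite invf_div.
have r_lo u x : D u -> 0 < x -> (forall nu, sphere nu -> x * dot nu z <= s u nu) -> x <= r u.
  move=> Du x0 h; have := dual_le (Kss Du) (flow_interior Du) z0 x0 h.
  by rewrite /r => le; rewrite -[leLHS]invrK lef_pV2 ?posrE ?invr_gt0 ?g0.
have dr : is_derive_in D r t ell.
  apply/is_derive_inP => e e0.
  have ed0 : 0 < e * dot nu0 z by rewrite mulr_gt0.
  have /is_derive_inP /(_ _ ed0) [d1 d10 hd1] := flow nuS Dt.
  (* A positive speed between ell - e and ell. *)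
  pose cf := Num.max (ell - e) (ell / 2).
  have cf0 : 0 < cf by rewrite lt_max divr_gt0 ?orbT.
  have cfl : cf < ell by rewrite gt_max ltrBlDr ltrDl e0 ltr_pdivrMr // ltr_pMr // ltr1n.
  have cfe : ell - e <= cf by rewrite le_max lexx.
  have cfF : cf * dot nu0 z < F t nu0 by rewrite FE ltr_pM2r.
  have [d2 d20 hd2] := forward cf0 cfF.
  have cb0 : 0 < ell + e by rewrite addr_gt0.
  have cbF : F t nu0 < (ell + e) * dot nu0 z by rewrite FE ltr_pM2r // ltrDl.
  have [d3 d30 hd3] : exists2 d3, 0 < d3 & forall u, D u -> t - d3 < u < t ->
      forall nu, sphere nu -> (rho - (t - u) * (ell + e)) * dot nu z <= s u nu.
    have [t0|t0] := ltP 0 t; first exact: backward.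
    exists 1 => // u [u0 _] /andP[_ ut]; have := lt_le_trans ut t0.
    by rewrite ltNge u0.
  exists (Num.min (Num.min d1 d2) (Num.min d3 (rho / (ell + e)))) => [|u Du].
    by rewrite !lt_min d10 d20 d30 divr_gt0.
  rewrite !lt_min => /andP[/andP[ud1 ud2] /andP[ud3 ud4]].
  rewrite -[r t]/rho ler_norml; apply/andP; split.
    have [tu|ut] := leP t u.
      have lo := r_lo u (rho + (u - t) * cf) Du.
      have ut0 : 0 <= u - t by rewrite subr_ge0.
      rewrite (ger0_norm ut0) in ud2 *.
      have := lo _ (hd2 u Du _); rewrite tu ltrBDl in ud2 *.
      rewrite ltr_wpDr ?mulr_ge0 ?(ltW cf0) // ud2 => /(_ isT isT) h.
      have h2 : (u - t) * (ell - e) <= (u - t) * cf by rewrite ler_wpM2l.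
      by apply: (radial_forward h h2).
    have nE : `|u - t| = t - u by rewrite distrC gtr0_norm // subr_gt0.
    rewrite nE in ud3 ud4 *.
    have pos : 0 < rho - (t - u) * (ell + e) by rewrite subr_gt0 -ltr_pdivlMr.
    have h3 : t - d3 < u < t by rewrite ut andbT ltrBlDr -ltrBlDl.
    have := r_lo u _ Du pos (hd3 u Du h3); exact: radial_backward.
  have /ler_normlP [_ h] := hd1 u Du ud1.
  have up := r_up u Du.
  apply: (@le_trans _ _ ((s u nu0 - s t nu0 - F t nu0 * (u - t)) / dot nu0 z)).
    by rewrite FE rho_eq (radial_quotient _ _ _ _ (lt0r_neq0 dz)) !lerD2r.
  by rewrite ler_pdivrMr // [leRHS]mulrAC.
have := is_derive_in_inv (f := r) (lt0r_neq0 rho0) dr.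
have -> : (fun u => (r u)^-1) = (fun u => support_fun (dual_body (K u)) z).
  by apply/funext => u; rewrite /r invrK.
by rewrite mulNr [r t ^+ 2]exprVn invrK mulrC.
Qed.

End AtTime.

End Flow.

(** * The evolution of the dual support function *)

(** The power law of the dual flow. Here g is the dual support function at z, e
    is the inverse of the support function at the corresponding normal nu, S'
    and S are the respective values of S_(n-1), and phi is the value of Phi at
    nu. *)
Lemma dual_speed (R : realType) (n : nat) (p phi g e S S' : R) :
  (2 <= n)%N -> 0 < g -> 0 < e -> 0 < S ->
  S' * g ^+ n.+1 * (S * e^-1 ^+ n.+1) = 1 ->
  g ^+ 2 * (phi * S `^ (p / (n%:R - 1)) / (g * e^-1)) =
  phi * ((e ^+ 2) `^ ((n%:R + 1) * p / (2 * (n%:R - 1)) + 2^-1)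
         / g `^ ((n%:R + 1) * p / (n%:R - 1) - 1)) * S' `^ (- (p / (n%:R - 1))).
Proof.
move=> n2 g0 e0 S0 rel.
have m0 : (n%:R - 1 : R) != 0.
  by rewrite subr_eq0 (eqr_nat R n 1); case: n n2 {rel} => [|[]].
set al := p / (n%:R - 1).
have E1 : (n%:R + 1) * p / (2 * (n%:R - 1)) + 2^-1 = 2^-1 * (n.+1%:R * al + 1).
  by rewrite /al -natr1; field.
have E2 : (n%:R + 1) * p / (n%:R - 1) - 1 = n.+1%:R * al - 1.
  by rewrite /al -natr1; field.
have gn0 : 0 < g ^+ n.+1 by rewrite exprn_gt0.
have en0 : 0 < e ^+ n.+1 by rewrite exprn_gt0.
have S'E : S' = e ^+ n.+1 / (g ^+ n.+1 * S).
  apply: (mulIf (lt0r_neq0 (mulr_gt0 gn0 S0))).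
  rewrite divfK ?gt_eqF ?mulr_gt0 // -[RHS]mul1r -rel exprVn.
  by field; rewrite gt_eqF.
have powE (x : R) k : 0 < x -> (x ^+ k) `^ al = x `^ (k%:R * al).
  by move=> x0; rewrite powRrM powR_mulrn ?ltW.
have e2 : (e ^+ 2) `^ (2^-1 * (n.+1%:R * al + 1)) = e `^ (n.+1%:R * al) * e.
  rewrite [LHS]powRrM powR12_sqrt ?exprn_ge0 ?(ltW e0) // sqrtr_sqr gtr0_norm //.
  by rewrite powRD ?powRr1 ?(ltW e0) ?(gt_eqF e0) ?implybT.
have g1 : g `^ (n.+1%:R * al - 1) = g `^ (n.+1%:R * al) / g.
  by rewrite powRB ?powRr1 ?(ltW g0) ?(gt_eqF g0) ?implybT.
have S'al : S' `^ (- al) = g `^ (n.+1%:R * al) * S `^ al / e `^ (n.+1%:R * al).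
  have gS0 : 0 < g ^+ n.+1 * S by rewrite mulr_gt0.
  rewrite S'E powRN powRM ?invr_ge0 ?ltW // -[_^-1 in X in _ * X]powR_inv1 ?ltW //.
  rewrite powRAC powR_inv1 ?powR_ge0 // powRM ?ltW // !powE //.
  by rewrite invfM invrK mulrC.
rewrite E1 E2 e2 g1 S'al.
have a0 : 0 < e `^ (n.+1%:R * al) by rewrite powR_gt0.
have b0 : 0 < g `^ (n.+1%:R * al) by rewrite powR_gt0.
have c0 : 0 < S `^ al by rewrite powR_gt0.
move: a0 b0 c0; move: (e `^ _) (g `^ _) (S `^ _) => a b c a0 b0 c0.
by field; rewrite !gt_eqF.
Qed.

Theorem theorem2p2 (R : realType) (n : nat) (p : R) (Phi : 'rV[R]_n -> R)
    (T : \bar R) (K : R -> set 'rV[R]_n) :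
  (2 <= n)%N -> 0 < p < 1 -> (0 < T)%E ->
  smooth_sphere Phi ->
  (forall z, sphere z -> 0 < Phi z) ->
  (forall t : R, 0 <= t -> (t%:E < T)%E -> smooth_strictly_convex (K t)) ->
  interior (K 0) 0 ->
  (forall (z : 'rV[R]_n) (t : R), sphere z -> 0 <= t -> (t%:E < T)%E ->
    is_derive_in [set u : R | 0 <= u /\ (u%:E < T)%E] (fun u => support_fun (K u) z) t
      (Phi z * Sn1 (support_fun (K t)) z `^ (p / (n%:R - 1)))) ->
  forall (z : 'rV[R]_n) (t : R), sphere z -> 0 <= t -> (t%:E < T)%E ->
    let sd := support_fun (dual_body (K t)) in
    let q := sd z ^+ 2 + enorm (sgrad sd z) ^+ 2 in
    is_derive_in [set u : R | 0 <= u /\ (u%:E < T)%E]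
      (fun u => support_fun (dual_body (K u)) z) t
      (- Phi ((Num.sqrt q)^-1 *: (sd z *: z + sgrad sd z))
       * (q `^ ((n%:R + 1) * p / (2 * (n%:R - 1)) + 2^-1)
          / sd z `^ ((n%:R + 1) * p / (n%:R - 1) - 1))
       * Sn1 sd z `^ (- (p / (n%:R - 1)))).
Proof.
move=> n2 p01 T0 Phi_smooth Phi0 Kss0 K00 flow0 z t zS t0 tT sd q.
have nE : n.-1%:R = n%:R - 1 :> R by rewrite -[in RHS](ltn_predK n2) -natr1 addrK.
have Kss u : 0 <= u /\ (u%:E < T)%E -> smooth_strictly_convex (K u).
  by move=> [u0 uT]; exact: Kss0.
have flow x u : sphere x -> 0 <= u /\ (u%:E < T)%E ->
    is_derive_in [set u : R | 0 <= u /\ (u%:E < T)%E]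
      (fun u => support_fun (K u) x) u (flow_speed p Phi K u x).
  by move=> xS [u0 uT]; rewrite /flow_speed nE; exact: flow0.
have Dt : 0 <= t /\ (t%:E < T)%E by [].
have Kt := Kss t Dt; have It := flow_interior Phi0 Kss K00 flow Dt.
have z0 := sphere_neq0 zS.
have nuS := dual_normal_sphere Kt It zS.
have g0 : 0 < sd z by exact: (dual_gt0 Kt It z0).
have e0 : 0 < enorm (max_point (dual_body (K t)) z).
  rewrite -invr_gt0 -(dual_normal_support Kt It zS).
  exact: (support_gt0 Kt It (sphere_neq0 nuS)).
have S0 := Sn1_body_gt0 Kt nuS.
have qE : q = enorm (max_point (dual_body (K t)) z) ^+ 2 by exact: dual_sqnorm.
have argE : (Num.sqrt q)^-1 *: (sd z *: z + sgrad sd z) = dual_normal (K t) z.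
  rewrite qE sqrtr_sqr gtr0_norm // /sd (dual_sgrad Kt It zS) addrCA.
  by rewrite subrr addr0.
have rel := dual_Sn1 Kt It zS; rewrite (dual_normal_support Kt It zS) in rel.
have := dual_derivative n2 p01 Phi_smooth Phi0 Kss K00 flow Dt zS.
rewrite (dual_normal_dot Kt It zS) (dual_normal_support Kt It zS) /flow_speed nE.
by rewrite (dual_speed p _ n2 g0 e0 S0 rel) argE qE !mulNr.
Qed.
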